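(* Let $d\geq 1$ and let $\mathbb P$ be an i.i.d. product probability measure on $\Omega$ with forbidden direction $-\hat u$ for some $\hat u\in\mathbb R^d\setminus\{0\}$, i.e. $\mathbb P\big(\sum_{z:\,z\cdot\hat u\geq 0}\pi_{0z}(\omega)=1\big)=1$. Assume the non-nestling hypothesis (N): there is a deterministic $\delta>0$ with $\mathbb P\big(\sum_z z\cdot\hat u\,\pi_{0z}\geq\delta\big)=1$; and the moment hypothesis (M) with some $p>1$: there is a deterministic $M>0$ with $\mathbb P\big(\sum_z|z|^p\pi_{0z}\leq M^p\big)=1$. Then there exists a probability measure $\mathbb P_\infty$ on $(\Omega,\mathfrak S)$ that is invariant for the Markov process with transition kernel $\hat\pi$ and has the following properties: (a) $\mathbb P_\infty$ is absolutely continuous relative to $\mathbb P$ when restricted to $\mathfrak S_k$ for every $k\leq 0$. Moreover $\mathbb P=\mathbb P_\infty$ on $\mathfrak S_1$, and the two measures are mutually absolutely continuous on $\mathfrak S_0$. (b) The Markov process with kernel $\hat\pi$ and initial distribution $\mathbb P_\infty$ is ergodic. (c) There can be at most one probability measure that is invariant under $\hat\pi$, absolutely continuous relative to $\mathbb P$ on $\mathfrak S_k$ for all $k\leq 0$, and satisfies (b). Moreover, $\mathbb P_n(A)=P_0(T_{X_n}\omega\in A)$ converges to $\mathbb P_\infty(A)$ for every $A\in\mathfrak S_k$ and every $k\leq 0$.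
   Context: Let $\mathcal P=\{(p_z)_{z\in\mathbb Z^d}: p_z\geq 0,\sum_z p_z=1\}$ and $\Omega=\mathcal P^{\mathbb Z^d}$ with product $\sigma$-field $\mathfrak S$; an environment is $\omega=(\omega_x)_{x\in\mathbb Z^d}$ with $\omega_x=(\pi_{x,x+y}(\omega))_{y\in\mathbb Z^d}$. Shifts: $\pi_{xy}(T_z\omega)=\pi_{x+z,y+z}(\omega)$. ''$\mathbb P$ is i.i.d. product'' means the $\omega_x$, $x\in\mathbb Z^d$, are i.i.d. under $\mathbb P$. For fixed $\omega$, $P^\omega_z$ (quenched law) is the law of the Markov chain $(X_n)_{n\geq0}$ on $\mathbb Z^d$ with $X_0=z$ and transition probabilities $P^\omega_z(X_{n+1}=y\mid X_n=x)=\pi_{xy}(\omega)$; the annealed law is $P_z(\cdot)=\int P^\omega_z(\cdot)\,\mathbb P(d\omega)$ (jointly on paths and environments). $|\cdot|$ is the $\ell^1$ norm on $\mathbb Z^d$. $\hat\pi$ is the transition kernel on $\Omega$ given by $\hat\pi(\omega,A)=P^\omega_0(T_{X_1}\omega\in A)$ (the environment seen from the particle). For integers $n$, $\mathfrak S_n=\sigma(\omega_x: x\cdot\hat u\geq n)$. *)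

(* Defs.v *)
From HB Require Import structures.
From mathcomp Require Import all_boot all_order all_algebra.
From mathcomp Require Import all_classical all_reals all_analysis.

Set Implicit Arguments.
Unset Strict Implicit.
Unset Printing Implicit Defensive.

Import Order.TTheory GRing.Theory Num.Theory.
Local Open Scope classical_set_scope.
Local Open Scope ring_scope.

Definition site (d : nat) := 'rV[int]_d.

(* Ambient space of environments: w x z = pi_{x, x+z}(w), the probability of
   a jump from x to x+z.  The actual environment space Omega = P^{Z^d} is the
   subset [valid_env] below; all measures considered give it full mass. *)
Definition rawenv (R : realType) (d : nat) := site d -> site d -> R.
HB.instance Definition _ R d := gen_eqMixin (rawenv R d).
HB.instance Definition _ R d := gen_choiceMixin (rawenv R d).
HB.instance Definition _ R d := isPointed.Build (rawenv R d) (fun _ _ => 0%R).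

Definition coord (R : realType) d (x z : site d) (w : rawenv R d) : R := w x z.

Definition coordG (R : realType) d (S : set (site d)) : set (set (rawenv R d)) :=
  [set A | exists x z (B : set R), S x /\ measurable B /\
           A = coord x z @^-1` B].

Definition Env (R : realType) d := g_sigma_algebraType (@coordG R d setT).

Definition sfield (R : realType) d (S : set (site d)) : set (set (Env R d)) :=
  <<s @coordG R d S >>.

Definition dotu (R : realType) d (z : site d) (u : 'rV[R]_d) : R :=
  \sum_(i < d) (z ord0 i)%:~R * u ord0 i.

Definition norm1 d (z : site d) : nat := \sum_(i < d) `|z ord0 i|%N.

Definition frakS (R : realType) d (u : 'rV[R]_d) (n : int) : set (set (Env R d)) :=
  @sfield R d [set x : site d | n%:~R <= dotu x u].

(* shifts: pi_{xy}(T_z w) = pi_{x+z,y+z}(w) *)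
Definition shift (R : realType) d (z : site d) (w : Env R d) : Env R d :=
  fun x v => w (x + z) v.

Definition valid_env (R : realType) d : set (Env R d) :=
  [set w | forall x, (forall z, 0 <= w x z) /\ esum setT (fun z => (w x z)%:E) = 1%E].

Definition zsum (R : realType) d (f : site d -> R) : \bar R :=
  (esum setT (fun z => (Num.max (f z) 0)%:E) - esum setT (fun z => (Num.max (- f z) 0)%:E))%E.

Definition iid_product (R : realType) d (P : probability (Env R d) R) : Prop :=
  (forall (x : site d) (A : set (Env R d)),
      @sfield R d [set 0] A -> P (shift x @^-1` A) = P A) /\
  (forall (S : seq (site d)) (A : site d -> set (Env R d)),
      uniq S -> (forall x, x \in S -> @sfield R d [set x] (A x)) ->
      P (\bigcap_(x in [set x | x \in S]) A x) = (\prod_(x <- S) P (A x))%E).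

(* the kernel hat pi(w, A) = P^w_0(T_{X_1} w in A) = sum_z pi_{0z}(w) 1_A(T_z w) *)
Definition pihat (R : realType) d (w : Env R d) (A : set (Env R d)) : \bar R :=
  esum setT (fun z => (w 0 z * \1_A (shift z w))%:E).

Definition pihat_invariant (R : realType) d (Q : probability (Env R d) R) : Prop :=
  forall A : set (Env R d), measurable A -> (\int[Q]_w pihat w A)%E = Q A.

Definition pihat_ergodic (R : realType) d (Q : probability (Env R d) R) : Prop :=
  forall A : set (Env R d), measurable A ->
    {ae Q, forall w, pihat w A = (\1_A w)%:E} -> Q A = 0%E \/ Q A = 1%E.

(* quenched law of X_n started at 0: qlaw w n x = P^w_0(X_n = x) *)
Fixpoint qlaw (R : realType) d (w : Env R d) (n : nat) (y : site d) : \bar R :=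
  match n with
  | 0 => if y == (0 : site d) then 1%E else 0%E
  | n.+1 => esum setT (fun x => (qlaw w n x * (w x (y - x)%R)%:E)%E)
  end.

Definition Pn (R : realType) d (P : probability (Env R d) R) (n : nat)
    (A : set (Env R d)) : \bar R :=
  (\int[P]_w esum setT (fun x => (qlaw w n x * (\1_A (shift x w))%:E)%E))%E.

Definition abs_cont_on (R : realType) d (Q P : probability (Env R d) R)
    (F : set (set (Env R d))) : Prop :=
  forall A, F A -> P A = 0%E -> Q A = 0%E.

(* Main.v *)
Require Import Defs.
From HB Require Import structures.
From mathcomp Require Import all_boot all_order all_algebra finmap.
From mathcomp Require Import all_classical all_reals all_analysis.
From mathcomp Require Import measurable_realfun ring lra.

(** By (N) and (M) there are [eta, c > 0] such that from every site the walk
    jumps by at least [eta] in direction [u] with quenched probability at least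
    [c].  Beyond such a jump the environment in the half-space ahead of the walk
    is unexplored, so for [f] depending only on [{x . u >= 0}] a transition
    [E (U f)] splits into a regeneration term [c * E f] and the contribution
    [E (K f)] of a positive operator [K] of norm at most [1 - c].  Iterating,
    [E (U^n f)] converges geometrically to [L f = c * sum_i E (K^i f)].

    The exponential moment of [- X_n . u] decays geometrically, so a function of
    [{x . u >= b}] with [b < 0] is carried by [U^m], up to an exponentially
    small error, to a function of [{x . u >= 0}]; hence [E (U^n f)] converges for
    these [f] too.  The limits are countably additive for each [b] and
    consistent, and a Kolmogorov extension (binary coding of environments, and
    nested intervals carrying Lebesgue measure) produces the invariant law.

    The same convergence holds from every initial law [Q] absolutely continuous
    with respect to [P] on [{x . u >= 0}]: by conditioning on the sites behind a
    fixed level for densities depending on finitely many levels, then by a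
    monotone class argument for the Radon-Nikodym density of [Q].  This yields
    uniqueness, and ergodicity follows because the conditioning of the invariant
    law on an invariant event is again invariant and absolutely continuous. *)

Import Order.TTheory GRing.Theory Num.Theory.
Local Open Scope classical_set_scope.
Local Open Scope ring_scope.
Local Open Scope ereal_scope.

Set Implicit Arguments.
Unset Strict Implicit.
Unset Printing Implicit Defensive.

(** Jumps [z] with [z . u = 0] are allowed, so the walk may return to sites of its current level,
    and even the law at the current site need not be fresh; only a jump of at least [eta] leaves
    every site read so far strictly behind. No lower bound on individual jump probabilities is
    assumed, so a long jump is not tied to a particular displacement. Its quenched probability
    varies with the environment; removing the constant [c] rather than the whole probability makes
    the loss of mass, hence the rate of convergence, the same everywhere. For a function that reads
    sites down to level [b] the error after [m] steps is [exp (- b) * rate^m], which is not uniform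
    in [b]. The limit is therefore found separately on each half-space and glued from laws that are
    right only on their own half-space. Laws are treated as countably additive functionals on
    nonnegative functions: these can be composed with operators and summed freely, which suits
    sub-Markov operators such as [K]. *)

Local Notation shift := Defs.shift.

(** * Sums over countable families *)

Section esum_extra.
Context {R : realType}.
Implicit Types T : choiceType.

Lemma esum_exchange T1 T2 (a : T1 -> T2 -> \bar R) :
  (forall i j, 0 <= a i j) ->
  \esum_(i in setT) \esum_(j in setT) a i j =
  \esum_(j in setT) \esum_(i in setT) a i j.
Proof.
move=> a0.
rewrite (@esum_esum _ _ _ setT (fun=> setT))//.
rewrite (@esum_esum _ _ _ setT (fun=> setT) (fun j i => a i j))//.
rewrite (reindex_esum (setT `*`` (fun=> setT)) _ (fun x => (x.2, x.1)))//.
split=> //=.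
- by move=> [i1 i2] [j1 j2] /= _ _ [] -> ->.
- by move=> [i1 i2] _ /=; exists (i2, i1).
Qed.

Lemma esum_ge1 T (a : T -> \bar R) i : (forall i, 0 <= a i) ->
  a i <= \esum_(i in setT) a i.
Proof.
move=> a0; apply: esum_ge; exists [set i]; last by rewrite fsbig_set1.
by split => //; exact: finite_set1.
Qed.

(** For real [c] the inequality [le_esumZ], used for [c] and for its inverse, gives both directions.
    The value [+oo] is covered as well, because path weights and integrals serve as constants
    later. *)
Lemma esumZl T (c : \bar R) (a : T -> \bar R) :
  0 <= c -> (forall i, 0 <= a i) ->
  \esum_(i in setT) (c * a i) = c * \esum_(i in setT) a i.
Proof.
move=> c0 a0.
have le_esumZ (r : R) (b : T -> \bar R) : (0 <= r)%R -> (forall i, 0 <= b i) ->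
    \esum_(i in setT) (r%:E * b i) <= r%:E * \esum_(i in setT) b i.
  move=> r0 b0; apply: ge_ereal_sup => _ /= [X [finX XD] <-].
  rewrite -ge0_mule_fsumr// lee_pmul ?lee_fin//; first exact: fsume_ge0.
  by apply: ereal_sup_ubound; exists X.
case: c c0 => [r r0|_|//].
- rewrite lee_fin in r0; apply/eqP; rewrite eq_le le_esumZ//=.
  have [<-|r_neq0] := eqVneq 0%R r.
    by rewrite mul0e; apply: esum_ge0 => i _; rewrite mul0e.
  have {}r0 : (0 < r)%R by rewrite lt_neqAle r_neq0.
  rewrite -lee_pdivlMl// (le_trans _ (le_esumZ _ _ _ _))//.
  + by apply: le_esum => i _; rewrite muleA -EFinM mulVf ?gt_eqF// mul1e.
  + by rewrite invr_ge0 ltW.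
  + by move=> i; rewrite mule_ge0// lee_fin ltW.
- have [a00|/existsNP[i /eqP ai]] := pselect (forall i, a i = 0).
    rewrite [X in _ = _ * X]esum1// mule0 esum1// => i _.
    by rewrite a00 mule0.
  have ai0 : 0 < a i by rewrite lt_neqAle eq_sym ai a0.
  rewrite gt0_mulye; last exact: lt_le_trans (esum_ge1 i a0).
  have a'0 j : 0 <= +oo * a j by rewrite mule_ge0.
  by apply/eqP; rewrite -leye_eq (le_trans _ (esum_ge1 i a'0))// gt0_mulye.
Qed.

Lemma esumZr T (c : \bar R) (a : T -> \bar R) :
  0 <= c -> (forall i, 0 <= a i) ->
  \esum_(i in setT) (a i * c) = (\esum_(i in setT) a i) * c.
Proof.
by move=> c0 a0; rewrite muleC -esumZl//; apply: eq_esum => i _; rewrite muleC.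
Qed.

Lemma esum_reindex_bij T1 T2 (e : T1 -> T2) (e' : T2 -> T1)
    (a : T2 -> \bar R) : cancel e e' -> cancel e' e ->
  \esum_(j in setT) a j = \esum_(i in setT) a (e i).
Proof.
move=> ee' e'e; apply: (reindex_esum setT setT e); split => //.
- by move=> x y _ _ /(congr1 e'); rewrite !ee'.
- by move=> y _; exists (e' y).
Qed.

Lemma esum_if1 T (i0 : T) (a : T -> \bar R) : 0 <= a i0 ->
  \esum_(i in setT) (if i == i0 then a i else 0) = a i0.
Proof.
move=> a0; rewrite -[RHS](esum_set1 a0) [RHS]esum_mkcond.
apply: eq_esum => i _; have [->|ne] := eqVneq i i0; first by rewrite ifT ?inE.
by rewrite ifF//; apply/negbTE; rewrite notin_setE; apply/eqP.
Qed.

Lemma esum_nneseries (I : countType) (a : I -> \bar R) :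
  (forall i, 0 <= a i) ->
  \esum_(i in setT) a i = \sum_(n <oo) oapp a 0 (pickle_inv n).
Proof.
move=> a0; rewrite nneseries_esumT; last first.
  by move=> n; case: pickle_inv => /=.
rewrite (esumID (range (@choice.pickle I))); last by move=> n _; case: pickle_inv => /=.
rewrite !setTI [X in _ + X]esum1 ?adde0; last first.
  move=> n /= nI; case E : (pickle_inv n) => [i|//]; exfalso; apply: nI.
  by exists i => //; have := @pickle_invK I n; rewrite E.
rewrite esum_image; last by move=> x y _ _; exact: (pcan_inj pickleK_inv).
by apply: eq_esum => i _; rewrite pickleK_inv.
Qed.

Lemma nneseries_esum_exchange T (a : nat -> T -> \bar R) :
  (forall n i, 0 <= a n i) ->
  \sum_(n <oo) \esum_(i in setT) a n i = \esum_(i in setT) \sum_(n <oo) a n i.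
Proof.
move=> a0; rewrite nneseries_esumT; last by move=> n; exact: esum_ge0.
rewrite esum_exchange//; apply: eq_esum => i _.
by rewrite nneseries_esumT.
Qed.

Lemma nneseries2 (f g : \bar R) (a : nat -> \bar R) : 0 <= f -> 0 <= g ->
  a 0%N = f -> a 1%N = g -> (forall n, a n.+2 = 0) ->
  \sum_(n <oo) a n = f + g.
Proof.
move=> f0 g0 a0 a1 a2.
have apos n : 0 <= a n by case: n => [|[|n]]; rewrite ?a0 ?a1 ?a2.
rewrite (@nneseries_split _ _ 0%N 2%N)// big_ltn// big_nat1 a0 a1.
rewrite eseries0 ?adde0// => -[|[|n]]//= _ _; exact: a2.
Qed.

Context d (X : measurableType d).

Lemma measurable_esum (I : countType) (a : I -> X -> \bar R) :
  (forall i x, 0 <= a i x) -> (forall i, measurable_fun setT (a i)) ->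
  measurable_fun setT (fun x => \esum_(i in setT) a i x).
Proof.
move=> a0 ma; under eq_fun do rewrite esum_nneseries//.
apply: ge0_emeasurable_sum.
- by move=> k x _ _; case: pickle_inv => /=.
- by move=> k _; case: pickle_inv => /= [i|]; [exact: ma|exact: measurable_cst].
Qed.

Lemma integral_esum (mu : {measure set X -> \bar R}) (I : countType)
    (a : I -> X -> \bar R) :
  (forall i x, 0 <= a i x) -> (forall i, measurable_fun setT (a i)) ->
  \int[mu]_x (\esum_(i in setT) a i x) =
  \esum_(i in setT) \int[mu]_x a i x.
Proof.
move=> a0 ma; under eq_integral do rewrite esum_nneseries//.
rewrite integral_nneseries//.
- rewrite esum_nneseries; last by move=> i; exact: integral_ge0.
  apply: eq_eseriesr => n _; case: pickle_inv => /= [//|].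
  by rewrite integral0.
- by move=> k; case: pickle_inv => /= [i|]; [exact: ma|exact: measurable_cst].
- by move=> k x _; case: pickle_inv => /=.
Qed.

End esum_extra.

(** * Countably additive functionals on nonnegative functions *)

Section nonneg_measurable.
Context d (X : measurableType d) (R : realType).
Implicit Types f g : X -> \bar R.

Definition nnm f := (forall x, 0 <= f x) /\ measurable_fun setT f.

Lemma nnm_ge0 f x : nnm f -> 0 <= f x. Proof. by case. Qed.

Lemma nnm_cst (c : \bar R) : 0 <= c -> nnm (fun=> c).
Proof. by move=> c0; split=> // _; exact: measurable_cst. Qed.

Lemma nnm_indic (A : set X) : measurable A -> nnm (fun x => (\1_A x)%:E).
Proof.
move=> mA; split => [x|]; first by rewrite lee_fin.
by apply/measurable_EFinP; exact: measurable_indic.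
Qed.

Lemma nnmD f g : nnm f -> nnm g -> nnm (fun x => f x + g x).
Proof.
move=> [f0 mf] [g0 mg]; split=> [x|]; first by rewrite adde_ge0.
exact: emeasurable_funD.
Qed.

Lemma nnmM f g : nnm f -> nnm g -> nnm (fun x => f x * g x).
Proof.
move=> [f0 mf] [g0 mg]; split=> [x|]; first by rewrite mule_ge0.
exact: emeasurable_funM.
Qed.

Lemma nnmZ (c : \bar R) f : 0 <= c -> nnm f -> nnm (fun x => c * f x).
Proof. by move=> c0 nf; apply: nnmM => //; exact: nnm_cst. Qed.

Lemma nnm_nneseries (F : nat -> X -> \bar R) : (forall n, nnm (F n)) ->
  nnm (fun x => \sum_(n <oo) F n x).
Proof.
move=> nF; split => [x|].
  by apply: nneseries_ge0 => n _ _; exact: nnm_ge0.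
apply: ge0_emeasurable_sum; last by move=> n _; case: (nF n).
by move=> n x _ _; exact: nnm_ge0.
Qed.

Lemma nnm_esum (I : countType) (F : I -> X -> \bar R) :
  (forall i, nnm (F i)) -> nnm (fun x => \esum_(i in setT) F i x).
Proof.
move=> nF; split => [x|]; first by apply: esum_ge0 => i _; exact: nnm_ge0.
by apply: measurable_esum => [i x|i]; [exact: nnm_ge0|case: (nF i)].
Qed.

Lemma nnm_comp d' (Y : measurableType d') (h : Y -> X) f :
  measurable_fun setT h -> nnm f ->
  (forall y, 0 <= f (h y)) /\ measurable_fun setT (fun y => f (h y)).
Proof. by move=> mh [f0 mf]; split => //; exact: measurableT_comp mf mh. Qed.

Section induction.
Import HBNNSimple.
Variable Pr : (X -> \bar R) -> Prop.
Hypothesis PrI : forall A, measurable A -> Pr (fun x => (\1_A x)%:E).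
Hypothesis PrZ : forall (r : R) f, (0 <= r)%R -> nnm f -> Pr f ->
  Pr (fun x => r%:E * f x).
Hypothesis PrS : forall F, (forall n, nnm (F n)) -> (forall n, Pr (F n)) ->
  Pr (fun x => \sum_(n <oo) F n x).

Let Pr0 : Pr (fun=> 0).
Proof.
have := PrI (@measurable0 _ X); congr Pr.
by apply/funext => x; rewrite indic0.
Qed.

Let PrD f g : nnm f -> nnm g -> Pr f -> Pr g -> Pr (fun x => f x + g x).
Proof.
move=> nf ng Pf Pg; pose F n := if n is n'.+1 then
  if n' is _.+1 then (fun=> 0) else g else f.
have := PrS (F := F); rewrite (_ : (fun x => f x + g x) = fun x => \sum_(n <oo) F n x).
  by apply; case=> [|[|n]]//; exact: nnm_cst.
by apply/funext => x; rewrite (@nneseries2 _ (f x) (g x))//; exact: nnm_ge0.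
Qed.

Let Pr_simple (h : X -> R) : measurable_fun setT h -> (forall x, 0 <= h x)%R ->
  finite_set (range h) -> Pr (fun x => (h x)%:E).
Proof.
move=> mh h0 finh.
have -> : (fun x => (h x)%:E) = fun x =>
    \sum_(y <- fset_set (range h)) y%:E * (\1_(h @^-1` [set y]) x)%:E.
  apply/funext => x; rewrite -fsbig_finite//= (fsbigD1 (h x))//=; last first.
    by exists x.
  rewrite indicE mem_set// mule1 fsbig1 ?adde0// => y [_ /= yhx].
  by rewrite indicE memNset ?mule0//= => /esym.
have: forall y, y \in enum_fset (fset_set (range h)) -> (0 <= y)%R.
  move=> y; rewrite -[_ \in _]/(y \in fset_set (range h)).
  by rewrite in_fset_set// inE => -[x _ <-].
elim: (enum_fset (fset_set (range h))) => [_|y s ih ys].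
  by under eq_fun do rewrite big_nil.
under eq_fun do rewrite big_cons.
have mhy z : measurable (h @^-1` [set z]) by rewrite -[X in measurable X]setTI; exact: mh.
have y0 : (0 <= y)%R by apply: ys; rewrite mem_head.
apply: PrD.
- by apply: nnmZ; [rewrite lee_fin|exact: nnm_indic].
- split => [x|].
    rewrite big_seq; apply: sume_ge0 => z zs; apply: mule_ge0 => //.
    by rewrite lee_fin; apply: ys; rewrite inE zs orbT.
  apply: emeasurable_sum => z; apply: measurable_funeM.
  by case: (nnm_indic (mhy z)).
- by apply: PrZ => //; [exact: nnm_indic|exact: PrI].
- by apply: ih => z zs; apply: ys; rewrite inE zs orbT.
Qed.

(** [f] is the series of the increments of an increasing simple approximation. Each increment is
    simple and nonnegative, so closure under countable sums replaces the usual monotone limit, and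
    neither limits nor differences enter the hypotheses on [Pr]. *)
Lemma nnm_ind f : nnm f -> Pr f.
Proof.
move=> [f0 mf]; pose g := nnsfun_approx measurableT mf.
pose F n x := if n is n'.+1 then (g n x - g n' x)%R else g 0%N x.
have gnd n x : (g n x <= g n.+1 x)%R.
  by have /lefP := nd_nnsfun_approx measurableT mf (leqnSn n); apply.
have mF n : measurable_fun setT (F n).
  by case: n => [|n]; rewrite /F//; apply: measurable_funB.
have F0 n x : (0 <= F n x)%R by case: n => [|n] //=; rewrite subr_ge0.
have finF n : finite_set (range (F n)).
  case: n => [|n]; first exact: fimfunP.
  exact: (finite_image11 (fun a b => (a - b)%R)).
have -> : f = fun x => \sum_(n <oo) (F n x)%:E.
  apply/funext => x; apply/esym/cvg_lim => //.
  rewrite -(cvg_shiftS _ _) [X in X @ \oo --> _](_ : _ = EFin \o g ^~ x).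
    exact: cvg_nnsfun_approx.
  apply/funext => n /=; elim: n => [|n ih]; first by rewrite big_nat1.
  by rewrite big_nat_recr//= ih -EFinD addrCA subrr addr0.
apply: PrS => n; last exact: Pr_simple.
split => [x|]; first by rewrite lee_fin.
by apply/measurable_EFinP.
Qed.

End induction.
End nonneg_measurable.

Section sigma_linear.
Context d (X : measurableType d) (R : realType).
Implicit Types (f : X -> \bar R) (I J : (X -> \bar R) -> \bar R).

(** On nonnegative measurable functions these are exactly the integrals against measures, see
    [sigma_linear_integral] and [sigma_linear_measure]. In this form the property passes through
    operators and series without building a measure each time. *)
Definition sigma_linear I :=
  [/\ forall f, nnm f -> 0 <= I f,
      forall F, (forall n, nnm (F n)) ->
        I (fun x => \sum_(n <oo) F n x) = \sum_(n <oo) I (F n) &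
      forall (r : R) f, (0 <= r)%R -> nnm f -> I (fun x => r%:E * f x) = r%:E * I f].

Lemma sigma_linear_ext I J : sigma_linear I -> sigma_linear J ->
  (forall A, measurable A -> I (fun x => (\1_A x)%:E) = J (fun x => (\1_A x)%:E)) ->
  forall f, nnm f -> I f = J f.
Proof.
move=> [_ IS IZ] [_ JS JZ] IJ; apply: nnm_ind => //.
- by move=> r f r0 nf IJf; rewrite IZ// JZ// IJf.
- by move=> F nF IJF; rewrite IS// JS//; apply: eq_eseriesr => n _.
Qed.

Lemma sigma_linear_integral (mu : {measure set X -> \bar R}) :
  sigma_linear (fun f => \int[mu]_x f x).
Proof.
split.
- by move=> f [f0 _]; exact: integral_ge0.
- by move=> F nF; rewrite integral_nneseries// => n; case: (nF n).
- by move=> r f r0 [f0 mf]; rewrite ge0_integralZl_EFin.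
Qed.

Section measure_of_functional.
Variable I : (X -> \bar R) -> \bar R.
Hypothesis sI : sigma_linear I.

(** The value [0] off the measurable sets is a default: a measure must be nonnegative on every set,
    while [I] is only controlled on measurable functions. *)
Definition functional_measure (A : set X) : \bar R :=
  if `[< measurable A >] then I (fun x => (\1_A x)%:E) else 0.

Let mE A : measurable A -> functional_measure A = I (fun x => (\1_A x)%:E).
Proof. by move=> mA; rewrite /functional_measure; case: asboolP. Qed.

Let m0 : functional_measure set0 = 0.
Proof.
case: sI => _ _ IZ; rewrite mE//; have := IZ 0%R (fun=> 0) (lexx _) (nnm_cst _ (lexx _)).
by rewrite [X in _ = X]mul0e => <-; congr I; apply/funext => x; rewrite indic0 mul0e.
Qed.

Let mge0 A : 0 <= functional_measure A.
Proof.
case: sI => I0 _ _; rewrite /functional_measure; case: asboolP => // mA.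
exact/I0/nnm_indic.
Qed.

Let msadd : semi_sigma_additive functional_measure.
Proof.
case: sI => I0 IS _ F mF tF mUF; rewrite mE//.
rewrite (_ : (fun x => _) = fun x => \sum_(n <oo) (\1_(F n) x)%:E).
  rewrite IS; last by move=> n; exact: nnm_indic.
  rewrite (@eq_eseriesr _ _ (fun n => functional_measure (F n))) => [|n _].
    by apply: is_cvg_ereal_nneg_natsum_cond => n _ _; exact: mge0.
  by rewrite mE.
by apply/funext => x; rewrite indic_bigcup.
Qed.

HB.instance Definition _ := isMeasure.Build _ _ _ functional_measure m0 mge0 msadd.

Lemma sigma_linear_measure : exists mu : {measure set X -> \bar R},
  forall f, nnm f -> I f = \int[mu]_x f x.
Proof.
exists functional_measure; apply: sigma_linear_ext => //.
  exact: sigma_linear_integral.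
by move=> A mA; rewrite integral_indic// setIT -mE.
Qed.

Section probability_of_functional.
Hypothesis I1 : I (fun=> 1) = 1.

Let mT : functional_measure setT = 1.
Proof.
by rewrite mE// -[RHS]I1; congr I; apply/funext => x; rewrite indicT.
Qed.

HB.instance Definition _ := Measure_isProbability.Build _ _ _ functional_measure mT.

Lemma sigma_linear_probability : exists Q : probability X R,
  forall f, nnm f -> I f = \int[Q]_x f x.
Proof.
exists functional_measure; apply: sigma_linear_ext => //.
  exact: sigma_linear_integral.
by move=> A mA; rewrite integral_indic// setIT -mE.
Qed.

End probability_of_functional.

End measure_of_functional.

Lemma sigma_linear_unique (G : set (set X)) I J :
  sigma_linear I -> sigma_linear J ->
  @measurable _ X = <<s G >> -> setI_closed G ->
  I (fun=> 1) = J (fun=> 1) -> I (fun=> 1) < +oo ->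
  (forall A, G A -> I (fun x => (\1_A x)%:E) = J (fun x => (\1_A x)%:E)) ->
  forall f, nnm f -> I f = J f.
Proof.
move=> sI sJ mG GI IJ1 I1 IJ.
have [mu Imu] := sigma_linear_measure sI.
have [nu Jnu] := sigma_linear_measure sJ.
have T1 : (fun x : X => (\1_setT x : R)%:E) = fun=> 1.
  by apply/funext => x; rewrite indicT.
have IE A : measurable A -> I (fun x => (\1_A x)%:E) = mu A.
  by move=> mA; rewrite Imu ?integral_indic ?setIT//; exact: nnm_indic.
have JE A : measurable A -> J (fun x => (\1_A x)%:E) = nu A.
  by move=> mA; rewrite Jnu ?integral_indic ?setIT//; exact: nnm_indic.
(* Uniqueness asks for a cover by sets of the class with finite mass; once [setT] has joined the
   class, the constant cover serves. *)
pose G' := G `|` [set setT].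
have G'm : G' `<=` @measurable _ X.
  by move=> A [GA|->//]; rewrite mG; exact: sub_sigma_algebra.
have G'E A : G' A -> I (fun x => (\1_A x)%:E) = J (fun x => (\1_A x)%:E).
  by move=> [/IJ//|->]; rewrite T1.
apply: sigma_linear_ext => // A mA; rewrite IE// JE//.
apply: (measure_unique G' (fun=> setT)) => //.
- apply/seteqP; split; last first.
    by apply: smallest_sub => //; exact: sigma_algebra_measurable.
  by rewrite mG; apply: sub_sigma_algebra2 => B; left.
- move=> B C [GB|->] [GC|->]; rewrite ?setIT ?setTI; [by left; exact: GI|by left|by left|by right].
- by move=> _; right.
- by apply/seteqP; split => // x _; exists 0%N.
- by move=> B GB; rewrite -IE ?G'E ?JE//; exact: G'm.
- by move=> _; rewrite -IE// T1.
Qed.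

Lemma sigma_linearD I f g : sigma_linear I -> nnm f -> nnm g ->
  I (fun x => f x + g x) = I f + I g.
Proof.
move=> /sigma_linear_measure[mu Imu] nf ng.
by rewrite !Imu//; [rewrite ge0_integralD//; case: nf => []; case: ng|exact: nnmD].
Qed.

Lemma sigma_linear_le I f g : sigma_linear I -> nnm f -> nnm g ->
  (forall x, f x <= g x) -> I f <= I g.
Proof.
move=> /sigma_linear_measure[mu Imu] nf ng fg; rewrite !Imu//.
by apply: ge0_le_integral => //; [case: nf|case: nf|case: ng].
Qed.

Lemma sigma_linear_esum (K : countType) (c : K -> (X -> \bar R) -> \bar R) :
  (forall k, sigma_linear (c k)) ->
  sigma_linear (fun f => \esum_(k in setT) c k f).
Proof.
move=> sc; have c0 k f : nnm f -> 0 <= c k f by case: (sc k) => c0 _ _; exact: c0.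
split.
- by move=> f nf; apply: esum_ge0 => k _; exact: c0.
- move=> F nF; rewrite nneseries_esum_exchange//; last by move=> n k; exact: c0.
  by apply: eq_esum => k _; case: (sc k) => _ ->.
- move=> r f r0 nf; rewrite -esumZl//; last by move=> k; exact: c0.
  by apply: eq_esum => k _; case: (sc k) => _ _ ->.
Qed.

Lemma sigma_linearZ (c : \bar R) I : 0 <= c -> sigma_linear I ->
  sigma_linear (fun f => c * I f).
Proof.
move=> c0 [I0 IS IZ]; split.
- by move=> f nf; rewrite mule_ge0// I0.
- move=> F nF; have IF0 n : 0 <= I (F n) by exact: I0.
  rewrite IS// !nneseries_esumT ?esumZl// => n.
  by rewrite mule_ge0.
- by move=> r f r0 nf; rewrite IZ// muleCA.
Qed.

Lemma sigma_linear_add I J : sigma_linear I -> sigma_linear J ->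
  sigma_linear (fun f => I f + J f).
Proof.
move=> [I0 IS IZ] [J0 JS JZ]; split.
- by move=> f nf; rewrite adde_ge0 ?I0 ?J0.
- by move=> F nF; rewrite IS// JS// nneseriesD// => n _ _; rewrite ?I0 ?J0.
- by move=> r f r0 nf; rewrite IZ// JZ// ge0_muleDr ?I0 ?J0.
Qed.

Lemma sigma_linear_eval (x : X) : sigma_linear (fun f => f x).
Proof. by split => // f []. Qed.

End sigma_linear.

(** With [I] a measure on [X] and [T] a kernel from [X] to [Y], the composite is the image of the
    measure under the kernel. *)
Lemma sigma_linear_comp d d' (X : measurableType d) (Y : measurableType d')
    (R : realType) (I : (X -> \bar R) -> \bar R)
    (T : (Y -> \bar R) -> X -> \bar R) :
  sigma_linear I -> (forall f, nnm f -> nnm (T f)) ->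
  (forall x, sigma_linear (fun f => T f x)) ->
  sigma_linear (fun f => I (T f)).
Proof.
move=> [I0 IS IZ] nT sT; split.
- by move=> f nf; exact/I0/nT.
- move=> F nF; rewrite -IS; last by move=> n; exact/nT.
  by congr I; apply/funext => x; case: (sT x) => _ ->.
- move=> r f r0 nf; rewrite -IZ//; last exact: nT.
  by congr I; apply/funext => x; case: (sT x) => _ _ ->.
Qed.

Lemma sigma_linearMl d (X : measurableType d) (R : realType)
    (mu : {measure set X -> \bar R}) (h : X -> \bar R) :
  nnm h -> sigma_linear (fun f => \int[mu]_x (h x * f x)).
Proof.
move=> nh.
apply: (sigma_linear_comp (T := fun f x => h x * f x) (sigma_linear_integral mu)).
  by move=> f nf; exact: nnmM.
by move=> x; apply: sigma_linearZ; [exact: nnm_ge0|exact: sigma_linear_eval].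
Qed.

(** * Functions of the environment on a set of sites *)

Section environments.
Context {R : realType} {d : nat}.
Local Notation Env := (Env R d).
Local Notation site := (site d).
Implicit Types (S : set site) (x y z : site) (A : set Env).

(** For measurable sets this amounts to membership in the sigma-field of the sites of [S], by
    [sfieldP]. It passes to sums, products and shifts pointwise, without any measurability
    argument. *)
Definition dep (T : Type) S (f : Env -> T) :=
  forall w w' : Env, (forall x, S x -> w x = w' x) -> f w = f w'.

Lemma depS T S S' (f : Env -> T) : S `<=` S' -> dep S f -> dep S' f.
Proof. by move=> SS' df w w' ww'; apply: df => x /SS'; exact: ww'. Qed.

Lemma dep_indic S A : dep S A -> dep S (fun w => (\1_A w)%:E : \bar R).
Proof.
move=> dA w w' /dA AA; rewrite !indicE.
by have -> : (w \in A) = (w' \in A) by apply/idP/idP; rewrite !inE AA.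
Qed.

Lemma measurable_coord x z : measurable_fun [set: Env] (fun w => w x z).
Proof.
move=> _ B mB; rewrite setTI; apply: sub_sigma_algebra.
by exists x, z, B.
Qed.

Lemma measurable_to_Env d' (X : measurableType d') (h : X -> Env) :
  (forall x z, measurable_fun setT (fun t => h t x z)) -> measurable_fun setT h.
Proof.
move=> mh; apply: (@measurability _ _ X Env setT h (@coordG R d setT) erefl).
move=> _ /= [_ [x [z [B [_ [mB ->]]]]] <-].
exact: mh.
Qed.

Lemma shiftD x y (w : Env) : shift x (shift y w) = shift (x + y)%R w.
Proof. by apply/funext => v; rewrite /shift addrA addrAC -addrA (addrC y). Qed.

Lemma shift0 (w : Env) : shift (0%R : site) w = w.
Proof. by apply/funext => v; rewrite /shift addr0. Qed.

Lemma measurable_shift x : measurable_fun setT (@shift R d x).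
Proof. by apply: measurable_to_Env => y z; exact: measurable_coord. Qed.

Lemma dep_shift T S (f : Env -> T) x :
  dep S f -> dep [set y | S (y - x)%R] (fun w => f (shift x w)).
Proof.
move=> df w w' ww'; apply: df => y Sy; rewrite /shift; apply: ww' => /=.
by rewrite addrK.
Qed.

Definition splice S (w w' : Env) : Env := fun x => if x \in S then w x else w' x.

Lemma measurable_splicel S w' : measurable_fun setT (fun w => splice S w w').
Proof.
apply: measurable_to_Env => x z; rewrite /splice; case: (x \in S).
  exact: measurable_coord.
exact: measurable_cst.
Qed.

Lemma measurable_splice S :
  measurable_fun [set: Env * Env] (fun w => splice S w.1 w.2).
Proof.
apply: measurable_to_Env => x z; rewrite /splice; case: (x \in S).
  exact: (measurableT_comp (measurable_coord x z) measurable_fst).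
exact: (measurableT_comp (measurable_coord x z) measurable_snd).
Qed.

Lemma dep_splicel T S (f : Env -> T) w w' : dep S f -> f (splice S w w') = f w.
Proof. by apply => x Sx; rewrite /splice mem_set. Qed.

Lemma dep_splicer T S S' (f : Env -> T) w w' :
  S `&` S' = set0 -> dep S' f -> f (splice S w w') = f w'.
Proof.
move=> SS'; apply => x S'x; rewrite /splice memNset// => Sx.
by have : (S `&` S') x by []; rewrite SS'.
Qed.

Lemma sfield_measurable S A : @sfield R d S A -> measurable A.
Proof.
apply: sub_sigma_algebra2 => B [x [z [C [_ [mC ->]]]]].
by exists x, z, C.
Qed.

Lemma sfield_dep S A : @sfield R d S A -> dep S A.
Proof.
pose H := [set A : set Env | dep S A].
suff : <<s @coordG R d S >> `<=` H by apply.
apply: smallest_sub; first split.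
- by [].
- by move=> B dB w w' ww'; rewrite !setTD /setC /= (dB _ _ ww').
- move=> F dF w w' ww'; apply/propext; split=> -[n _ Fn]; exists n => //.
    by rewrite -(dF n _ _ ww').
  by rewrite (dF n _ _ ww').
- move=> B [x [z [C [Sx [mC ->]]]]] w w' ww'.
  by change (C (w x z) = C (w' x z)); rewrite ww'.
Qed.

(** A set that reads only [S] equals its preimage under the map resetting all other sites to a
    constant environment, and that map pulls every measurable set back into the sigma-field of
    [S]. *)
Lemma sfieldP S A : @sfield R d S A <-> measurable A /\ dep S A.
Proof.
split => [sA|[mA dA]]; first by split; [exact: sfield_measurable sA|exact: sfield_dep].
pose w0 : Env := fun _ _ => 0%R.
pose H := [set A : set Env | @sfield R d S ((fun w => splice S w w0) @^-1` A)].
have sub : <<s @coordG R d setT >> `<=` H.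
  have [s0 sC sU] := @smallest_sigma_algebra _ setT (@coordG R d S).
  apply: smallest_sub; first split.
  - by rewrite /H /= preimage_set0.
  - by move=> B HB; rewrite /H /= setTD preimage_setC -setTD; exact: sC.
  - by move=> F HF; rewrite /H /= preimage_bigcup; exact: sU.
  - move=> B [x [z [C [_ [mC ->]]]]]; rewrite /H /=.
    have [xS|xS] := boolP (x \in S).
      apply: sub_sigma_algebra; exists x, z, C; split; [exact: set_mem|split => //].
      apply/funext => w; change (C (splice S w w0 x z) = C (w x z)).
      by rewrite /splice xS.
    have Cw w : C (splice S w w0 x z) = C 0%R by rewrite /splice (negbTE xS).
    have [C0|C0] := pselect (C 0%R).
      rewrite [X in @sfield R d _ X](_ : _ = setT).
        by rewrite -(setD0 setT); exact: sC.
      by apply/seteqP; split => w _ //; change (C (splice S w w0 x z)); rewrite Cw.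
    rewrite [X in @sfield R d _ X](_ : _ = set0)//.
    apply/seteqP; split => w //; change (C (splice S w w0 x z) -> False).
    by rewrite Cw.
have := sub A mA; rewrite /H /=; congr sfield.
by apply/seteqP; split => w; rewrite /preimage/= (dep_splicel _ _ dA).
Qed.

End environments.

(** * Product laws *)

Lemma integral1 d (X : measurableType d) (R : realType)
  (mu : {measure set X -> \bar R}) : mu setT = 1 -> \int[mu]_x 1 = 1.
Proof. by move=> mu1; rewrite integral_cst// mul1e. Qed.

Lemma integral_indic_setT d (X : measurableType d) (R : realType)
  (mu : {measure set X -> \bar R}) (A : set X) : measurable A ->
  \int[mu]_x (\1_A x)%:E = mu A.
Proof. by move=> mA; rewrite integral_indic// setIT. Qed.

Section iid.
Context {R : realType} {d : nat}.
Local Notation Env := (Env R d).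
Local Notation site := (site d).
Variable P : probability Env R.
Hypothesis Piid : iid_product P.
Implicit Types (S : set site) (x y z : site) (A : set Env).

Definition cylinders : set (set Env) :=
  [set C | exists (s : seq site) (A : site -> set Env), uniq s /\
     (forall x, @sfield R d [set x] (A x)) /\
     C = \bigcap_(x in [set x | x \in s]) A x].

Lemma sfieldT S : @sfield R d S setT.
Proof. by apply/sfieldP; split. Qed.

Lemma measurable_cyl (s : seq site) (A : site -> set Env) :
  (forall x, @sfield R d [set x] (A x)) ->
  measurable (\bigcap_(x in [set x | x \in s]) A x).
Proof.
move=> sA; rewrite bigcap_seq.
apply: big_ind => [|B C|x _]; [exact: measurableT|exact: measurableI|].
exact: sfield_measurable (sA x).
Qed.

Lemma measurable_cylinders : @measurable _ Env = <<s cylinders >>.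
Proof.
apply/seteqP; split; last first.
  apply: smallest_sub; first exact: sigma_algebra_measurable.
  by move=> _ [s [A [_ [sA ->]]]]; exact: measurable_cyl.
apply: sub_sigma_algebra2 => B [x [z [C [_ [mC ->]]]]].
exists [:: x], (fun y => if y == x then Defs.coord x z @^-1` C else setT).
split => //; split.
  move=> y; case: eqVneq => [->|_]; last exact: sfieldT.
  by apply: sub_sigma_algebra; exists x, z, C.
apply/seteqP; split => [w Cw y /=|w /(_ x)/=].
  by rewrite inE => /eqP ->; rewrite eqxx.
by rewrite eqxx inE eqxx; exact.
Qed.

Lemma cylinders_setI : setI_closed cylinders.
Proof.
move=> _ _ [s [A [us [sA ->]]]] [t [B [ut [sB ->]]]].
exists (undup (s ++ t)), (fun x => (if x \in s then A x else setT) `&`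
                                  (if x \in t then B x else setT)).
split; first exact: undup_uniq.
split.
  move=> x; have /sfieldP[mA dA] : @sfield R d [set x] (if x \in s then A x else setT).
    by case: ifP => _; [exact: sA|exact: sfieldT].
  have /sfieldP[mB dB] : @sfield R d [set x] (if x \in t then B x else setT).
    by case: ifP => _; [exact: sB|exact: sfieldT].
  apply/sfieldP; split; first exact: measurableI.
  by move=> w w' ww'; rewrite /setI /mkset (dA _ _ ww') (dB _ _ ww').
apply/seteqP; split => [w [sAw tBw] x /= _|w stw].
  by split; case: ifPn => // ?; [exact: sAw|exact: tBw].
by split => x /= xs; have := stw x; rewrite /= mem_undup mem_cat xs ?orbT => -[].
Qed.

Let PT : P [set: Env] = 1.
Proof. exact: probability_setT. Qed.

Lemma P_cyl (s : seq site) (A : site -> set Env) : uniq s ->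
  (forall x, @sfield R d [set x] (A x)) ->
  P (\bigcap_(x in [set x | x \in s]) A x) = \prod_(x <- s) P (A x).
Proof. by move=> us sA; apply: Piid.2. Qed.

(** On a cylinder both sides are the product of the one-site probabilities, and cylinders form a
    generating pi-system. Resampling outside [S] turns the independence of disjoint regions into an
    iterated integral, see [iid_indep]. *)
Lemma iid_splice S (f : Env -> \bar R) : nnm f ->
  \int[P]_w f w = \int[P]_w \int[P]_w' f (splice S w w').
Proof.
move=> nf.
have mf2 : measurable_fun setT (fun w : Env * Env => f (splice S w.1 w.2)).
  by case: nf => _ mf; exact: measurableT_comp mf (measurable_splice S).
rewrite -[RHS](@fubini_tonelli1 _ _ _ _ _ P P (fun w => f (splice S w.1 w.2)))//; last first.
  by move=> w; exact: nnm_ge0.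
apply: (sigma_linear_unique (I := fun f => \int[P]_w f w)
  (J := fun f => \int[P \x P]_w f (splice S w.1 w.2))
  _ _ measurable_cylinders cylinders_setI _ _ _ nf).
- exact: sigma_linear_integral.
- apply: (@sigma_linear_comp _ _ _ _ _ _ (fun f w => f (splice S w.1 w.2))).
  + exact: sigma_linear_integral.
  + by move=> g ng; apply: nnm_comp ng; exact: measurable_splice.
  + by move=> w; exact: sigma_linear_eval.
- by rewrite !integral1//; exact: probability_setT.
- by rewrite integral1 ?ltry//; exact: probability_setT.
- move=> _ [s [A [us [sA ->]]]].
  (* Each one-site condition is charged to the copy that supplies its site. *)
  pose A1 x := if x \in S then A x else setT.
  pose A2 x := if x \in S then setT else A x.
  have sA1 x : @sfield R d [set x] (A1 x).
    by rewrite /A1; case: ifP => _; [exact: sA|exact: sfieldT].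
  have sA2 x : @sfield R d [set x] (A2 x).
    by rewrite /A2; case: ifP => _; [exact: sfieldT|exact: sA].
  rewrite integral_indic//; last exact: measurable_cyl.
  rewrite setIT.
  transitivity ((P \x P) ((\bigcap_(x in [set x | x \in s]) A1 x) `*`
                          (\bigcap_(x in [set x | x \in s]) A2 x))).
    apply: (@etrans _ _ (P (\bigcap_(x in [set x | x \in s]) A1 x) *
                         P (\bigcap_(x in [set x | x \in s]) A2 x))).
      apply: (@etrans _ _ (\prod_(x <- s) P (A x))); first exact: P_cyl.
      rewrite (P_cyl us sA1) (P_cyl us sA2) -big_split/=.
      apply: eq_bigr => x _.
      by rewrite /A1 /A2; case: ifP => _; rewrite PT ?mule1 ?mul1e.
    by apply/esym/product_measure1E; exact: measurable_cyl.
  have mC : measurable ((\bigcap_(x in [set x | x \in s]) A1 x) `*`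
                        (\bigcap_(x in [set x | x \in s]) A2 x)).
    by apply: measurableX; exact: measurable_cyl.
  rewrite -[LHS](integral_indic_setT _ mC); congr integral.
  have dA x w w' : w x = w' x -> A x w = A x w'.
    by have /sfieldP[_ +] := sA x => dA ww'; apply: dA => y ->.
  have spS w w' x : x \in S -> A x (splice S w w') = A x w.
    by move=> xS; apply: dA; rewrite /splice xS.
  have spN w w' x : x \notin S -> A x (splice S w w') = A x w'.
    by move=> xS; apply: dA; rewrite /splice (negbTE xS).
  apply/funext => -[w w'] /=; rewrite !indicE; congr (_%:R%:E).
  congr nat_of_bool; apply/idP/idP; rewrite !inE /=.
    move=> [A1w A2w'] x /= xs; have := A1w x xs; have := A2w' x xs.
    by rewrite /A1 /A2; have [xS|xS] := ifPn => a b; [rewrite spS|rewrite spN].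
  move=> ww'; split=> x /= xs; rewrite /A1 /A2; have [xS|xS]// := ifPn.
    by rewrite -(spS _ w')//; exact: ww'.
  by rewrite -(spN w)//; exact: ww'.
Qed.

Lemma iid_indep S S' (f g : Env -> \bar R) : nnm f -> nnm g ->
  dep S f -> dep S' g -> S `&` S' = set0 ->
  \int[P]_w (f w * g w) = (\int[P]_w f w) * \int[P]_w g w.
Proof.
move=> nf ng df dg SS'; rewrite (iid_splice S); last exact: nnmM.
case: (nf) => f0 mf; case: (ng) => g0 mg.
rewrite -ge0_integralZr//; last exact: integral_ge0.
apply: eq_integral => w _; rewrite -ge0_integralZl//.
apply: eq_integral => w' _.
by rewrite (dep_splicel _ _ df) (dep_splicer _ _ SS' dg).
Qed.

(** Stationarity is given for events of the origin only, so [A] and its shift are both written as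
    shifts of one event [B] of the origin. *)
Lemma P_shift_site x y A : @sfield R d [set y] A ->
  P (shift x @^-1` A) = P A.
Proof.
move=> /sfieldP[mA dA].
pose B := shift (- y)%R @^-1` A.
have AB : A = shift y @^-1` B.
  apply/funext => w; change (A w = A (shift (- y)%R (shift y w))).
  by rewrite shiftD addNr shift0.
have sB : @sfield R d [set 0%R] B.
  apply/sfieldP; split.
    by rewrite -[B]setTI; exact: measurable_shift.
  apply: depS (dep_shift dA) => z /=; rewrite opprK => zy.
  by rewrite -(addrK y z) zy subrr.
rewrite [in RHS]AB (Piid.1 y B sB) -(Piid.1 (y + x)%R B sB); congr (P _).
apply/funext => w.
change (A (shift x w) = A (shift (- y)%R (shift (y + x)%R w))).
by rewrite shiftD addKr.
Qed.

Lemma iid_shift x (f : Env -> \bar R) : nnm f ->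
  \int[P]_w f (shift x w) = \int[P]_w f w.
Proof.
move=> nf.
apply: (sigma_linear_unique (I := fun f => \int[P]_w f (shift x w))
  (J := fun f => \int[P]_w f w)
  _ _ measurable_cylinders cylinders_setI _ _ _ nf).
- apply: (@sigma_linear_comp _ _ _ _ _ _ (fun f w => f (shift x w))).
  + exact: sigma_linear_integral.
  + by move=> g ng; apply: nnm_comp ng; exact: measurable_shift.
  + by move=> w; exact: sigma_linear_eval.
- exact: sigma_linear_integral.
- by [].
- by rewrite integral1 ?ltry//; exact: probability_setT.
- move=> _ [s [A [us [sA ->]]]].
  set C := \bigcap_(_ in _) _.
  have mC : measurable C by exact: measurable_cyl.
  rewrite (_ : (fun w => _) = fun w => (\1_(shift x @^-1` C) w)%:E)//.
  rewrite !integral_indic// ?setIT; last first.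
    by rewrite -[X in measurable X]setTI; exact: measurable_shift.
  pose A' y := shift x @^-1` A (y - x)%R.
  have sA' y : @sfield R d [set y] (A' y).
    have /sfieldP[mA dA] := sA (y - x)%R; apply/sfieldP; split.
      by rewrite -[A' y]setTI; exact: measurable_shift.
    apply: depS (dep_shift dA) => z /= /eqP; rewrite (inj_eq (addIr _)) => /eqP.
    by [].
  rewrite (_ : shift x @^-1` C = \bigcap_(y in [set y | y \in map (+%R^~ x) s]) A' y).
    have us' : uniq (map (+%R^~ x) s) by rewrite map_inj_uniq//; exact: addIr.
    apply: etrans (P_cyl us' sA') _; apply: etrans _ (esym (P_cyl us sA)).
    rewrite big_map; apply: eq_bigr => y _.
    by rewrite /A' addrK (P_shift_site _ (sA y)).
  apply/seteqP; split => w.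
    by move=> Cw y /= /mapP[z zs ->]; rewrite /A' addrK; exact: Cw.
  move=> Cw y /= ys; have := Cw (y + x)%R; rewrite /A' addrK; apply.
  by apply/mapP; exists y.
Qed.

End iid.

(** * Transfer operators *)

Section transfer_operators.
Context {R : realType} {d : nat}.
Local Notation Env := (Env R d).
Local Notation site := (site d).
Implicit Types (S : set site) (x y z : site) (f : Env -> \bar R).
Implicit Types c : site -> Env -> \bar R.

(** [c x w] is read as the weight of a family of paths from the origin to [x]. For one-step
    probabilities this is the kernel of the environment seen from the walk; other weights describe
    truncated or reweighted families of paths. *)
Definition transfer c f (w : Env) : \bar R :=
  \esum_(x in setT) (c x w * f (shift x w)).

(** Concatenation of paths: the second family starts at [x] and reads the environment from there. *)
Definition conv c1 c2 : site -> Env -> \bar R := fun y w =>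
  \esum_(x in setT) (c1 x w * c2 (y - x)%R (shift x w)).

Lemma nnm_shift f x : nnm f -> nnm (fun w => f (shift x w)).
Proof. by move=> nf; apply: nnm_comp nf; exact: measurable_shift. Qed.

Lemma nnm_transfer c f : (forall x, nnm (c x)) -> nnm f -> nnm (transfer c f).
Proof. by move=> nc nf; apply: nnm_esum => x; apply: nnmM => //; exact: nnm_shift. Qed.

Lemma nnm_conv c1 c2 : (forall x, nnm (c1 x)) -> (forall x, nnm (c2 x)) ->
  forall x, nnm (conv c1 c2 x).
Proof.
by move=> nc1 nc2 y; apply: nnm_esum => x; apply: nnmM => //; exact: nnm_shift.
Qed.

Lemma transfer_conv c1 c2 f : (forall x, nnm (c1 x)) -> (forall x, nnm (c2 x)) ->
  nnm f -> transfer c1 (transfer c2 f) = transfer (conv c1 c2) f.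
Proof.
move=> nc1 nc2 nf; apply/funext => w; rewrite /transfer /conv.
have c10 x v : 0 <= c1 x v by exact: nnm_ge0.
have c20 x v : 0 <= c2 x v by exact: nnm_ge0.
have f0 v : 0 <= f v by exact: nnm_ge0.
transitivity (\esum_(x in setT) \esum_(y in setT)
   (c1 x w * c2 (y - x)%R (shift x w) * f (shift y w))).
  apply: eq_esum => x _; rewrite -esumZl//; last by move=> z; exact: mule_ge0.
  rewrite (@esum_reindex_bij _ _ _ (fun y => y - x)%R (fun z => z + x)%R).
  - apply: eq_esum => y _; rewrite muleA shiftD; congr (_ * f (shift _ w)).
    exact: subrK.
  - by move=> y; rewrite subrK.
  - by move=> y; rewrite addrK.
rewrite esum_exchange; last by move=> x y; rewrite !mule_ge0.
apply: eq_esum => y _; rewrite esumZr// => x.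
by rewrite mule_ge0.
Qed.

Lemma sigma_linear_transfer c w : (forall x, nnm (c x)) ->
  sigma_linear (fun f => transfer c f w).
Proof.
move=> nc; apply: sigma_linear_esum => x.
by apply: sigma_linearZ; [exact: nnm_ge0|exact: sigma_linear_eval].
Qed.

Lemma dep_esum (I : choiceType) S (F : I -> Env -> \bar R) :
  (forall i, dep S (F i)) -> dep S (fun w => \esum_(i in setT) F i w).
Proof. by move=> dF w w' ww'; apply: eq_esum => i _; exact: dF. Qed.

Lemma depM S (f g : Env -> \bar R) : dep S f -> dep S g ->
  dep S (fun w => f w * g w).
Proof. by move=> df dg w w' ww'; rewrite (df _ _ ww') (dg _ _ ww'). Qed.

Lemma depD S (f g : Env -> \bar R) : dep S f -> dep S g ->
  dep S (fun w => f w + g w).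
Proof. by move=> df dg w w' ww'; rewrite (df _ _ ww') (dg _ _ ww'). Qed.

Fixpoint steps c n : site -> Env -> \bar R :=
  if n is n'.+1 then conv (steps c n') c
  else fun x _ => if x == 0%R then 1 else 0.

Lemma nnm_steps c n : (forall x, nnm (c x)) -> forall x, nnm (steps c n x).
Proof.
move=> nc; elim: n => [|n ih] x /=; first by case: ifP => _; exact: nnm_cst.
exact: nnm_conv.
Qed.

Lemma transfer_steps c n f : (forall x, nnm (c x)) -> nnm f ->
  transfer (steps c n) f = iter n (transfer c) f.
Proof.
move=> nc; elim: n f => [|n ih] f nf /=.
  apply/funext => w; rewrite /transfer.
  under eq_esum => x _ do rewrite (fun_if (fun a => a * _)) mul1e mul0e.
  rewrite (esum_if1 (i0 := 0%R) (a := fun x => f (shift x w)));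
    last exact: nnm_ge0.
  by rewrite shift0.
rewrite -transfer_conv//; last exact: nnm_steps.
by rewrite ih; [rewrite -iterSr|exact: nnm_transfer].
Qed.

Lemma nnm_iter_transfer c n f : (forall x, nnm (c x)) -> nnm f ->
  nnm (iter n (transfer c) f).
Proof. by move=> nc nf; elim: n => //= n ih; exact: nnm_transfer. Qed.

Variable P : probability Env R.
Hypothesis Piid : iid_product P.

Lemma sigma_linear_Etransfer c : (forall x, nnm (c x)) ->
  sigma_linear (fun f => \int[P]_w transfer c f w).
Proof.
move=> nc; apply: (@sigma_linear_comp _ _ _ _ _ (fun f => \int[P]_w f w)).
- exact: sigma_linear_integral.
- by move=> f; exact: nnm_transfer.
- by move=> w; exact: sigma_linear_transfer.
Qed.

(** The weight of the end-point [x] reads [S x], and the shifted function reads [x + S']. When these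
    never meet, the expectation of each term factors, and stationarity makes the second factor
    independent of [x]. *)
Lemma Etransfer_indep c f (S : site -> set site) S' : (forall x, nnm (c x)) ->
  nnm f -> (forall x, dep (S x) (c x)) -> dep S' f ->
  (forall x z, S x z -> S' (z - x)%R -> False) ->
  \int[P]_w transfer c f w = \int[P]_w transfer c (fun=> 1) w * \int[P]_w f w.
Proof.
move=> nc nf dc df SS'; have n1 : nnm (fun _ : Env => 1 : \bar R) by exact: nnm_cst.
have ncs g x : nnm g -> nnm (fun w => c x w * g (shift x w)).
  by move=> ng; apply: nnmM => //; exact: nnm_shift.
have E g : nnm g -> \int[P]_w transfer c g w =
    \esum_(x in setT) \int[P]_w (c x w * g (shift x w)).
  move=> ng; rewrite integral_esum// => [x w|x]; first exact: nnm_ge0 (ncs _ x ng).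
  by case: (ncs _ x ng).
rewrite !E// -esumZr; last 2 first.
- by apply: integral_ge0 => w _; exact: nnm_ge0.
- by move=> x; apply: integral_ge0 => w _; exact: nnm_ge0 (ncs _ x n1).
apply: eq_esum => x _.
rewrite (iid_indep Piid (nc x) (nnm_shift x nf) (dc x) (dep_shift df)).
  by rewrite iid_shift//; congr (_ * _); apply: eq_integral => w _; rewrite mule1.
by apply/seteqP; split => // z [] /SS'.
Qed.

End transfer_operators.

(** * Forward kernels and regeneration *)

Section dotu_theory.
Context {R : realType} {d : nat} (u : 'rV[R]_d).
Implicit Types x y : site d.

Lemma dotuD x y : (dotu (x + y) u = dotu x u + dotu y u)%R.
Proof.
by rewrite /dotu -big_split; apply: eq_bigr => i _; rewrite mxE intrD mulrDl.
Qed.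

Lemma dotu0 : (dotu (0%R : site d) u = 0)%R.
Proof. by rewrite /dotu big1// => i _; rewrite mxE mul0r. Qed.

Lemma dotuB x y : (dotu (x - y) u = dotu x u - dotu y u)%R.
Proof. by apply/eqP; rewrite eq_sym subr_eq -dotuD subrK. Qed.

Definition halfspace (a : R) : set (site d) := [set x | (a <= dotu x u)%R].

Lemma halfspaceS a b : (b <= a)%R -> halfspace a `<=` halfspace b.
Proof. by move=> ba x; exact: le_trans. Qed.

End dotu_theory.

Section regeneration.
Context {R : realType} {d : nat} (u : 'rV[R]_d).
Local Notation Env := (Env R d).
Local Notation site := (site d).
Local Notation H := (halfspace u).
Implicit Types (S : set site) (x y z : site) (f : Env -> \bar R).

Record forward_kernel (pp : site -> Env -> \bar R) (eta c : R) : Prop := {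
  fk_nnm : forall z, nnm (pp z);
  fk_dep : forall z, dep [set 0%R] (pp z);
  fk_sum : forall w, \esum_(z in setT) pp z w = 1;
  fk_forward : forall z w, (dotu z u < 0)%R -> pp z w = 0;
  fk_eta0 : (0 < eta)%R;
  fk_c0 : (0 < c)%R;
  fk_jump : forall w,
    c%:E <= \esum_(z in setT) (if (eta <= dotu z u)%R then pp z w else 0) }.

Variables (pp : site -> Env -> \bar R) (eta c : R).
Hypothesis fk : forward_kernel pp eta c.

Let npp := fk_nnm fk.
Let pp0 z w : 0 <= pp z w. Proof. exact: nnm_ge0. Qed.

Definition long_jumps : site -> Env -> \bar R :=
  fun z w => if (eta <= dotu z u)%R then pp z w else 0.
Definition short_jumps : site -> Env -> \bar R :=
  fun z w => if (eta <= dotu z u)%R then 0 else pp z w.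

Let nlj z : nnm (long_jumps z).
Proof. by rewrite /long_jumps; case: (_ <= _)%R => //; exact: nnm_cst. Qed.
Let nsj z : nnm (short_jumps z).
Proof. by rewrite /short_jumps; case: (_ <= _)%R => //; exact: nnm_cst. Qed.

Definition excess (w : Env) : \bar R := \esum_(z in setT) long_jumps z w - c%:E.

(* What remains of [transfer pp f] after subtracting [c * E f]: for [f]
   depending on the half-space at the origin, a long jump contributes [E f]. *)
Definition coin_kernel (P : probability Env R) f (w : Env) : \bar R :=
  excess w * (\int[P]_v f v) + transfer short_jumps f w.

Lemma dep_long_jumps z : dep [set 0%R] (long_jumps z).
Proof. by rewrite /long_jumps; case: (_ <= _)%R => //; exact: fk_dep fk z. Qed.

Lemma excessD w : excess w + c%:E = \esum_(z in setT) long_jumps z w.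
Proof. by rewrite /excess subeK. Qed.

Lemma excess_ge0 w : 0 <= excess w.
Proof. by rewrite /excess sube_ge0 ?(fk_jump fk)//; right. Qed.

Lemma nnm_excess : nnm excess.
Proof.
split; first exact: excess_ge0.
apply: emeasurable_funB; last exact: measurable_cst.
by case: (nnm_esum nlj).
Qed.

Lemma dep_excess : dep [set 0%R] excess.
Proof.
move=> w w' ww'; rewrite /excess; congr (_ - _).
by apply: eq_esum => z _; exact: dep_long_jumps.
Qed.

(** The reason why [coin_kernel] contracts: exactly [c] of the unit mass of a step is set aside in
    every environment, whatever the actual probability of a long jump. *)
Lemma excess_short w :
  excess w + \esum_(z in setT) short_jumps z w = (1 - c)%:E.
Proof.
have E : \esum_(z in setT) long_jumps z w + \esum_(z in setT) short_jumps z w = 1.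
  rewrite -esumD => [|z _|z _]; [|exact: nnm_ge0|exact: nnm_ge0].
  rewrite -(fk_sum fk w); apply: eq_esum => z _.
  by rewrite /long_jumps /short_jumps; case: ifP => _; rewrite ?adde0 ?add0e.
rewrite /excess addeAC E EFinB; congr (_ + _).
Qed.

Lemma c_le1 : (c <= 1)%R.
Proof.
have : 0 <= (1 - c)%:E by rewrite -(excess_short point) adde_ge0 ?excess_ge0// esum_ge0// => z _; exact: nnm_ge0.
by rewrite lee_fin subr_ge0.
Qed.

Lemma transferE f : nnm f ->
  transfer pp f = fun w => transfer long_jumps f w + transfer short_jumps f w.
Proof.
move=> nf; apply/funext => w; rewrite /transfer -esumD.
- apply: eq_esum => z _; rewrite /long_jumps /short_jumps.
  by case: ifP => _; rewrite mul0e ?adde0 ?add0e.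
- by move=> z _; rewrite mule_ge0 ?(nnm_ge0 _ (nlj z))// nnm_ge0.
- by move=> z _; rewrite mule_ge0 ?(nnm_ge0 _ (nsj z))// nnm_ge0.
Qed.

Lemma transfer1 : transfer pp (fun=> 1) = fun=> 1.
Proof.
apply/funext => w; rewrite /transfer -[RHS](fk_sum fk w).
by apply: eq_esum => z _; rewrite mule1.
Qed.

Lemma le_transfer f g : nnm f -> nnm g -> (forall w, f w <= g w) ->
  forall w, transfer pp f w <= transfer pp g w.
Proof.
by move=> nf ng fg w; apply: (sigma_linear_le (sigma_linear_transfer w npp)).
Qed.

(** Forward jumps move the half-space read by [f] only further ahead, and [a <= 0] puts the origin,
    which the weights read, inside [H a]. *)
Lemma dep_transfer (cf : site -> Env -> \bar R) f a :
  (forall z, dep [set 0%R] (cf z)) -> (forall z w, (dotu z u < 0)%R -> cf z w = 0) ->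
  (a <= 0)%R -> dep (H a) f -> dep (H a) (transfer cf f).
Proof.
move=> dcf cf0 a0 df; apply: dep_esum => z.
have [z0|z0] := ltP (dotu z u) 0%R.
  by move=> w w' _; rewrite !cf0// !mul0e.
apply: depM.
  by apply: depS (dcf z) => x /= ->; rewrite /halfspace/= dotu0.
apply: depS (dep_shift df) => x /=; rewrite /halfspace /= dotuB => /le_trans; apply.
by rewrite gerBl.
Qed.

Lemma dep_transfer_pp f a : (a <= 0)%R -> dep (H a) f -> dep (H a) (transfer pp f).
Proof. by apply: dep_transfer; [exact: fk_dep fk|exact: fk_forward fk]. Qed.

Lemma dep_iter_transfer n f a : (a <= 0)%R -> dep (H a) f ->
  dep (H a) (iter n (transfer pp) f).
Proof. by move=> a0 df; elim: n => //= n; exact: dep_transfer_pp. Qed.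

Lemma iter_transfer1 n : iter n (transfer pp) (fun=> 1) = fun=> 1.
Proof. by elim: n => //= n ->; exact: transfer1. Qed.

Lemma iter_transfer_le n f r : nnm f -> (0 <= r)%R -> (forall w, f w <= r%:E) ->
  forall w, iter n (transfer pp) f w <= r%:E.
Proof.
move=> nf r0 fr; elim: n => //= n ih w.
apply: (le_trans (le_transfer (nnm_iter_transfer n npp nf) _ ih w)).
  by apply: nnm_cst; rewrite lee_fin.
rewrite /transfer esumZr ?lee_fin//.
by rewrite (fk_sum fk) mul1e.
Qed.

Section coin_kernel.
Variable P : probability Env R.
Hypothesis Piid : iid_product P.
Local Notation K := (coin_kernel P).

Lemma nnm_coin_kernel f : nnm f -> nnm (K f).
Proof.
move=> nf; apply: nnmD; last exact: nnm_transfer.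
apply: nnmM; first exact: nnm_excess.
by apply: nnm_cst; apply: integral_ge0 => w _; exact: nnm_ge0.
Qed.

Lemma sigma_linear_coin_kernel w : sigma_linear (fun f => K f w).
Proof.
apply: sigma_linear_add; last exact: sigma_linear_transfer.
by apply: sigma_linearZ; [exact: excess_ge0|exact: sigma_linear_integral].
Qed.

Lemma dep_coin_kernel f : dep (H 0) f -> dep (H 0) (K f).
Proof.
move=> df; apply: depD.
  move=> w w' ww'; congr (_ * _); apply: dep_excess => x /= ->.
  by apply: ww'; rewrite /halfspace/= dotu0.
apply: dep_transfer => //.
- move=> z; rewrite /short_jumps; case: (_ <= _)%R => //; exact: fk_dep fk z.
- by move=> z w z0; rewrite /short_jumps; case: ifP => // _; exact: fk_forward fk _ _ z0.
Qed.

Lemma integral_le_cst f r : nnm f -> (forall w, f w <= r%:E) ->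
  \int[P]_w f w <= r%:E.
Proof.
move=> [f0 mf] fr.
apply: (@le_trans _ _ (\int[P]_w r%:E)).
  by apply: ge0_le_integral.
by rewrite integral_cst// -[leRHS]mule1 -(probability_setT P).
Qed.

Lemma coin_kernel_le f r : nnm f -> (0 <= r)%R -> (forall w, f w <= r%:E) ->
  forall w, K f w <= ((1 - c) * r)%:E.
Proof.
move=> nf r0 fr w; rewrite EFinM -(excess_short w) muleC ge0_muleDr ?excess_ge0//; last first.
  by apply: esum_ge0 => z _; exact: nnm_ge0.
rewrite leeD//.
  by rewrite muleC lee_wpmul2r// ?excess_ge0// integral_le_cst.
rewrite -esumZl ?lee_fin// => [|z]; last exact: nnm_ge0.
apply: le_esum => z _; rewrite muleC lee_wpmul2r//.
exact: nnm_ge0.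
Qed.

End coin_kernel.
End regeneration.

(** * Geometric convergence on the half-space at the origin *)

Section regeneration_limit.
Context {R : realType} {d : nat} (u : 'rV[R]_d).
Local Notation Env := (Env R d).
Local Notation site := (site d).
Local Notation H := (halfspace u).
Implicit Types (S : set site) (x y z : site) (f : Env -> \bar R).

Variables (pp : site -> Env -> \bar R) (eta c : R).
Hypothesis fk : forward_kernel u pp eta c.
Variable P : probability Env R.
Hypothesis Piid : iid_product P.
Local Notation K := (coin_kernel u pp eta c P).
Local Notation U := (transfer pp).
Let npp := fk_nnm fk.
Let n1 : nnm (fun _ : Env => 1 : \bar R). Proof. exact: nnm_cst. Qed.

(** Path weights that have read nothing beyond the level of their end-point. Sites at that very
    level may have been read, so a fresh function must look strictly ahead ([Etransfer_fresh]) or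
    follow a long jump ([Etransfer_long]). *)
Definition adapted (g : site -> Env -> \bar R) :=
  (forall x, nnm (g x)) /\
  (forall x, dep [set y | (dotu y u <= dotu x u)%R] (g x)).

Lemma adapted_conv g : adapted g -> adapted (conv g pp).
Proof.
move=> [ng dg]; split; first exact: nnm_conv.
move=> y; apply: dep_esum => x; have [yx|xy] := ltP (dotu y u) (dotu x u).
  by move=> w w' _; rewrite !(fk_forward fk) ?mule0// dotuB subr_lt0.
apply: depM; first by apply: depS (dg x) => z /= /le_trans; apply.
apply: depS (dep_shift (fk_dep fk _)) => z /= /eqP; rewrite subr_eq0 => /eqP ->.
by [].
Qed.

Lemma Etransfer_fresh g f : adapted g -> nnm f ->
  dep [set x | (0 < dotu x u)%R] f ->
  \int[P]_w transfer g f w = \int[P]_w transfer g (fun=> 1) w * \int[P]_w f w.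
Proof.
move=> [ng dg] nf df; apply: (Etransfer_indep Piid ng nf dg df) => x z /= zx.
by rewrite dotuB subr_gt0 ltNge zx.
Qed.

(** After a last jump of at least [eta > 0] the end-point lies strictly above every site read so
    far, so even the closed half-space read by the shifted [f] is independent of the path. *)
Lemma Etransfer_long g f : adapted g -> nnm f -> dep (H 0) f ->
  \int[P]_w transfer g (transfer (long_jumps u pp eta) f) w =
  \int[P]_w transfer g (fun w => \esum_(z in setT) long_jumps u pp eta z w) w *
  \int[P]_w f w.
Proof.
move=> [ng dg] nf df.
have nlj z : nnm (long_jumps u pp eta z).
  by rewrite /long_jumps; case: (_ <= _)%R => //; exact: nnm_cst.
rewrite transfer_conv//.
rewrite (Etransfer_indep Piid (S := fun x => [set y | (dotu y u < dotu x u)%R])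
  (S' := H 0))//; last 3 first.
- exact: nnm_conv.
- move=> y; apply: dep_esum => x; have [xy|yx] := ltP (dotu x u) (dotu y u).
    apply: depM; first by apply: depS (dg x) => z /= /le_lt_trans; apply.
    apply: depS (dep_shift (dep_long_jumps fk _)) => z /= /eqP.
    by rewrite subr_eq0 => /eqP ->.
  have E : (eta <= dotu (y - x) u)%R = false.
    apply/negbTE; rewrite -ltNge dotuB; apply: le_lt_trans (fk_eta0 fk).
    by rewrite subr_le0.
  by move=> w w' _; rewrite /long_jumps E !mule0.
- by move=> x z /= zx; rewrite /halfspace/= dotuB subr_ge0 leNgt zx.
rewrite -(transfer_conv ng nlj n1).
suff -> : transfer (long_jumps u pp eta) (fun=> 1) =
  fun w => \esum_(z in setT) long_jumps u pp eta z w by [].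
by apply/funext => w; apply: eq_esum => z _; rewrite mule1.
Qed.

Lemma regeneration_step g f r : adapted g -> nnm f -> (forall w, f w <= r%:E) ->
  dep (H 0) f ->
  \int[P]_w transfer g (U f) w =
  c%:E * (\int[P]_w transfer g (fun=> 1) w * \int[P]_w f w) +
  \int[P]_w transfer g (K f) w.
Proof.
move=> ag nf fr df; have [ng _] := ag.
have sI := sigma_linear_Etransfer P ng.
have nlj z : nnm (long_jumps u pp eta z).
  by rewrite /long_jumps; case: (_ <= _)%R => //; exact: nnm_cst.
have nsj z : nnm (short_jumps u pp eta z).
  by rewrite /short_jumps; case: (_ <= _)%R => //; exact: nnm_cst.
have nex := nnm_excess fk.
(* [sigma_linear] scales by real constants only, so the expectation of [f] must first be known to be
   finite; this is what the bound [r] is for. *)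
have [s sE] : exists s : R, \int[P]_w f w = s%:E.
  have : \int[P]_w f w \is a fin_num.
    rewrite ge0_fin_numE; last by apply: integral_ge0 => w _; exact: nnm_ge0.
    exact: le_lt_trans (integral_le_cst P nf fr) (ltry _).
  by case: (\int[P]_w f w) => // s _; exists s.
have s0 : (0 <= s)%R.
  by rewrite -lee_fin -sE; apply: integral_ge0 => w _; exact: nnm_ge0.
rewrite (transferE fk nf).
rewrite (sigma_linearD sI); [|exact: nnm_transfer|exact: nnm_transfer].
rewrite (Etransfer_long ag nf df).
rewrite (_ : (fun w => \esum_(z in setT) long_jumps u pp eta z w) =
             (fun w => excess u pp eta c w + c%:E * 1)); last first.
  by apply/funext => w; rewrite mule1 excessD.
have c0 := ltW (fk_c0 fk).
have nc1 : nnm (fun _ : Env => c%:E * 1 : \bar R).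
  by rewrite mule1; apply: nnm_cst; rewrite lee_fin.
rewrite (sigma_linearD sI)//.
have [_ _ IZ] := sI; rewrite IZ//.
have nes : nnm (fun w => excess u pp eta c w * \int[P]_v f v).
  by rewrite sE; apply: nnmM => //; apply: nnm_cst; rewrite lee_fin.
rewrite /coin_kernel (sigma_linearD sI nes (nnm_transfer nsj nf)).
rewrite sE; under [fun w => excess _ _ _ _ w * _]eq_fun do rewrite muleC.
rewrite (IZ _ _ s0 nex) ge0_muleDl; last 2 first.
- by apply: integral_ge0 => w _; exact: nnm_ge0 (nnm_transfer ng nex).
- by rewrite mule_ge0 ?lee_fin//; apply: integral_ge0 => w _; exact: nnm_ge0 (nnm_transfer ng n1).
by rewrite -!addeA addeCA !muleA; congr (_ + (_ + _)); exact: muleC.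
Qed.

Lemma iter_coin_props n f r : (0 <= r)%R -> nnm f -> (forall w, f w <= r%:E) ->
  dep (H 0) f ->
  [/\ nnm (iter n K f), forall w, iter n K f w <= ((1 - c) ^+ n * r)%:E &
      dep (H 0) (iter n K f)].
Proof.
move=> r0 nf fr df; elim: n => [|n [nK Kr dK]]; first by rewrite expr0 mul1r.
split => /=; [exact: (nnm_coin_kernel fk)| |exact: (dep_coin_kernel fk)].
rewrite exprS -mulrA; apply: (coin_kernel_le fk) => //.
by rewrite mulr_ge0// exprn_ge0// subr_ge0 (c_le1 fk).
Qed.

(** The induction runs over all adapted [g]: the outermost [U] is absorbed into [g], whose mass it
    keeps because [U 1 = 1], and the regeneration step is then applied to [iter n K f]. A general
    [g] later lets the walk start from a density. *)
Lemma regeneration_iter g n f r : adapted g -> (0 <= r)%R -> nnm f ->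
  (forall w, f w <= r%:E) -> dep (H 0) f ->
  \int[P]_w transfer g (iter n U f) w =
  \int[P]_w transfer g (fun=> 1) w *
    (c%:E * \sum_(0 <= i < n) \int[P]_w iter i K f w) +
  \int[P]_w transfer g (iter n K f) w.
Proof.
move=> + r0 nf fr df; elim: n g => [|n ih] g ag.
  by rewrite big_nil mule0 mule0 add0e.
have [ng _] := ag; have nUf := nnm_iter_transfer n npp nf.
have [nK Kr dK] := iter_coin_props n r0 nf fr df.
rewrite iterS transfer_conv// ih; last exact: adapted_conv.
rewrite -!transfer_conv// (transfer1 fk).
rewrite (regeneration_step ag nK Kr dK) addeA; congr (_ + _).
have K0 i : 0 <= \int[P]_w iter i K f w.
  apply: integral_ge0 => w _; apply: nnm_ge0.
  by have [] := iter_coin_props i r0 nf fr df.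
rewrite big_nat_recr//= [in RHS]ge0_muleDr ?sume_ge0//.
rewrite [in RHS]ge0_muleDr.
- by congr (_ + _); exact: muleCA.
- by rewrite mule_ge0 ?lee_fin ?(ltW (fk_c0 fk))// sume_ge0.
- by rewrite mule_ge0 ?lee_fin ?(ltW (fk_c0 fk)).
Qed.

Definition limit_law f : \bar R :=
  c%:E * \esum_(i in [set: nat]) \int[P]_w iter i K f w.

Lemma sigma_linear_Eiter_coin n : sigma_linear (fun f => \int[P]_w iter n K f w).
Proof.
elim: n => [|n ih]; first exact: sigma_linear_integral.
rewrite (_ : (fun f => _) = (fun f => \int[P]_w iter n K (K f) w)); last first.
  by apply/funext => f; rewrite iterSr.
apply: (sigma_linear_comp (T := K) ih).
- by move=> f; exact: (nnm_coin_kernel fk).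
- exact: (sigma_linear_coin_kernel fk).
Qed.

Lemma sigma_linear_limit_law : sigma_linear limit_law.
Proof.
apply: sigma_linearZ; first by rewrite lee_fin (ltW (fk_c0 fk)).
by apply: sigma_linear_esum => n; exact: sigma_linear_Eiter_coin.
Qed.

Lemma Eiter_coin_ge0 n f : nnm f -> 0 <= \int[P]_w iter n K f w.
Proof. by move=> nf; have [I0 _ _] := sigma_linear_Eiter_coin n; exact: I0. Qed.

(** For [n = 1] this is the fixed-point equation [L f = c * E f + L (K f)], which bounds the limit
    below by [c * E f]. For general [n] the last term is part of the error in [Etransfer_limit]. *)
Lemma limit_law_split n f : nnm f ->
  limit_law f = c%:E * \sum_(0 <= i < n) \int[P]_w iter i K f w +
                limit_law (iter n K f).
Proof.
move=> nf; have nKf : nnm (iter n K f).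
  by elim: n => //= n; exact: (nnm_coin_kernel fk).
rewrite /limit_law -!nneseries_esumT => [|i|i]; [|exact: Eiter_coin_ge0|exact: Eiter_coin_ge0].
rewrite -ge0_muleDr.
- rewrite (@nneseries_split _ _ 0%N n) => [|k _]; last exact: Eiter_coin_ge0.
  congr (_ * (_ + _)); rewrite add0n -nneseries_addn//; last by move=> i; exact: Eiter_coin_ge0.
  by apply: eq_eseriesr => i _; rewrite iterD.
- by apply: sume_ge0 => i _; exact: Eiter_coin_ge0.
- by apply: nneseries_ge0 => i _ _; exact: Eiter_coin_ge0.
Qed.

Let g0 : site -> Env -> \bar R := steps pp 0.

Let transfer_g0 f : nnm f -> transfer g0 f = f.
Proof. by move=> nf; rewrite transfer_steps. Qed.

Lemma adapted0 : adapted g0.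
Proof.
split; first exact: (nnm_steps 0 npp).
by move=> x w w' _.
Qed.

(** With the trivial path weight, [regeneration_iter] bounds [c] times each partial sum by the
    expectation of [U^n f], hence by [r]. *)
Lemma limit_law_le f r : (0 <= r)%R -> nnm f -> (forall w, f w <= r%:E) ->
  dep (H 0) f -> limit_law f <= r%:E.
Proof.
move=> r0 nf fr df; rewrite /limit_law -nneseries_esumT => [|i]; last exact: Eiter_coin_ge0.
have c0 := fk_c0 fk.
rewrite -lee_pdivlMl//.
apply: lime_le; first by apply: is_cvg_nneseries => i _ _; exact: Eiter_coin_ge0.
apply: nearW => n /=; rewrite lee_pdivlMl//.
have := regeneration_iter n adapted0 r0 nf fr df.
rewrite (transfer_g0 (nnm_iter_transfer n npp nf)) (transfer_g0 n1).
rewrite integral1; last exact: probability_setT.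
have [nK _ _] := iter_coin_props n r0 nf fr df.
rewrite mul1e (transfer_g0 nK) => E.
apply: le_trans (integral_le_cst P (nnm_iter_transfer n npp nf)
  (iter_transfer_le fk n nf r0 fr)).
by rewrite E leeDl// Eiter_coin_ge0.
Qed.

(** The expansions of the expectation and of [M * L f] share their first [n] terms, and each
    remainder is at most [M * (1 - c)^n * r]. Two inequalities avoid a difference of extended
    reals. *)
Lemma Etransfer_limit g n f r : adapted g -> (0 <= r)%R -> nnm f ->
  (forall w, f w <= r%:E) -> dep (H 0) f ->
  let M := \int[P]_w transfer g (fun=> 1) w in
  \int[P]_w transfer g (iter n U f) w <=
    M * limit_law f + M * ((1 - c) ^+ n * r)%:E /\
  M * limit_law f <=
    \int[P]_w transfer g (iter n U f) w + M * ((1 - c) ^+ n * r)%:E.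
Proof.
move=> ag r0 nf fr df M; have [ng _] := ag.
have [nK Kr dK] := iter_coin_props n r0 nf fr df.
have M0 : 0 <= M by apply: integral_ge0 => w _; exact: nnm_ge0 (nnm_transfer ng n1).
have rn0 : (0 <= (1 - c) ^+ n * r)%R.
  by rewrite mulr_ge0// exprn_ge0// subr_ge0 (c_le1 fk).
have sI := sigma_linear_Etransfer P ng.
have IK : \int[P]_w transfer g (iter n K f) w <= M * ((1 - c) ^+ n * r)%:E.
  have nrn : nnm (fun _ : Env => ((1 - c) ^+ n * r)%:E).
    by apply: nnm_cst; rewrite lee_fin.
  apply: le_trans (sigma_linear_le sI nK nrn Kr) _.
  have [_ _ IZ] := sI.
  have := IZ _ _ rn0 n1; rewrite (_ : (fun=> _ * 1) = (fun=> ((1 - c) ^+ n * r)%:E)).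
    by move=> ->; rewrite muleC.
  by apply/funext => w; rewrite mule1.
have LK := limit_law_le rn0 nK Kr dK.
have LK0 : 0 <= limit_law (iter n K f).
  by have [I0 _ _] := sigma_linear_limit_law; exact: I0.
have S0 : 0 <= c%:E * \sum_(0 <= i < n) \int[P]_w iter i K f w.
  rewrite mule_ge0 ?lee_fin ?(ltW (fk_c0 fk))// sume_ge0// => i _.
  exact: Eiter_coin_ge0.
rewrite (regeneration_iter n ag r0 nf fr df) -/M (limit_law_split n nf).
rewrite ge0_muleDr//; split.
  by rewrite -addeA leeD2l// (le_trans IK)// leeDr// mule_ge0.
rewrite -addeA leeD2l// (le_trans (lee_wpmul2l M0 LK))// leeDr//.
by apply: integral_ge0 => w _; exact: nnm_ge0 (nnm_transfer ng nK).
Qed.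

End regeneration_limit.

(** * Convergence and transience *)

Section tends.
Import numFieldNormedType.Exports.
Context {R : realType}.
Implicit Types (X : nat -> \bar R) (Y : \bar R).

(** Two one-sided bounds need no subtraction in the extended reals; for finite values they give
    topological convergence, by [tends_cvg]. *)
Definition tends X Y := forall e : R, (0 < e)%R ->
  exists N, forall n, (N <= n)%N -> X n <= Y + e%:E /\ Y <= X n + e%:E.

Lemma tends_le X X' Y Y' : tends X Y -> tends X' Y' ->
  (forall n, X n <= X' n) -> Y <= Y'.
Proof.
move=> XY XY' XX'; apply/lee_addgt0Pr => e e0.
have [N XN] := XY _ (divr_gt0 e0 (ltr0n _ 2)).
have [N' XN'] := XY' _ (divr_gt0 e0 (ltr0n _ 2)).
have [_ b] := XN (maxn N N') (leq_maxl _ _).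
have [a' _] := XN' (maxn N N') (leq_maxr _ _).
rewrite (splitr e) EFinD addeA (le_trans b)// leeD2r//.
exact: le_trans (XX' _) a'.
Qed.

Lemma tends_uniq X Y Y' : tends X Y -> tends X Y' -> Y = Y'.
Proof. by move=> XY XY'; apply/eqP; rewrite eq_le !(tends_le (X := X) (X' := X)). Qed.

Lemma tends_cst Y : tends (fun=> Y) Y.
Proof. by move=> e e0; exists 0%N => n _; rewrite leeDl ?lee_fin// ltW. Qed.

Lemma tendsD X X' Y Y' : tends X Y -> tends X' Y' ->
  tends (fun n => X n + X' n) (Y + Y').
Proof.
move=> XY XY' e e0.
have [N XN] := XY _ (divr_gt0 e0 (ltr0n _ 2)).
have [N' XN'] := XY' _ (divr_gt0 e0 (ltr0n _ 2)).
exists (maxn N N') => n; rewrite geq_max => /andP[/XN[a b] /XN'[a' b']].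
rewrite [in X in X /\ _](splitr e) [in X in _ /\ X](splitr e) EFinD.
by split; rewrite addeACA; exact: leeD.
Qed.

Lemma tendsBr X X' Y Y' : (forall n, X' n \is a fin_num) ->
  tends (fun n => X n + X' n) (Y + Y') -> tends X' Y' -> Y' \is a fin_num ->
  tends X Y.
Proof.
move=> fX XY XY' fY' e e0.
have [N XN] := XY _ (divr_gt0 e0 (ltr0n _ 2)).
have [N' XN'] := XY' _ (divr_gt0 e0 (ltr0n _ 2)).
exists (maxn N N') => n; rewrite geq_max => /andP[/XN[a b] /XN'[a' b']].
rewrite [in X in X /\ _](splitr e) [in X in _ /\ X](splitr e) EFinD; split.
  rewrite -(@leeD2rE _ (X' n))// (le_trans a)//.
  rewrite -addeA -[leRHS]addeA leeD2l// (addeC (_ + _) (X' n)) addeA.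
  by rewrite leeD2r.
rewrite -(@leeD2rE _ Y')// (le_trans b)//.
rewrite -addeA -[leRHS]addeA leeD2l// (addeC (_ + _) Y') addeA.
by rewrite leeD2r.
Qed.

Lemma tends_sub X Y k : tends X Y -> tends (fun n => X (n + k)%N) Y.
Proof.
move=> XY e /XY[N XN]; exists N => n Nn; apply: XN.
exact: leq_trans Nn (leq_addr _ _).
Qed.

(** [X] has to be close to [X'] only after a delay [k], which may depend on [e]: in the applications
    it is the time the walk needs to advance far enough. *)
Lemma tends_approx X Y :
  (forall e : R, (0 < e)%R -> exists k X' Y', [/\ tends X' Y',
     forall n, X (n + k)%N <= X' n + e%:E /\ X' n <= X (n + k)%N + e%:E,
     Y <= Y' + e%:E & Y' <= Y + e%:E]) -> tends X Y.
Proof.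
move=> H e e0; have e30 : (0 < e / 3)%R by rewrite divr_gt0.
have [k [X' [Y' [XY' XX' YY' Y'Y]]]] := H _ e30.
have [N XN] := XY' _ e30.
exists (N + k)%N => n Nn.
have kn : (k <= n)%N by exact: leq_trans (leq_addl _ _) Nn.
have [a b] := XX' (n - k)%N; rewrite subnK// in a b.
have Nnk : (N <= n - k)%N by rewrite leq_subRL// addnC.
have {XN}[a' b'] := XN _ Nnk.
have eE : e%:E = (e / 3)%:E + ((e / 3)%:E + (e / 3)%:E).
  by rewrite -!EFinD; congr EFin; field.
rewrite eE !addeA; split.
- by rewrite (le_trans a)// leeD2r// (le_trans a')// leeD2r.
- by rewrite (le_trans YY')// leeD2r// (le_trans b')// leeD2r.
Qed.

Lemma tends_cvg X Y : (forall n, X n \is a fin_num) -> Y \is a fin_num ->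
  tends X Y -> X @ \oo --> Y.
Proof.
move=> fX fY XY; rewrite -(fineK fY); apply/fine_cvgP; split; first exact: nearW.
apply/cvgrPdist_le => e /XY[N XN]; exists N => // n /XN /=.
rewrite -(fineK (fX n)) -(fineK fY) -!EFinD !lee_fin => -[a b].
by rewrite ler_distl; apply/andP; split; lra.
Qed.

Lemma geometric_small (r C e : R) : (0 <= r < 1)%R -> (0 < e)%R ->
  exists N, forall n, (N <= n)%N -> (r ^+ n * C <= e)%R.
Proof.
move=> /andP[r0 r1] e0.
have /cvgrPdist_le/(_ e e0)[N _ HN] : (fun n => r ^+ n * C)%R @ \oo --> (0 : R)%R.
  rewrite -[X in _ --> X](mul0r C); apply: cvgMr_tmp.
  by apply: cvg_expr; rewrite ger0_norm.
exists N => n /HN /=; rewrite sub0r normrN => /(le_trans (ler_norm _)).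
exact.
Qed.

Lemma tends_geometric X Y (r C : R) : (0 <= r < 1)%R ->
  (forall n, X n <= Y + (r ^+ n * C)%:E /\ Y <= X n + (r ^+ n * C)%:E) ->
  tends X Y.
Proof.
move=> r01 H e e0; have [N HN] := geometric_small C r01 e0.
exists N => n /HN rC; have [a b] := H n.
by rewrite (le_trans a) ?(le_trans b)// leeD2l// lee_fin.
Qed.

End tends.

(** * Algebra of path weights *)

Section convolution.
Context {R : realType} {d : nat}.
Local Notation Env := (Env R d).
Local Notation site := (site d).
Implicit Types (c : site -> Env -> \bar R).

Lemma conv_assoc c1 c2 c3 : (forall x, nnm (c1 x)) -> (forall x, nnm (c2 x)) ->
  (forall x, nnm (c3 x)) -> conv (conv c1 c2) c3 = conv c1 (conv c2 c3).
Proof.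
move=> n1 n2 n3; apply/funext => y; apply/funext => w; rewrite /conv.
have p1 x v : 0 <= c1 x v by exact: nnm_ge0.
have p2 x v : 0 <= c2 x v by exact: nnm_ge0.
have p3 x v : 0 <= c3 x v by exact: nnm_ge0.
transitivity (\esum_(x in setT) \esum_(v in setT)
  (c1 v w * c2 (x - v)%R (shift v w) * c3 (y - x)%R (shift x w))).
  apply: eq_esum => x _; rewrite esumZr// => v; exact: mule_ge0.
rewrite esum_exchange; last by move=> x v; rewrite !mule_ge0.
apply: eq_esum => v _; rewrite -esumZl//; last first.
  by move=> x; rewrite mule_ge0.
rewrite (@esum_reindex_bij _ _ _ (fun z => z + v)%R (fun x => x - v)%R).
- apply: eq_esum => z _; rewrite addrK muleA shiftD.
  by rewrite opprD addrA addrAC.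
- by move=> x; rewrite addrK.
- by move=> x; rewrite subrK.
Qed.

Lemma conv0c c0 c : (forall x, nnm (c x)) -> conv (steps c0 0) c = c.
Proof.
move=> nc; apply/funext => y; apply/funext => w; rewrite /conv /=.
under eq_esum => x _ do rewrite (fun_if (fun a => a * _)) mul1e mul0e.
rewrite (esum_if1 (i0 := 0%R) (a := fun x => c (y - x)%R (shift x w))).
  by rewrite subr0 shift0.
exact: nnm_ge0.
Qed.

Lemma convc0 c0 c : (forall x, nnm (c x)) -> conv c (steps c0 0) = c.
Proof.
move=> nc; apply/funext => y; apply/funext => w; rewrite /conv /=.
under eq_esum => x _ do rewrite (fun_if (fun a => _ * a)) mule1 mule0 subr_eq0 eq_sym.
by rewrite (esum_if1 (i0 := y) (a := fun x => c x w))//; exact: nnm_ge0.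
Qed.

Lemma stepsS c n : (forall x, nnm (c x)) -> steps c n.+1 = conv c (steps c n).
Proof.
move=> nc; elim: n => [|n ih]; first by rewrite convc0//= conv0c.
transitivity (conv (conv c (steps c n)) c); first by rewrite -ih.
by rewrite conv_assoc//; exact: nnm_steps.
Qed.

Lemma convDr c1 c2 c3 : (forall x, nnm (c1 x)) -> (forall x, nnm (c2 x)) ->
  (forall x, nnm (c3 x)) ->
  conv c1 (fun x w => c2 x w + c3 x w) = fun x w => conv c1 c2 x w + conv c1 c3 x w.
Proof.
move=> n1 n2 n3; apply/funext => y; apply/funext => w; rewrite /conv -esumD.
- apply: eq_esum => x _; rewrite ge0_muleDr//; exact: nnm_ge0.
- by move=> x _; rewrite mule_ge0//; exact: nnm_ge0.
- by move=> x _; rewrite mule_ge0//; exact: nnm_ge0.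
Qed.

Lemma transferDl c1 c2 f : (forall x, nnm (c1 x)) -> (forall x, nnm (c2 x)) ->
  nnm f ->
  transfer (fun x w => c1 x w + c2 x w) f = fun w => transfer c1 f w + transfer c2 f w.
Proof.
move=> n1 n2 nf; apply/funext => w; rewrite /transfer -esumD.
- apply: eq_esum => x _; rewrite ge0_muleDl//; exact: nnm_ge0.
- by move=> x _; rewrite mule_ge0//; exact: nnm_ge0.
- by move=> x _; rewrite mule_ge0//; exact: nnm_ge0.
Qed.

End convolution.

(** * Slow advance is exponentially unlikely *)

Section transience.
Context {R : realType} {d : nat} (u : 'rV[R]_d).
Local Notation Env := (Env R d).
Local Notation site := (site d).
Local Notation H := (halfspace u).
Variables (pp : site -> Env -> \bar R) (eta c : R).
Hypothesis fk : forward_kernel u pp eta c.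
Let npp := fk_nnm fk.
Let n1 : nnm (fun _ : Env => 1 : \bar R). Proof. exact: nnm_cst. Qed.

(** Exponential change of weight along [u]. As [dotu] is additive it commutes with concatenation
    ([tilt_conv]), so the exponential moment of [m] steps is bounded by the [m]-th power of a
    one-step bound. *)
Definition tilt (a : site -> Env -> \bar R) : site -> Env -> \bar R :=
  fun x w => (expR (- dotu x u))%:E * a x w.

Lemma nnm_tilt a : (forall x, nnm (a x)) -> forall x, nnm (tilt a x).
Proof. by move=> na x; apply: nnmZ => //; rewrite lee_fin expR_ge0. Qed.

Lemma tilt_conv a b : (forall x, nnm (a x)) -> (forall x, nnm (b x)) ->
  tilt (conv a b) = conv (tilt a) (tilt b).
Proof.
move=> na nb; apply/funext => y; apply/funext => w.
rewrite /tilt /conv -esumZl ?lee_fin ?expR_ge0//; last first.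
  by move=> x; rewrite mule_ge0//; exact: nnm_ge0.
apply: eq_esum => x _; rewrite muleACA -EFinM -expRD; congr (_%:E * _); congr expR.
by rewrite dotuB; ring.
Qed.

(** Worst case of the one-step exponential moment: a forward jump has factor at most [1], a long one
    at most [exp (- eta)], and long jumps have mass at least [c]. *)
Definition rate : R := (1 - c + c * expR (- eta))%R.

Lemma rate_bounds : (0 <= rate < 1)%R.
Proof.
have c0 := fk_c0 fk; have c1 := c_le1 fk; have e0 := expR_ge0 (- eta).
apply/andP; split; first by rewrite /rate; nra.
have : (expR (- eta) < 1)%R by rewrite expR_lt1 oppr_lt0 (fk_eta0 fk).
by rewrite /rate => h; nra.
Qed.

Lemma tilt_pp_le w : \esum_(z in setT) tilt pp z w <= rate%:E.
Proof.
have nlj z : nnm (long_jumps u pp eta z).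
  by rewrite /long_jumps; case: (_ <= _)%R => //; exact: nnm_cst.
have nsj z : nnm (short_jumps u pp eta z).
  by rewrite /short_jumps; case: (_ <= _)%R => //; exact: nnm_cst.
apply: (@le_trans _ _ (\esum_(z in setT) ((expR (- eta))%:E * long_jumps u pp eta z w
   + short_jumps u pp eta z w))).
  apply: le_esum => z _; rewrite /tilt /long_jumps /short_jumps.
  have [ez|ez] := leP eta (dotu z u).
    rewrite adde0 lee_wpmul2r//; first exact: nnm_ge0.
    by rewrite lee_fin ler_expR lerN2.
  rewrite mule0 add0e; have [z0|z0] := ltP (dotu z u) 0%R.
    by rewrite (fk_forward fk)// mule0.
  rewrite -[leRHS]mul1e lee_wpmul2r//; first exact: nnm_ge0.
  by rewrite lee_fin -expR0 ler_expR oppr_le0.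
have e0 : (0 <= expR (- eta))%R by exact: expR_ge0.
have e1 : (expR (- eta) <= 1)%R.
  by rewrite -expR0 ler_expR oppr_le0 ltW ?(fk_eta0 fk).
rewrite esumD; last 2 first.
- by move=> z _; rewrite mule_ge0 ?lee_fin//; exact: nnm_ge0.
- by move=> z _; exact: nnm_ge0.
rewrite esumZl ?lee_fin//; last by move=> z; exact: nnm_ge0.
rewrite -(excessD u pp eta c w).
have := excess_short fk w; have := excess_ge0 fk w.
set s := \esum_(z in setT) short_jumps u pp eta z w.
have s0 : 0 <= s by apply: esum_ge0 => z _; exact: nnm_ge0.
case: (excess u pp eta c w) => [a| |]//; last first.
  by move: s0; case: s => [b| |].
move: s0; case: s => [b| |]//; rewrite !lee_fin => b0 a0 [ab].
by rewrite /rate mulrDr; have := ler_wpM2r a0 e1; lra.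
Qed.

Lemma tilt_steps_le m w : \esum_(x in setT) tilt (steps pp m) x w <= (rate ^+ m)%:E.
Proof.
have /andP[r0 r1] := rate_bounds.
have E a : \esum_(x in setT) a x w = transfer a (fun=> 1) w.
  by apply: eq_esum => x _; rewrite mule1.
have nt := nnm_tilt npp.
have nst m' x : nnm (tilt (steps pp m') x) by apply: nnm_tilt; exact: nnm_steps.
rewrite E; elim: m => [|m ih] /=.
  rewrite -E expr0 /tilt /=.
  under eq_esum => x _ do rewrite (fun_if (fun a => _ * a)) mule1 mule0.
  rewrite (esum_if1 (i0 := 0%R) (a := fun x => (expR (- dotu x u))%:E)) ?lee_fin ?expR_ge0//.
  by rewrite dotu0 oppr0 expR0.
rewrite tilt_conv//; last exact: nnm_steps.
rewrite -transfer_conv//.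
apply: (@le_trans _ _ (transfer (tilt (steps pp m)) (fun=> rate%:E * 1) w)).
  apply: (sigma_linear_le (sigma_linear_transfer w (nst m))).
  - exact: nnm_transfer.
  - by rewrite mule1; apply: nnm_cst; rewrite lee_fin.
  - move=> v; rewrite mule1 /transfer; under eq_esum do rewrite mule1.
    exact: tilt_pp_le.
have [_ _ ->] := sigma_linear_transfer w (nst m) => //.
by rewrite exprS EFinM lee_wpmul2l// lee_fin.
Qed.

Lemma steps_forward m x w : (dotu x u < 0)%R -> steps pp m x w = 0.
Proof.
elim: m x w => [|m ih] x w x0 /=.
  by case: eqP => // x00; move: x0; rewrite x00 dotu0 ltxx.
rewrite /conv esum1// => y _; have [y0|y0] := ltP (dotu y u) 0%R.
  by rewrite ih// mul0e.
by rewrite (fk_forward fk) ?mule0// dotuB subr_lt0 (lt_le_trans x0).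
Qed.

Lemma dep_steps m x : dep (H 0) (steps pp m x).
Proof.
elim: m x => [|m ih] x; first by [].
change (dep (H 0) (conv (steps pp m) pp x)); apply: dep_esum => y; have [y0|y0] := ltP (dotu y u) 0%R.
  by move=> w w' _; rewrite !steps_forward// !mul0e.
apply: depM => //; apply: depS (dep_shift (fk_dep fk _)) => z /= /eqP.
by rewrite subr_eq0 => /eqP ->.
Qed.

Lemma steps_adapted m : adapted u (steps pp m).
Proof.
elim: m => [|m ih]; first exact: (adapted0 fk).
exact: (adapted_conv fk ih).
Qed.

(** Chernoff bound: on paths that end below level [k] the factor [exp (k - x . u)] is at least
    [1]. *)
Lemma slow_steps_le (k : R) m w :
  \esum_(x in setT) (if (k <= dotu x u)%R then 0 else steps pp m x w) <=
  (expR k * rate ^+ m)%:E.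
Proof.
have ns := nnm_steps m npp.
rewrite EFinM; apply: le_trans _ (lee_wpmul2l _ (tilt_steps_le m w)); last first.
  by rewrite lee_fin expR_ge0.
rewrite -esumZl ?lee_fin ?expR_ge0//; last by move=> x; exact: nnm_ge0 (nnm_tilt ns x).
apply: le_esum => x _; rewrite /tilt muleA -EFinM -expRD.
have s0 : 0 <= steps pp m x w by exact: nnm_ge0.
have [kx|xk] := leP k (dotu x u).
  by rewrite mule_ge0// lee_fin expR_ge0.
rewrite -[leLHS]mul1e lee_wpmul2r// lee_fin -expR0 ler_expR.
by rewrite subr_ge0 ltW.
Qed.

End transience.

(** * Half-spaces behind the origin *)

Section slab_law.
Context {R : realType} {d : nat} (u : 'rV[R]_d).
Local Notation Env := (Env R d).
Local Notation site := (site d).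
Local Notation H := (halfspace u).
Implicit Types (f : Env -> \bar R).
Variables (pp : site -> Env -> \bar R) (eta c : R).
Hypothesis fk : forward_kernel u pp eta c.
Variable P : probability Env R.
Hypothesis Piid : iid_product P.
Local Notation L := (limit_law u pp eta c P).
Local Notation U := (transfer pp).
Let npp := fk_nnm fk.
Let n1 : nnm (fun _ : Env => 1 : \bar R). Proof. exact: nnm_cst. Qed.

Definition unit_local b f := [/\ nnm f, forall w, f w <= 1 & dep (H b) f].

Lemma unit_local_iter b n f : (b <= 0)%R -> unit_local b f ->
  unit_local b (iter n U f).
Proof.
move=> b0 [nf f1 df]; split.
- exact: nnm_iter_transfer.
- exact: (iter_transfer_le fk n nf ler01 f1).
- exact: (dep_iter_transfer fk).
Qed.

Definition mixing (Q : probability Env R) := forall f, unit_local 0 f ->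
  tends (fun n => \int[Q]_w iter n U f w) (L f).

Lemma rate_c : (0 <= 1 - c < 1)%R.
Proof. by rewrite subr_ge0 (c_le1 fk) gtrBl (fk_c0 fk). Qed.

Lemma mixingP : mixing P.
Proof.
move=> f [nf f1 df]; apply: (tends_geometric (r := (1 - c)%R) (C := 1%R) rate_c) => n.
have := Etransfer_limit fk Piid n (adapted0 fk) ler01 nf f1 df.
rewrite !(transfer_steps 0 npp)//; last exact: nnm_iter_transfer.
rewrite [iter 0 _ _]/= integral1; last exact: probability_setT.
by move=> /=; rewrite !mul1e.
Qed.

Lemma limit_law_ge0 f : nnm f -> 0 <= L f.
Proof. by have [I0 _ _] := sigma_linear_limit_law fk P; exact: I0. Qed.

(** Invariance is not visible in the series that defines [L]; it holds because the sequences
    converging to the two sides differ by one unit of time. *)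
Lemma limit_lawU f : unit_local 0 f -> L (U f) = L f.
Proof.
move=> uf; apply: (tends_uniq (X := fun n => \int[P]_w iter n U (U f) w)).
  by apply: mixingP; exact: (unit_local_iter 1 (lexx _) uf).
have := tends_sub 1 (mixingP uf); congr tends.
by apply/funext => n; rewrite addn1 iterSr.
Qed.

(* [crossing k m] is the mass passing from [slow k m] to [fast k m.+1] when one
   more step is inserted at the start of the path, see [fastS]. *)
Definition fast (k : R) m : site -> Env -> \bar R :=
  fun x w => if (k <= dotu x u)%R then steps pp m x w else 0.
Definition slow (k : R) m : site -> Env -> \bar R :=
  fun x w => if (k <= dotu x u)%R then 0 else steps pp m x w.
Definition crossing (k : R) m : site -> Env -> \bar R :=
  fun x w => if (k <= dotu x u)%R then conv pp (slow k m) x w else 0.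

Lemma nnm_fast k m x : nnm (fast k m x).
Proof.
rewrite /fast; case: (_ <= _)%R; last exact: nnm_cst.
exact: nnm_steps.
Qed.

Lemma nnm_slow k m x : nnm (slow k m x).
Proof.
rewrite /slow; case: (_ <= _)%R; first exact: nnm_cst.
exact: nnm_steps.
Qed.

Lemma nnm_crossing k m x : nnm (crossing k m x).
Proof.
rewrite /crossing; case: (_ <= _)%R; last exact: nnm_cst.
by apply: nnm_conv => // y; exact: nnm_slow.
Qed.

Lemma fast_slow k m : (fun x w => fast k m x w + slow k m x w) = steps pp m.
Proof.
apply/funext => x; apply/funext => w; rewrite /fast /slow.
by case: ifP => _; rewrite ?adde0 ?add0e.
Qed.

Lemma fastS k m : fast k m.+1 = fun x w => conv pp (fast k m) x w + crossing k m x w.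
Proof.
apply/funext => x; apply/funext => w; rewrite /fast /crossing.
have [kx|xk] := leP k (dotu x u).
  rewrite stepsS// -[in LHS](fast_slow k m) convDr//.
  - by move=> y; exact: nnm_fast.
  - by move=> y; exact: nnm_slow.
(* An end-point behind level [k] is not reached by a forward first step followed by a path that
   advances by [k], so both sides vanish. *)
rewrite adde0 /conv esum1// => z _.
have [z0|z0] := ltP (dotu z u) 0%R; first by rewrite (fk_forward fk)// mul0e.
rewrite ifF ?mule0//; apply/negbTE; rewrite -ltNge dotuB.
by apply: le_lt_trans xk; rewrite gerBl.
Qed.

Lemma steps_split k m f : nnm f ->
  iter m U f = fun w => transfer (fast k m) f w + transfer (slow k m) f w.
Proof.
move=> nf; rewrite -transfer_steps// -(fast_slow k m) transferDl//.
- by move=> x; exact: nnm_fast.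
- by move=> x; exact: nnm_slow.
Qed.

Lemma slow_le k m f w : nnm f -> (forall w, f w <= 1) ->
  transfer (slow k m) f w <= (expR k * rate eta c ^+ m)%:E.
Proof.
move=> nf f1; apply: le_trans (slow_steps_le fk k m w).
apply: le_esum => x _; rewrite -[leRHS]mule1.
by apply: lee_pmul => //; [exact: nnm_ge0 (nnm_slow k m x)|exact: nnm_ge0].
Qed.

Lemma dep_shift_half b f x : (- b <= dotu x u)%R -> dep (H b) f ->
  dep (H 0) (fun w => f (shift x w)).
Proof.
move=> bx df; apply: depS (dep_shift df) => y; rewrite /halfspace/= dotuB.
by lra.
Qed.

(** The half-space [H b] attached to an end-point at level at least [- b] is contained in the
    half-space [H 0] of the starting point. *)
Lemma dep_fast b m f : dep (H b) f -> dep (H 0) (transfer (fast (- b) m) f).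
Proof.
move=> df; apply: dep_esum => x; rewrite /fast; case bx: (- b <= dotu x u)%R; last first.
  by move=> w w' _; rewrite !mul0e.
by apply: depM; [exact: (dep_steps fk)|exact: (dep_shift_half bx df)].
Qed.

Lemma unit_local_fast b m f : unit_local b f ->
  unit_local 0 (transfer (fast (- b) m) f).
Proof.
move=> [nf f1 df]; have nF := nnm_fast (- b) m; split.
- exact: nnm_transfer.
- move=> w; apply: le_trans (iter_transfer_le fk m nf ler01 f1 w).
  rewrite (steps_split (- b)%R m nf) leeDl//.
  by apply: nnm_ge0; apply: nnm_transfer => // x; exact: nnm_slow.
- exact: dep_fast.
Qed.

(* [L (transfer (fast (- b) m) f)] increases with [m]; summing its increments
   makes countable additivity in [f] evident. *)
Definition slab_law b f : \bar R :=
  L (transfer (fast (- b) 0) f) + \esum_(m in [set: nat]) L (transfer (crossing (- b) m) f).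

Lemma sigma_linear_slab_law b : sigma_linear (slab_law b).
Proof.
have sL cf : (forall x, nnm (cf x)) -> sigma_linear (fun f => L (transfer cf f)).
  move=> ncf; apply: (sigma_linear_comp (T := transfer cf)).
  - exact: (sigma_linear_limit_law fk).
  - by move=> f; exact: nnm_transfer.
  - by move=> w; exact: sigma_linear_transfer.
apply: sigma_linear_add; first by apply: sL => x; exact: nnm_fast.
by apply: sigma_linear_esum => m; apply: sL => x; exact: nnm_crossing.
Qed.

Section approximation.
Variables (b : R) (f : Env -> \bar R).
Hypotheses (b0 : (b <= 0)%R) (uf : unit_local b f).
Let e m := (expR (- b) * rate eta c ^+ m)%R.
Let F m := transfer (fast (- b) m) f.

(** Inserting the new step at the start of the path turns the first part into [U (F m)], to which
    the invariance of [L] applies. *)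
Lemma limit_law_fastS m : L (F m.+1) = L (F m) + L (transfer (crossing (- b) m) f).
Proof.
have [nf f1 df] := uf; have nF m' : nnm (F m').
  by apply: nnm_transfer => // x; exact: nnm_fast.
rewrite /F fastS transferDl//.
- rewrite (sigma_linearD (sigma_linear_limit_law fk P)).
  + rewrite -transfer_conv// => [|x]; last exact: nnm_fast.
    by rewrite limit_lawU//; exact: unit_local_fast.
  + by apply: nnm_transfer => //; apply: nnm_conv => // x; exact: nnm_fast.
  + by apply: nnm_transfer => // x; exact: nnm_crossing.
- by apply: nnm_conv => // x; exact: nnm_fast.
- by move=> x; exact: nnm_crossing.
Qed.

Lemma limit_law_fast m : L (F m) =
  L (F 0) + \sum_(0 <= i < m) L (transfer (crossing (- b) i) f).
Proof.
elim: m => [|m ih]; first by rewrite big_nil adde0.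
by rewrite limit_law_fastS ih big_nat_recr//= addeA.
Qed.

Let rate01 := rate_bounds fk.
Let e0 m : (0 <= e m)%R.
Proof. by rewrite mulr_ge0 ?expR_ge0// exprn_ge0//; case/andP: rate01. Qed.

(** The slow paths dropped by [F m] have mass at most [e m] in every environment, so the comparison
    is uniform in [n] and in the initial law [Q]. *)
Lemma steps_fast (Q : probability Env R) m n :
  \int[Q]_w iter (n + m) U f w <= \int[Q]_w iter n U (F m) w + (e m)%:E /\
  \int[Q]_w iter n U (F m) w <= \int[Q]_w iter (n + m) U f w.
Proof.
have [nf f1 df] := uf.
have nF : nnm (F m) by apply: nnm_transfer => // x; exact: nnm_fast.
have nS : nnm (transfer (slow (- b) m) f).
  by apply: nnm_transfer => // x; exact: nnm_slow.
have sI : sigma_linear (fun h => \int[Q]_w iter n U h w).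
  rewrite (_ : (fun h => _) = (fun h => \int[Q]_w (iter n U h) w))//.
  apply: (sigma_linear_comp (T := fun h => iter n U h) (sigma_linear_integral Q)).
    by move=> h; exact: nnm_iter_transfer.
  move=> w; elim: n w => [|k ih] w; first exact: sigma_linear_eval.
  apply: (sigma_linear_comp (T := iter k U) (sigma_linear_transfer w npp)) => //.
  by move=> h; exact: nnm_iter_transfer.
rewrite iterD (steps_split (- b)%R m nf) (sigma_linearD sI nF nS); split; last first.
  by rewrite leeDl//; have [I0 _ _] := sI; exact: I0.
rewrite leeD2l//; apply: (integral_le_cst Q (nnm_iter_transfer n npp nS)).
apply: (iter_transfer_le fk n nS (e0 m)) => w.
exact: slow_le.
Qed.

(** Both are compared with the expectation of [U^(n + m + j) f], where [F j] can only lose mass and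
    [F m] loses at most [e m]. *)
Lemma fast_close m j : L (F j) <= L (F m) + (e m)%:E.
Proof.
have Ftends k : tends (fun n => \int[P]_w iter n U (F k) w) (L (F k)).
  by apply: mixingP; exact: unit_local_fast.
apply: (tends_le (tends_sub m (Ftends j))
                 (tendsD (tends_sub j (Ftends m)) (tends_cst _))) => n.
have [_ /le_trans] := steps_fast P j (n + m); apply.
by have [+ _] := steps_fast P m (n + j); rewrite addnAC.
Qed.

Lemma slab_law_fast m : L (F m) <= slab_law b f /\
  slab_law b f <= L (F m) + (e m)%:E.
Proof.
have [nf f1 df] := uf.
have C0 i : 0 <= L (transfer (crossing (- b) i) f).
  by apply: limit_law_ge0; apply: nnm_transfer => // x; exact: nnm_crossing.
have F00 : 0 <= L (F 0).
  by apply: limit_law_ge0; apply: nnm_transfer => // x; exact: nnm_fast.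
rewrite /slab_law -nneseries_esumT//; split.
  rewrite limit_law_fast leeD2l//; apply: nneseries_lim_ge => i _ _.
  exact: C0.
(* Finiteness lets this term cross the inequality, which leaves a bound to be checked on partial
   sums. *)
have F0fin : L (F 0) \is a fin_num.
  rewrite ge0_fin_numE//; apply: le_lt_trans (ltry 1).
  have [nF F1 dF] := unit_local_fast 0 uf.
  exact: (limit_law_le fk Piid ler01).
rewrite [leLHS]addeC -(leeBrDr _ _ F0fin).
apply: lime_le; first by apply: is_cvg_nneseries => i _ _; exact: C0.
apply: nearW => j; rewrite (leeBrDr _ _ F0fin) [leLHS]addeC.
have := fast_close m j; rewrite {1}(limit_law_fast j).
exact.
Qed.

Lemma mixing_slab Q : mixing Q ->
  tends (fun n => \int[Q]_w iter n U f w) (slab_law b f).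
Proof.
move=> mQ; apply: tends_approx => r r0.
have [N HN] := geometric_small (expR (- b)) rate01 r0.
have eN : (e N <= r)%R by rewrite /e mulrC HN.
exists N, (fun n => \int[Q]_w iter n U (F N) w), (L (F N)); split.
- by apply: mQ; exact: unit_local_fast.
- move=> n; have [A B] := steps_fast Q N n; split.
    by rewrite (le_trans A)// leeD2l.
  by rewrite (le_trans B)// leeDl// lee_fin ltW.
- by have [_ A] := slab_law_fast N; rewrite (le_trans A)// leeD2l.
- by have [A _] := slab_law_fast N; rewrite (le_trans A)// leeDl// lee_fin ltW.
Qed.

End approximation.

End slab_law.

(** * Absolutely continuous initial laws *)

Section mixing_absolutely_continuous.
Context {R : realType} {d : nat} (u : 'rV[R]_d).
Local Notation Env := (Env R d).
Local Notation site := (site d).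
Local Notation H := (halfspace u).
Implicit Types (f h : Env -> \bar R).
Variables (pp : site -> Env -> \bar R) (eta c : R).
Hypothesis fk : forward_kernel u pp eta c.
Variable P : probability Env R.
Hypothesis Piid : iid_product P.
Local Notation L := (limit_law u pp eta c P).
Local Notation U := (transfer pp).
Let npp := fk_nnm fk.
Let n1 : nnm (fun _ : Env => 1 : \bar R). Proof. exact: nnm_cst. Qed.

Section fixed_function.
Variable f : Env -> \bar R.
Hypothesis uf : unit_local u 0 f.
Let nf : nnm f. Proof. by case: uf. Qed.
Let nUf n : nnm (iter n U f). Proof. exact: nnm_iter_transfer. Qed.
Let Uf1 n w : iter n U f w <= 1.
Proof. by case: uf => _ f1 _; exact: (iter_transfer_le fk n nf ler01 f1). Qed.
Let L0 : 0 <= L f. Proof. exact: (limit_law_ge0 fk). Qed.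
Let L1 : L f <= 1.
Proof. by case: uf => _ f1 df; exact: (limit_law_le fk Piid ler01). Qed.
Let Lfin : L f \is a fin_num.
Proof. by rewrite ge0_fin_numE//; exact: le_lt_trans L1 (ltry _). Qed.

(** For [h] of integral [1] this is convergence from the initial law with density [h]. The
    unnormalised form behaves well under sums and scaling, as the monotone class argument
    requires. *)
Definition asymptotically_independent h :=
  tends (fun n => \int[P]_w (h w * iter n U f w)) (\int[P]_w h w * L f).

Lemma integralM_le h g : nnm h -> nnm g -> (forall w, g w <= 1) ->
  \int[P]_w (h w * g w) <= \int[P]_w h w.
Proof.
move=> nh ng g1.
apply: (sigma_linear_le (sigma_linear_integral P) (nnmM nh ng) nh) => w.
by rewrite -[leRHS]mule1 lee_wpmul2l//; exact: nnm_ge0.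
Qed.

(* After [l] steps the walk is, up to [e], beyond the level [k] bounding the
   sites on which [h] depends, so the regeneration argument applies to [h]. *)
Lemma local_asymptotically_independent h k : nnm h -> (forall w, h w <= 1) ->
  dep [set y | (dotu y u <= k)%R] h -> asymptotically_independent h.
Proof.
move=> nh h1 dh; apply: tends_approx => e e0.
have rate01 := rate_bounds fk.
have [l Hl] := geometric_small (expR k) rate01 e0.
have el : (expR k * rate eta c ^+ l <= e)%R by rewrite mulrC Hl.
pose g x w := h w * fast u pp k l x w.
have nF x : nnm (fast u pp k l x) by exact: (nnm_fast fk).
have nS x : nnm (slow u pp k l x) by exact: (nnm_slow fk).
have ag : adapted u g.
  split=> [x|x]; first exact: nnmM.
  rewrite /g /fast; case kx : (k <= dotu x u)%R; last by move=> w w' _; rewrite !mule0.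
  apply: depM; first by apply: depS dh => y /= /le_trans; apply.
  by have [_] := steps_adapted fk l; apply.
have gE q w : nnm q -> transfer g q w = h w * transfer (fast u pp k l) q w.
  move=> nq; rewrite /transfer -esumZl.
  - by apply: eq_esum => x _; rewrite muleA.
  - exact: nnm_ge0.
  - by move=> x; rewrite mule_ge0//; exact: nnm_ge0.
have hE q : nnm q -> (forall w, q w <= 1) ->
    \int[P]_w (h w * iter l U q w) <= \int[P]_w transfer g q w + e%:E /\
    \int[P]_w transfer g q w <= \int[P]_w (h w * iter l U q w).
  move=> nq q1.
  have nhF : nnm (fun w => h w * transfer (fast u pp k l) q w).
    by apply: nnmM => //; exact: nnm_transfer.
  have nhS : nnm (fun w => h w * transfer (slow u pp k l) q w).
    by apply: nnmM => //; exact: nnm_transfer.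
  rewrite (_ : (fun w => h w * _) = fun w => h w * transfer (fast u pp k l) q w +
                                    h w * transfer (slow u pp k l) q w); last first.
    apply/funext => w; rewrite (steps_split fk k l nq) ge0_muleDr//.
      exact: nnm_ge0 (nnm_transfer nF nq).
    exact: nnm_ge0 (nnm_transfer nS nq).
  rewrite (sigma_linearD (sigma_linear_integral P) nhF nhS).
  rewrite (_ : (fun w => transfer g q w) = fun w => h w * transfer (fast u pp k l) q w);
    last by apply/funext => w; exact: gE.
  split; last by rewrite leeDl// integral_ge0// => w _; exact: nnm_ge0 nhS.
  rewrite leeD2l//; apply: (integral_le_cst P nhS) => w.
  apply: (@le_trans _ _ (1 * transfer (slow u pp k l) q w)).
    by apply: lee_wpmul2r => //; exact: nnm_ge0 (nnm_transfer nS nq).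
  by rewrite mul1e; apply: le_trans (slow_le fk k l w nq q1) _; rewrite lee_fin.
pose M := \int[P]_w transfer g (fun=> 1) w.
have [hM Mh] := hE _ n1 (fun=> lexx _).
have h1E : (fun w => h w * iter l U (fun=> 1) w) = h.
  by apply/funext => w; rewrite (iter_transfer1 fk) mule1.
rewrite h1E -/M in hM Mh.
have Mle1 : M <= 1 by apply: le_trans Mh _; exact: integral_le_cst.
have M0 : 0 <= M by apply: integral_ge0 => w _; apply: nnm_ge0; apply: nnm_transfer => //; case: ag.
exists l, (fun n => \int[P]_w transfer g (iter n U f) w), (M * L f); split.
- apply: (tends_geometric (r := (1 - c)%R) (C := 1%R) (rate_c fk)) => n.
  have [_ f1 df] := uf.
  have [A B] := Etransfer_limit fk Piid n ag ler01 nf f1 df.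
  have r0 : (0 <= (1 - c) ^+ n * 1)%R.
    by rewrite mulr1 exprn_ge0//; case/andP: (rate_c fk).
  have MC : M * ((1 - c) ^+ n * 1)%:E <= ((1 - c) ^+ n * 1)%:E.
    by rewrite -[leRHS]mul1e lee_wpmul2r ?lee_fin.
  by split; [apply: le_trans A _|apply: le_trans B _]; rewrite leeD2l.
- move=> n; have [A B] := hE _ (nUf n) (Uf1 n).
  rewrite addnC iterD; split => //; apply: le_trans B _.
  by rewrite leeDl// lee_fin ltW.
- apply: (@le_trans _ _ ((M + e%:E) * L f)); first exact: lee_wpmul2r.
  rewrite ge0_muleDl//; last by rewrite lee_fin ltW.
  rewrite leeD2l//.
  by rewrite -[leRHS]mule1 lee_wpmul2l// lee_fin ltW.
- apply: (@le_trans _ _ (\int[P]_w h w * L f)); first exact: lee_wpmul2r.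
  by rewrite leeDl// lee_fin ltW.
Qed.

Lemma tail_nneseries (a : nat -> \bar R) (e : R) : (forall n, 0 <= a n) ->
  \sum_(n <oo) a n < +oo -> (0 < e)%R ->
  exists N, \sum_(n <oo) a n <= \sum_(0 <= n < N) a n + e%:E.
Proof.
move=> a0 afin e0.
have fin : \sum_(n <oo) a n \is a fin_num.
  by rewrite ge0_fin_numE// nneseries_ge0.
apply: contrapT => /forallNP HN.
have : \sum_(n <oo) a n <= \sum_(n <oo) a n - e%:E.
  apply: lime_le; first by apply: is_cvg_nneseries => i _ _; exact: a0.
  apply: nearW => N; rewrite leeBrDr//; have /negP := HN N.
  by rewrite -ltNge => /ltW.
by rewrite leeBrDr// -[leRHS]adde0 leeD2lE// lee_fin leNgt e0.
Qed.

(** The tail is small uniformly in time: since [U^m f <= 1], the expectation of [F n * U^m f] is at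
    most that of [F n], and these are summable. *)
Lemma series_asymptotically_independent F : (forall n, nnm (F n)) ->
  (forall n, asymptotically_independent (F n)) ->
  \int[P]_w (\sum_(n <oo) F n w) < +oo ->
  asymptotically_independent (fun w => \sum_(n <oo) F n w).
Proof.
move=> nF aF; have [_ IS _] := sigma_linear_integral P.
rewrite IS// => Ffin.
have IF0 n : 0 <= \int[P]_w F n w.
  by apply: integral_ge0 => w _; exact: nnm_ge0.
have IFle n m : \int[P]_w (F n w * iter m U f w) <= \int[P]_w F n w.
  exact: integralM_le.
have IFm0 n m : 0 <= \int[P]_w (F n w * iter m U f w).
  by apply: integral_ge0 => w _; apply: mule_ge0; exact: nnm_ge0.
have ISm m : \int[P]_w ((\sum_(n <oo) F n w) * iter m U f w) =
    \sum_(n <oo) \int[P]_w (F n w * iter m U f w).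
  have [_ + _] := sigma_linearMl P (nUf m); move=> /(_ F nF) E.
  rewrite (_ : (fun w => _ * _) =
      fun w => iter m U f w * \sum_(n <oo) F n w); last first.
    by apply/funext => w; rewrite muleC.
  rewrite E; apply: eq_eseriesr => n _.
  by apply: eq_integral => w _; rewrite muleC.
apply: tends_approx => e e0.
have [N HN] := tail_nneseries IF0 Ffin e0.
exists 0%N, (fun m => \sum_(0 <= n < N) \int[P]_w (F n w * iter m U f w)),
  ((\sum_(0 <= n < N) \int[P]_w F n w) * L f).
have le_lim (a : nat -> \bar R) : (forall n, 0 <= a n) ->
    \sum_(0 <= n < N) a n <= \sum_(n <oo) a n.
  by move=> a0; apply: nneseries_lim_ge => n _ _.
have tail m : \sum_(N <= n <oo) \int[P]_w (F n w * iter m U f w) <= e%:E.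
  apply: (@le_trans _ _ (\sum_(N <= n <oo) \int[P]_w F n w)).
    by apply: lee_nneseries => n _ *; [exact: IFm0|exact: IFle].
  move: HN; rewrite (@nneseries_split _ _ 0%N N) => [|k _]; last exact: IF0.
  rewrite add0n leeD2lE//.
  rewrite ge0_fin_numE ?sume_ge0//; exact: le_lt_trans (le_lim _ IF0) Ffin.
split.
- elim: N {HN le_lim tail} => [|N ih].
    rewrite big_nil mul0e (_ : (fun m => _) = fun=> 0); first exact: tends_cst.
    by apply/funext => m; rewrite big_nil.
  rewrite big_nat_recr//= ge0_muleDl ?sume_ge0//.
  rewrite (_ : (fun m => _) = fun m => \sum_(0 <= n < N) \int[P]_w (F n w * iter m U f w)
    + \int[P]_w (F N w * iter m U f w)); first exact: tendsD ih (aF N).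
  by apply/funext => m; rewrite big_nat_recr.
- move=> m; rewrite addn0 ISm; split.
    rewrite (@nneseries_split _ _ 0%N N) => [|k _]; last exact: IFm0.
    by rewrite add0n leeD2l.
  by rewrite (le_trans (le_lim _ (IFm0^~ m)))// leeDl// lee_fin ltW.
- rewrite IS//; apply: (le_trans (lee_wpmul2r L0 HN)).
  rewrite ge0_muleDl ?sume_ge0 ?lee_fin//; last exact: ltW.
  by rewrite leeD2l// -[leRHS]mule1 lee_wpmul2l// lee_fin ltW.
- rewrite IS//; apply: (le_trans (lee_wpmul2r L0 (le_lim _ IF0))).
  by rewrite leeDl// lee_fin ltW.
Qed.

Let local_sets : set (set Env) := [set C | measurable C /\
  exists k, dep [set y | (dotu y u <= k)%R] C].

Lemma measurable_local_sets : @measurable _ Env = <<s local_sets >>.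
Proof.
apply/seteqP; split; last first.
  apply: smallest_sub; first exact: sigma_algebra_measurable.
  by move=> C [].
apply: sub_sigma_algebra2 => B [x [z [C [_ [mC ->]]]]]; split.
  by apply: sub_sigma_algebra; exists x, z, C.
exists (dotu x u) => w w' ww'.
by change (C (w x z) = C (w' x z)); rewrite ww'//=.
Qed.

Lemma setI_local_sets : setI_closed local_sets.
Proof.
move=> A B [mA [a dA]] [mB [b dB]]; split; first exact: measurableI.
exists (Num.max a b) => w w' ww'; rewrite /setI /mkset.
rewrite (dA w w'); last by move=> x /= xa; apply: ww'; rewrite /= le_max xa.
by rewrite (dB w w')// => x /= xb; apply: ww'; rewrite /= le_max xb orbT.
Qed.

(** Dynkin argument. For a complement, the convergence for the set itself is cancelled from that for
    the constant [1], which is [mixingP]. *)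
Lemma set_asymptotically_independent C : measurable C ->
  asymptotically_independent (fun w => (\1_C w)%:E).
Proof.
pose D := [set C : set Env | measurable C /\
  asymptotically_independent (fun w => (\1_C w)%:E)].
have loc A : local_sets A -> D A.
  move=> [mA [k dA]]; split => //.
  apply: (local_asymptotically_independent (k := k)).
  - exact: nnm_indic.
  - by move=> w; rewrite lee_fin indicE lern1 leq_b1.
  - exact: dep_indic.
move=> mC; suff : D C by case.
move: C mC; rewrite [measurable]measurable_local_sets.
apply: (lambda_system_subset setI_local_sets) => //.
apply/dynkin_lambda_system; split.
- by apply: loc; split => //; exists 0%R.
- move=> A [mA aA]; split; first exact: measurableC.
  have mAc := measurableC mA.
  have nA := nnm_indic R mA; have nAc := nnm_indic R mAc.
  have I1 w : (\1_(~` A) w)%:E + (\1_A w)%:E = 1 :> \bar R.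
    by rewrite -EFinD !indicE in_setC; case: (w \in A); rewrite /= ?addr0 ?add0r.
  have fin h : nnm h -> (forall w, h w <= 1) -> \int[P]_w h w \is a fin_num.
    move=> nh h1; rewrite ge0_fin_numE; last by apply: integral_ge0 => w _; exact: nnm_ge0.
    exact: le_lt_trans (integral_le_cst P nh h1) (ltry _).
  have indic1 w : (\1_A w)%:E <= 1 :> \bar R by rewrite lee_fin indicE lern1 leq_b1.
  apply: (tendsBr _ _ aA); last first.
  + by rewrite fin_numM// fin.
  + rewrite -ge0_muleDl; last 2 first.
    * by apply: integral_ge0 => w _; exact: nnm_ge0 nAc.
    * by apply: integral_ge0 => w _; exact: nnm_ge0 nA.
    rewrite -(sigma_linearD (sigma_linear_integral P) nAc nA).
    under eq_integral do rewrite I1.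
    rewrite integral1; last exact: probability_setT.
    rewrite mul1e; have := mixingP fk Piid uf; congr tends.
    apply/funext => n.
    rewrite -(sigma_linearD (sigma_linear_integral P) (nnmM nAc (nUf n)) (nnmM nA (nUf n))).
    apply: eq_integral => w _; rewrite -ge0_muleDl ?I1 ?mul1e//; exact: nnm_ge0.
  + move=> n; apply: fin; first exact: nnmM.
    move=> w; apply: (@le_trans _ _ (1 * iter n U f w)).
      by rewrite lee_wpmul2r//; exact: nnm_ge0.
    by rewrite mul1e.
- move=> F tF DF; split.
    by apply: bigcupT_measurable => n; case: (DF n).
  rewrite (_ : (fun w => _) = fun w => \sum_(n <oo) (\1_(F n) w)%:E).
    apply: series_asymptotically_independent => [n|n|].
    + by apply: nnm_indic; case: (DF n).
    + by case: (DF n).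
    + under eq_integral do rewrite -indic_bigcup//.
      rewrite integral_indic_setT; last by apply: bigcupT_measurable => n; case: (DF n).
      apply: le_lt_trans (probability_le1 P _) (ltry _).
      by apply: bigcupT_measurable => n; case: (DF n).
  by apply/funext => w; rewrite indic_bigcup.
Qed.

(** For [r = 0] nothing may be asked of [h]: in the induction that follows, [h] can have infinite
    integral although [r%:E * h] is integrable. *)
Lemma asymptotically_independentZ (r : R) h : (0 <= r)%R -> nnm h ->
  ((0 < r)%R -> asymptotically_independent h) ->
  asymptotically_independent (fun w => r%:E * h w).
Proof.
rewrite le_eqVlt => /predU1P[<- nh _|r0 nh /(_ r0) ah].
  rewrite /asymptotically_independent.
  rewrite (_ : (fun n => _) = fun=> 0); last first.
    by apply/funext => n; under eq_integral do rewrite !mul0e; rewrite integral0.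
  by under eq_integral do rewrite mul0e; rewrite integral0 mul0e; exact: tends_cst.
have [_ _ IZ] := sigma_linear_integral P.
move=> e e0; have [N HN] := ah _ (divr_gt0 e0 r0).
exists N => n /HN[A B].
have rZ q : nnm q -> \int[P]_w (r%:E * h w * q w) = r%:E * \int[P]_w (h w * q w).
  move=> nq; rewrite -(IZ _ _ (ltW r0) (nnmM nh nq)).
  by apply: eq_integral => w _; rewrite muleA.
rewrite (rZ _ (nUf n)) (IZ _ _ (ltW r0) nh) -muleA.
have -> : e%:E = r%:E * (e / r)%:E by rewrite -EFinM mulrC divfK// gt_eqF.
have Ln : 0 <= \int[P]_w h w * L f.
  by rewrite mule_ge0//; apply: integral_ge0 => w _; exact: nnm_ge0.
have Xn : 0 <= \int[P]_w (h w * iter n U f w).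
  by apply: integral_ge0 => w _; exact: nnm_ge0 (nnmM nh (nUf n)).
have er : 0 <= (e / r)%:E by rewrite lee_fin divr_ge0// ltW.
have r0e : 0 <= r%:E by rewrite lee_fin ltW.
by split; rewrite -ge0_muleDr//; apply: lee_wpmul2l.
Qed.

Lemma integrable_asymptotically_independent h : nnm h ->
  \int[P]_w h w < +oo -> asymptotically_independent h.
Proof.
move: h; apply: nnm_ind.
- by move=> A mA _; exact: set_asymptotically_independent.
- move=> r h r0 nh ih rh.
  apply: asymptotically_independentZ => // r_gt0; apply: ih; move: rh.
  have [_ _ IZ] := sigma_linear_integral P; rewrite IZ//.
  by rewrite -lte_pdivlMl// mulry gtr0_sg ?mul1e// invr_gt0.
- move=> F nF ih Ffin; apply: series_asymptotically_independent => // n.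
  apply: ih; apply: le_lt_trans Ffin.
  apply: (sigma_linear_le (sigma_linear_integral P)) => //; first exact: nnm_nneseries.
  move=> w; rewrite (@nneseriesD1 _ _ n)//; last first.
    by move=> k _; exact: nnm_ge0.
  rewrite leeDl//; apply: nneseries_ge0 => k _ _; exact: nnm_ge0.
Qed.

End fixed_function.

Lemma mixing_abs_cont (Q : probability Env R) :
  (forall A, measurable A -> dep (H 0) A -> P A = 0 -> Q A = 0) ->
  mixing u pp eta c P Q.
Proof.
move=> QP f uf; have [nf f1 df] := uf.
(* [Q] is dominated by [P] only on events of [H 0]. Resetting all other sites to a fixed environment
   makes the image laws dominated on the whole space, where Radon-Nikodym applies, and functions
   reading [H 0] do not see the reset. *)
pose w0 : Env := point; pose rho w := splice (H 0) w w0.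
have mrho : measurable_fun setT rho := measurable_splicel _ _.
pose X : {mfun Env >-> Env} := HB.pack rho (isMeasurableFun.Build _ _ _ _ _ mrho).
have nu_mu : distribution Q X `<< distribution P X.
  apply/null_content_dominatesP => A mA PA.
  apply: QP => //.
    by rewrite -[_ @^-1` _]setTI; exact: (measurable_splicel _ _).
  move=> w w' ww'; congr A; apply/funext => x; rewrite /= /rho /splice.
  by case xH : (x \in H 0) => //; apply: ww'; exact: set_mem xH.
have [h [h0 hfin hint hE]] := radon_nikodym_sigma_finite nu_mu.
have nh : nnm h by split => //; exact: measurable_int hint.
have Qh g : nnm g -> dep (H 0) g ->
    \int[Q]_w g w = \int[P]_w (h (rho w) * g w).
  move=> ng dg.
  have hg : \int[distribution Q X]_w g w = \int[distribution P X]_w (h w * g w).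
    apply: (sigma_linear_ext (I := fun g => \int[distribution Q X]_w g w)
      (J := fun g => \int[distribution P X]_w (h w * g w)) _ _ _ ng).
    - exact: sigma_linear_integral.
    - exact: sigma_linearMl.
    - move=> A mA; rewrite integral_indic_setT//.
      apply: etrans (hE A mA) _; rewrite integral_mkcond.
      apply: eq_integral => w _; rewrite patchE indicE.
      by case: (w \in A); rewrite ?mule1 ?mule0.
  have grho w : g (rho w) = g w by exact: dep_splicel.
  transitivity (\int[Q]_w g (rho w)).
    by apply: eq_integral => w _; rewrite grho.
  rewrite -(@ge0_integral_distribution _ _ _ _ _ Q X g ng.2 ng.1) hg.
  have nhg := nnmM nh ng.
  rewrite (@ge0_integral_distribution _ _ _ _ _ P X _ nhg.2 nhg.1).
  by apply: eq_integral => w _ /=; rewrite grho.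
have nhr : nnm (fun w => h (rho w)) by exact: nnm_comp mrho nh.
have hr1 : \int[P]_w h (rho w) = 1.
  transitivity (\int[Q]_w (1 : \bar R)).
    by rewrite Qh//; apply: eq_integral => w _; rewrite mule1.
  by rewrite integral1//; exact: probability_setT.
have := integrable_asymptotically_independent uf nhr.
rewrite /asymptotically_independent hr1 mul1e => /(_ (ltry _)).
congr tends; apply/funext => n; rewrite Qh//.
- exact: nnm_iter_transfer.
- exact: (dep_iter_transfer fk).
Qed.

End mixing_absolutely_continuous.

(** * Extension of consistent laws *)

Section countable_fibers.
Context d (X : measurableType d) (R : realType) (T : countType) (p : X -> T).
Hypothesis mp : forall s, measurable [set x | p x = s].

Lemma measurable_fibers (psi : set T) : measurable [set x | psi (p x)].
Proof.
rewrite (_ : [set x | _] = \bigcup_(n : nat)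
   [set x | exists2 s, @choice.unpickle T n = Some s & psi s /\ p x = s]).
  apply: bigcupT_measurable => n; case: (@choice.unpickle T n) => [s|]; last first.
    by rewrite (_ : mkset _ = set0)//; apply/seteqP; split => x // [].
  have [ps|ps] := pselect (psi s).
    rewrite (_ : mkset _ = [set x | p x = s]); first exact: mp.
    by apply/seteqP; split => [x [s0 [<-] [_ pxs]]|x pxs]//=; exists s.
  rewrite (_ : mkset _ = set0)//; apply/seteqP; split => x // [s0 [<-]].
  by case.
apply/seteqP; split => [x px|x [n _ [s _ [ps pxs]]]]; last first.
  by rewrite /mkset pxs.
by exists (choice.pickle (p x)) => //=; exists (p x) => //; exact: choice.pickleK.
Qed.

Lemma integral_fibers (mu : {measure set X -> \bar R}) (psi : set T) :
  mu [set x | psi (p x)] =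
  \esum_(s in setT) (if s \in psi then mu [set x | p x = s] else 0).
Proof.
rewrite -[LHS](integral_indic_setT mu (measurable_fibers psi)).
transitivity (\int[mu]_x \esum_(s in setT)
   (if s \in psi then (\1_[set x | p x = s] x)%:E else 0)).
  apply: eq_integral => x _; rewrite -[RHS](_ : \esum_(s in setT)
      (if s == p x then (if s \in psi then 1 else 0) else 0) = _).
    rewrite (esum_if1 (a := fun s => if s \in psi then 1 else 0)); last by case: ifP.
    rewrite indicE; case: ifP => [/set_mem px|/negP px]; first by rewrite mem_set.
    by rewrite memNset// => /mem_set.
  apply: eq_esum => s _; rewrite indicE; case: (eqVneq s (p x)) => [->|spx].
    by case: ifP => // _; rewrite mem_set.
  by case: ifP => // _; rewrite memNset//= => /esym; exact/eqP.
rewrite integral_esum.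
- by apply: eq_esum => s _; case: ifP => _; rewrite ?integral0// integral_indic_setT.
- by move=> s x; case: ifP => _//; rewrite lee_fin.
- move=> s; case: (s \in psi); last exact: measurable_cst.
  by case: (nnm_indic R (mp s)).
Qed.
End countable_fibers.

Definition bitstream := nat -> bool.
HB.instance Definition _ := gen_eqMixin bitstream.
HB.instance Definition _ := gen_choiceMixin bitstream.
HB.instance Definition _ := isPointed.Build bitstream (fun=> false).

(* Most recent bit first, so that extending a prefix by one bit is [cons]. *)
Fixpoint recent (b : bitstream) (n : nat) : seq bool :=
  if n is n'.+1 then b n' :: recent b n' else [::].

Lemma size_recent b n : size (recent b n) = n.
Proof. by elim: n => //= n ->. Qed.

Lemma recent_drop b n k : recent b n = drop k (recent b (k + n)).
Proof. by elim: k => [|k ih]; rewrite ?drop0. Qed.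

Lemma eq_recent b b' n : (forall i, (i < n)%N -> b i = b' i) ->
  recent b n = recent b' n.
Proof.
elim: n => //= n ih bb'; rewrite bb'// ih// => i ni; apply: bb'.
exact: ltnW.
Qed.

(** Arbitrary sets of words make the class stable under intersection: two conditions on prefixes
    become one condition on a longer prefix. *)
Definition recent_sets : set (set bitstream) :=
  [set A | exists n (psi : set (seq bool)), A = [set b | psi (recent b n)]].

Definition Bits := g_sigma_algebraType recent_sets.

Lemma setI_recent_sets : setI_closed recent_sets.
Proof.
move=> _ _ [n [psi ->]] [n' [psi' ->]].
exists (n' + n)%N, [set s | psi (drop n' s) /\ psi' (drop n s)].
apply/seteqP; split => b /=; rewrite /setI /=.
  by rewrite -recent_drop addnC -recent_drop.
by rewrite -recent_drop addnC -recent_drop.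
Qed.

Lemma measurable_recent n (psi : set (seq bool)) :
  measurable [set b : Bits | psi (recent b n)].
Proof. by apply: sub_sigma_algebra; exists n, psi. Qed.

Lemma measurable_to_Bits d (X : measurableType d) (h : X -> Bits) :
  (forall n, measurable [set x | h x n]) -> measurable_fun setT h.
Proof.
move=> mh; apply: (@measurability _ _ X Bits setT h recent_sets erefl).
move=> _ /= [_ [n [psi ->]] <-]; rewrite setTI.
apply: (measurable_fibers (p := fun x => recent (h x) n)) => s.
elim: n s => [|n ih] [|b s] /=.
- by rewrite (_ : mkset _ = setT)//; apply/seteqP; split.
- by rewrite (_ : mkset _ = set0)//; apply/seteqP; split.
- by rewrite (_ : mkset _ = set0)//; apply/seteqP; split.
rewrite (_ : mkset _ = [set x | h x n = b] `&` [set x | recent (h x) n = s]).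
  apply: measurableI => //; case: b; first exact: mh.
  rewrite (_ : mkset _ = ~` [set x | h x n]); first exact: measurableC.
  by apply/seteqP; split => x /=; case: (h x n).
by apply/seteqP; split => x /= [-> ->].
Qed.

(** * Random words from a uniform point *)

Section nested_intervals.
Context {R : realType} (m : seq bool -> R).
Hypothesis m0 : forall s, (0 <= m s)%R.
Hypothesis mnil : m [::] = 1%R.
Hypothesis mD : forall s, m s = (m (true :: s) + m (false :: s))%R.

(* [[left_end s, left_end s + m s[] are the nested intervals of lengths [m s]. *)
Fixpoint left_end (s : seq bool) : R :=
  if s is b :: s' then
    if b then (left_end s' + m (false :: s'))%R else left_end s'
  else 0%R.

Fixpoint branch (t : R) n : seq bool :=
  if n is n'.+1 then
    let s := branch t n' in (left_end s + m (false :: s) <= t)%R :: s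
  else [::].

Definition branch_bits (t : R) : Bits :=
  fun n => (left_end (branch t n) + m (false :: branch t n) <= t)%R.

Lemma recent_branch t n : recent (branch_bits t) n = branch t n.
Proof. by elim: n => //= n ->. Qed.

Lemma left_end_bounds s : (0 <= left_end s)%R /\ (left_end s + m s <= 1)%R.
Proof.
elim: s => [|[] s [l0 l1]] /=; first by rewrite mnil add0r.
- have := m0 (false :: s); have := m0 (true :: s); rewrite mD in l1.
  by split; lra.
- have := m0 (false :: s); have := m0 (true :: s); rewrite mD in l1.
  by split; lra.
Qed.

(** Half-open intervals make the two children of a word split its interval exactly, also when one
    child has mass [0] and its interval is empty. *)
Lemma branchP t s : (0 <= t < 1)%R ->
  (branch t (size s) = s) <-> (left_end s <= t < left_end s + m s)%R.
Proof.
move=> t01; elim: s => [|b s ih] /=; first by rewrite mnil add0r t01.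
have ms := mD s; have mt := m0 (true :: s); have mf := m0 (false :: s).
split=> [[bE /[dup] sE /ih/andP[l0 l1]]|].
  rewrite sE in bE; case: b bE => /= [->|/negbT]; first by apply/andP; split => //; lra.
  by rewrite -ltNge => lt; apply/andP; split.
move=> H; have sE : branch t (size s) = s.
  by apply/ih; case: b H => /= /andP[a b]; apply/andP; split; lra.
rewrite sE; congr (_ :: _); case: b H => /= /andP[a b] //.
by apply/negbTE; rewrite -ltNge.
Qed.

Lemma measurable_branch_bits : measurable_fun setT branch_bits.
Proof.
apply: measurable_to_Bits => n; rewrite /branch_bits.
pose A (s : seq bool) := [set t | (left_end s + m (false :: s) <= t)%R].
have mA s : measurable (A s).
  rewrite (_ : A s = [set` `[(left_end s + m (false :: s))%R, +oo[ ])//.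
  by apply/seteqP; split => t; rewrite /A /= in_itv /= andbT.
have mb : forall n s, measurable [set t | branch t n = s].
  elim => [|k ih] [|b s] /=.
  - by rewrite (_ : mkset _ = setT)//; apply/seteqP; split.
  - by rewrite (_ : mkset _ = set0)//; apply/seteqP; split.
  - by rewrite (_ : mkset _ = set0)//; apply/seteqP; split.
  rewrite (_ : mkset _ = (if b then A s else ~` A s) `&` [set t | branch t k = s]).
    by apply: measurableI => //; case: b => //; exact: measurableC.
  apply/seteqP; split => t /=.
    move=> [<- ->]; split => //; rewrite /A /=.
    by case: (boolP (_ <= t)%R) => // /negP.
  case=> + ->; case: b; rewrite /A /= => H; congr (_ :: _) => //.
  by apply/negbTE/negP.
rewrite (_ : mkset _ = \bigcup_(k : nat) [set t | exists2 s,
   @choice.unpickle (seq bool) k = Some s & branch t n = s /\ A s t]).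
  apply: bigcupT_measurable => k; case: (choice.unpickle k) => [s|]; last first.
    by rewrite (_ : mkset _ = set0)//; apply/seteqP; split => x // [].
  rewrite (_ : mkset _ = [set t | branch t n = s] `&` A s); first exact: measurableI.
  by apply/seteqP; split => [t [s0 [<-] [bs As]]|t [/= bs As]] => //; exists s.
apply/seteqP; split => [t At|t [k _ [s _ [bs As]]]]; last by rewrite /mkset bs.
by exists (choice.pickle (branch t n)) => //=; exists (branch t n) => //; exact: choice.pickleK.
Qed.

Lemma integral_indic_itv (a b : R) : (a <= b)%R ->
  \int[lebesgue_measure]_t (\1_[set` `[a, b[ ] t)%:E = (b - a)%:E :> \bar R.
Proof.
move=> ab; apply: etrans (integral_indic_setT _ _) _ => //.
apply: etrans (lebesgue_measure_itv _) _; rewrite /= lte_fin.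
case: ltP => [_|ba]; first by rewrite -EFinB.
by rewrite (@le_anti _ _ a b) ?ab ?ba// subrr.
Qed.

Lemma bits_extension : exists nu : probability Bits R,
  forall s, nu [set b | recent b (size s) = s] = (m s)%:E.
Proof.
have nn1 : nnm (fun t : R => (\1_`[0%R, 1%R[ t)%:E : \bar R) by exact: nnm_indic.
have sI : sigma_linear (fun f : Bits -> \bar R =>
    \int[lebesgue_measure]_t ((\1_`[0%R, 1%R[ t)%:E * f (branch_bits t))).
  apply: (@sigma_linear_comp _ _ _ _ _ _ (fun f t => f (branch_bits t))
    (sigma_linearMl lebesgue_measure nn1)).
  - by move=> f nf; apply: nnm_comp nf; exact: measurable_branch_bits.
  - by move=> t; exact: sigma_linear_eval.
have I1 : \int[lebesgue_measure]_t ((\1_`[0%R, 1%R[ t)%:E * 1) = 1 :> \bar R.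
  under eq_integral do rewrite mule1.
  by rewrite integral_indic_itv ?ler01// subr0.
have [nu nuE] := sigma_linear_probability sI I1.
exists nu => s.
have mB : measurable [set b : Bits | recent b (size s) = s].
  exact: (measurable_recent (size s) [set s' | s' = s]).
rewrite -(integral_indic_setT nu mB) -nuE; last exact: nnm_indic.
transitivity (\int[lebesgue_measure]_t
   (\1_[set` `[left_end s, (left_end s + m s)%R[ ] t)%:E : \bar R).
  apply: eq_integral => t _; rewrite !indicE -EFinM -natrM mulnb; congr (_%:R%:E).
  congr nat_of_bool; apply/idP/idP.
    move=> /andP[]; rewrite !inE/= in_itv/= => t01.
    by rewrite recent_branch in_itv /= => /branchP; apply.
  rewrite inE /= in_itv/= => lt.
  have [l0 l1] := left_end_bounds s.
  have t01 : (0 <= t < 1)%R by move/andP: lt => [a b]; apply/andP; split; lra.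
  apply/andP; split; first by rewrite inE /= in_itv.
  by rewrite inE /= recent_branch; apply/branchP.
rewrite integral_indic_itv ?lerDl//.
by rewrite addrAC subrr add0r.
Qed.

End nested_intervals.

Lemma negligible_countable d (X : measurableType d) (R : realType)
    (mu : {measure set X -> \bar R}) (T : countType) (F : T -> set X) :
  (forall t, mu.-negligible (F t)) -> mu.-negligible (\bigcup_t F t).
Proof.
move=> nF; pose G n := if @choice.unpickle T n is Some t then F t else set0.
apply: (@negligibleS _ _ _ _ (\bigcup_n G n)).
  move=> x [t _ Ft]; exists (choice.pickle t) => //.
  by rewrite /G choice.pickleK.
apply: negligible_bigcup => n; rewrite /G; case: choice.unpickle => //.
exact: negligible_set0.
Qed.

(** * From bits to environments *)

Section environment_extension.
Context {R : realType} {d : nat}.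
Local Notation Env := (Env R d).
Local Notation site := (site d).
Local Notation index := (site * site * rat)%type.
Variable S : nat -> set site.
Hypothesis S_homo : forall k k', (k <= k')%N -> S k `<=` S k'.
Hypothesis S_cover : forall x, exists k, S k x.
Variable lam : nat -> {measure set Env -> \bar R}.
Hypothesis lam1 : forall k, lam k setT = 1.
Hypothesis lam_consistent : forall k k' A, (k <= k')%N -> measurable A ->
  dep (S k) A -> lam k A = lam k' A.
Hypothesis lam_ge0 : forall k x z, S k x -> lam k [set w | (w x z < 0)%R] = 0.

(* An environment is coded by the bits [r < w x z]; only nonnegative entries are
   recovered, as suprema over the rationals [r >= 0]. *)
Definition index_of (n : nat) : option index := @choice.unpickle index n.
Definition code (i : index) : nat := choice.pickle i.

Lemma codeK i : index_of (code i) = Some i.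
Proof. exact: choice.pickleK. Qed.

Definition env_bits (w : Env) : Bits := fun n =>
  if index_of n is Some (x, z, r) then (ratr r < w x z)%R else false.

(** [lam k] is the right law only for the sites of [S k]. Erasing the other bits confines the
    comparison of the bit measure with [lam k] to those sites. *)
Definition mask_bits (k : nat) (b : Bits) : Bits := fun n =>
  if index_of n is Some (x, z, r) then (x \in S k) && b n else false.

Definition decode (b : Bits) : Env := fun x z =>
  fine (ereal_sup (range (fun r : rat =>
    (if b (code (x, z, r)) && (0 <= r)%R then ratr r : R else 0%R)%:E))).

Lemma measurable_decode : measurable_fun setT decode.
Proof.
apply: measurable_to_Env => x z.
pose F (n : nat) (b : Bits) : \bar R :=
  if @choice.unpickle rat n is Some r then
    (if b (code (x, z, r)) && (0 <= r)%R then ratr r : R else 0%R)%:E else 0.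
have mF n : measurable_fun setT (F n).
  rewrite /F; case: (choice.unpickle n) => [r|]; last exact: measurable_cst.
  apply/measurable_EFinP.
  apply: measurable_fun_ifT; [|exact: measurable_cst|exact: measurable_cst].
  apply: (measurable_fun_bool true).
  rewrite setTI (_ : _ @^-1` _ = [set b : Bits | b (code (x, z, r)) && (0 <= r)%R])//.
  have := measurable_recent (code (x, z, r)).+1 [set s | head false s && (0 <= r)%R].
  by congr measurable.
rewrite (_ : (fun b => _) = fun b => fine (esups (F ^~ b) 0%N)).
  apply: measurableT_comp => //.
  exact: measurable_fun_esups.
apply/funext => b; rewrite /decode /esups /=; congr (fine (ereal_sup _)).
apply/seteqP; split.
- move=> _ [r _ <-]; exists (choice.pickle r) => //.
  by rewrite /F choice.pickleK.
- move=> _ [n _ <-]; rewrite /F; case: choice.unpickle => [r|].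
    by exists r.
  (* The index [-1] produces the value [0] given to integers that code no rational. *)
  by exists (-1)%R => //; rewrite andbF.
Qed.

Lemma decode_mask k b x : S k x -> decode (mask_bits k b) x = decode b x.
Proof.
move=> Sx; apply/funext => z; rewrite /decode; congr (fine (ereal_sup _)).
have E r : mask_bits k b (code (x, z, r)) = b (code (x, z, r)).
  by rewrite /mask_bits codeK mem_set.
by apply/seteqP; split=> _ [r _ <-]; exists r; rewrite ?E.
Qed.

Lemma decode_env_bits w x z : (0 <= w x z)%R -> decode (env_bits w) x z = w x z.
Proof.
move=> w0; rewrite /decode /env_bits.
under eq_imagel => r _ do rewrite codeK.
rewrite (_ : ereal_sup _ = (w x z)%:E)//.
apply/eqP; rewrite eq_le; apply/andP; split.
  apply: ge_ereal_sup => _ [r _ <-]; rewrite lee_fin.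
  by case: ifP => // /andP[/ltW].
rewrite leNgt; apply/negP; set l := ereal_sup _ => lt.
have l0 : 0 <= l.
  by apply: ereal_sup_ubound; exists (-1)%R => //; rewrite andbF.
have lfin : l \is a fin_num by rewrite ge0_fin_numE// (lt_trans lt)// ltry.
have l0' : (0 <= fine l)%R by exact: fine_ge0.
rewrite -(fineK lfin) lte_fin in lt.
have [r] := rat_in_itvoo lt; rewrite in_itv /= => /andP[lr rw].
have r0 : (0 <= r)%R by rewrite -(ler0q R) ltW// (le_lt_trans l0').
have : (ratr r)%:E <= l.
  by apply: ereal_sup_ubound; exists r => //; rewrite rw r0.
by rewrite -(fineK lfin) lee_fin leNgt lr.
Qed.

Definition covers (n k : nat) :=
  forall i x z r, (i < n)%N -> index_of i = Some (x, z, r) -> S k x.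

Lemma ex_cover n : exists k, covers n k.
Proof.
elim: n => [|n [k ck]]; first by exists 0%N.
case E : (index_of n) => [[[x z] r]|].
  have [k' Sk'] := S_cover x; exists (maxn k k') => i x0 z0 r0.
  rewrite ltnS leq_eqVlt => /predU1P[->|ni Ei].
    by rewrite E => -[<- _ _]; apply: S_homo Sk'; exact: leq_maxr.
  by apply: S_homo (ck _ _ _ _ ni Ei); exact: leq_maxl.
exists k => i x0 z0 r0; rewrite ltnS leq_eqVlt => /predU1P[->|ni].
  by rewrite E.
exact: ck.
Qed.

Definition level n : nat := sval (cid (ex_cover n)).

Lemma coversS n k k' : (k <= k')%N -> covers n k -> covers n k'.
Proof. by move=> kk' ck i x z r ni Ei; apply: S_homo kk' _ (ck _ _ _ _ ni Ei). Qed.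

Lemma level_covers n k : (level n <= k)%N -> covers n k.
Proof. by move=> /coversS; apply; rewrite /level; case: cid. Qed.

Lemma dep_recent n k : covers n k -> dep (S k) (fun w => recent (env_bits w) n).
Proof.
move=> ck w w' ww'; apply: eq_recent => i ni; rewrite /env_bits.
case E : (index_of i) => [[[x z] r]|//].
by rewrite (ww' x)//; exact: ck ni E.
Qed.

Lemma measurable_env_bits : measurable_fun setT env_bits.
Proof.
apply: measurable_to_Bits => n; rewrite /env_bits.
case: (index_of n) => [[[x z] r]|]; last first.
  by rewrite (_ : mkset _ = set0)//; apply/seteqP; split.
rewrite (_ : mkset _ = (fun w : Env => w x z) @^-1` [set` `]ratr r, +oo[ ]).
  by rewrite -[X in measurable X]setTI; exact: measurable_coord.
by apply/seteqP; split => w; rewrite /preimage /= in_itv /= andbT.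
Qed.

Lemma measurable_mask_bits k : measurable_fun setT (mask_bits k).
Proof.
apply: measurable_to_Bits => n; rewrite /mask_bits.
case: (index_of n) => [[[x z] r]|]; last first.
  by rewrite (_ : mkset _ = set0)//; apply/seteqP; split.
case: (x \in S k) => /=; last first.
  by rewrite (_ : mkset _ = set0)//; apply/seteqP; split.
have := measurable_recent n.+1 [set s | head false s]; congr measurable.
Qed.

Lemma measurable_env_recent n s : measurable [set w | recent (env_bits w) n = s].
Proof.
rewrite (_ : mkset _ = env_bits @^-1` [set b | recent b n = s])//.
rewrite -[X in measurable X]setTI; apply: measurable_env_bits => //.
exact: (measurable_recent n [set s' | s' = s]).
Qed.

Definition cylinder_mass (s : seq bool) : R :=
  fine (lam (level (size s)) [set w | recent (env_bits w) (size s) = s]).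

(** Two stages that cover the sites read by the word are compared through their maximum, so the
    choice made by [level] does not matter. *)
Lemma cylinder_massE s k : covers (size s) k ->
  lam k [set w | recent (env_bits w) (size s) = s] = (cylinder_mass s)%:E.
Proof.
move=> ck; set A := [set w | _]; have mA : measurable A by exact: measurable_env_recent.
have dA k' : covers (size s) k' -> dep (S k') A.
  by move=> ck' w w' ww'; rewrite /A /mkset (dep_recent ck' ww').
have lE : lam k A = lam (level (size s)) A.
  rewrite (lam_consistent (leq_maxl k (level (size s))) mA (dA _ ck)).
  rewrite (lam_consistent (leq_maxr k (level (size s))) mA)//.
  exact/dA/level_covers.
rewrite lE /cylinder_mass fineK// ge0_fin_numE//.
apply: le_lt_trans (ltry 1); rewrite -(lam1 (level (size s))).
by apply: le_measure => //; rewrite inE.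
Qed.

Lemma cylinder_mass_ge0 s : (0 <= cylinder_mass s)%R.
Proof. exact: fine_ge0. Qed.

Lemma cylinder_mass_nil : cylinder_mass [::] = 1%R.
Proof.
rewrite /cylinder_mass (_ : mkset _ = setT) ?lam1//.
by apply/seteqP; split.
Qed.

Lemma cylinder_massD s :
  cylinder_mass s = (cylinder_mass (true :: s) + cylinder_mass (false :: s))%R.
Proof.
apply: EFin_inj; rewrite EFinD.
pose k := maxn (level (size s)) (level (size s).+1).
have c1 : covers (size s) k by apply: level_covers; exact: leq_maxl.
have c2 b : covers (size (b :: s)) k by apply: level_covers; exact: leq_maxr.
rewrite -(cylinder_massE c1) -(cylinder_massE (c2 true)) -(cylinder_massE (c2 false)).
rewrite -measureU//; [|exact: (measurable_env_recent (size s).+1)|exact: (measurable_env_recent (size s).+1)|].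
  congr (lam k _); apply/seteqP; split => w /=.
    by move=> ->; case: (env_bits w (size s)); [left|right].
  by move=> [[_ ->]|[_ ->]].
by apply/seteqP; split => w //= [[-> _] []].
Qed.

Lemma nth_recent b n i : (i < n)%N -> nth false (rev (recent b n)) i = b i.
Proof.
elim: n => // n ih; rewrite ltnS leq_eqVlt /= rev_cons nth_rcons size_rev size_recent.
by move=> /predU1P[->|ni]; rewrite ?ltnn ?eqxx// ni ih.
Qed.

Definition stream_of (s : seq bool) : Bits := nth false (rev s).

Lemma recent_mask k n b :
  recent (mask_bits k b) n = recent (mask_bits k (stream_of (recent b n))) n.
Proof.
apply: eq_recent => i ni; rewrite /mask_bits; case: index_of => [[[x z] r]|]//.
by rewrite /stream_of nth_recent.
Qed.

Lemma environment_extension : exists Q : probability Env R,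
  forall k A, measurable A -> dep (S k) A -> Q A = lam k A.
Proof.
have [nu nuE] := bits_extension cylinder_mass_ge0 cylinder_mass_nil cylinder_massD.
have sI : sigma_linear (fun f : Env -> \bar R => \int[nu]_b f (decode b)).
  apply: (@sigma_linear_comp _ _ _ _ _ _ (fun f b => f (decode b)) (sigma_linear_integral nu)).
  - by move=> f nf; apply: nnm_comp nf; exact: measurable_decode.
  - by move=> b; exact: sigma_linear_eval.
have I1 : \int[nu]_b (1 : \bar R) = 1 by rewrite integral1//; exact: probability_setT.
have [Q QE] := sigma_linear_probability sI I1.
exists Q => k A mA dA.
have nA : nnm (fun w : Env => (\1_A w)%:E : \bar R) by exact: nnm_indic.
have dA1 := dep_indic (R := R) dA.
rewrite -(integral_indic_setT Q mA) -QE//.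
transitivity (\int[nu]_b (\1_A (decode (mask_bits k b)))%:E : \bar R).
  by apply: eq_integral => b _; apply: dA1 => x Sx; rewrite decode_mask.
transitivity (\int[lam k]_w (\1_A (decode (mask_bits k (env_bits w))))%:E : \bar R).
  have nF : nnm (fun b : Bits => (\1_A (decode b))%:E : \bar R).
    by apply: nnm_comp nA; exact: measurable_decode.
  have sJ d' (X : measurableType d') (mu : {measure set X -> \bar R}) (g : X -> Bits) :
      measurable_fun setT g ->
      sigma_linear (fun f : Bits -> \bar R => \int[mu]_x f (mask_bits k (g x))).
    move=> mg; apply: (@sigma_linear_comp _ _ _ _ _ _ (fun f x => f (mask_bits k (g x)))
      (sigma_linear_integral mu)).
    - move=> f nf; apply: nnm_comp nf.
      exact: measurableT_comp (measurable_mask_bits k) mg.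
    - by move=> x; exact: sigma_linear_eval.
  apply: (sigma_linear_unique
    (I := fun f : Bits -> \bar R => \int[nu]_b f (mask_bits k b))
    (J := fun f : Bits -> \bar R => \int[lam k]_w f (mask_bits k (env_bits w)))
    _ _ erefl setI_recent_sets _ _ _ nF).
  - exact: (sJ _ _ nu id (@measurable_id _ _ _)).
  - exact: (sJ _ _ (lam k) _ measurable_env_bits).
  - by rewrite I1 integral1.
  - by rewrite I1 ltry.
  - move=> _ [n [psi ->]].
    (* The first [n] masked bits are a function of the first [n] bits, so the mask can be moved into
       the set of words. *)
    pose psi' := [set s | psi (recent (mask_bits k (stream_of s)) n)].
    have psiE b : (\1_[set b : Bits | psi (recent b n)] (mask_bits k b))%:E =
        (\1_[set b | psi' (recent b n)] b)%:E :> \bar R.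
      rewrite !indicE; congr (_%:R%:E); congr nat_of_bool.
      by apply/idP/idP; rewrite !inE /= recent_mask.
    under eq_integral do rewrite psiE.
    under [RHS]eq_integral do rewrite psiE.
    rewrite integral_indic_setT; last exact: measurable_recent.
    rewrite (integral_fibers (p := fun b : Bits => recent b n)); last first.
      by move=> s; exact: (measurable_recent n [set s' | s' = s]).
    pose B := [set w | psi' (recent (env_bits w) n)].
    rewrite (_ : (fun w => _) = fun w => (\1_B w)%:E)//.
    have mB : measurable B.
      exact: (measurable_fibers (p := fun w : Env => recent (env_bits w) n) (measurable_env_recent n)).
    rewrite integral_indic_setT//.
    have dB : dep (S k) B.
      move=> w w' ww'; rewrite /B /mkset /psi' /mkset -!recent_mask.
      congr psi; apply: eq_recent => i ni; rewrite /mask_bits /env_bits.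
      case: (index_of i) => [[[x z] r]|//]; case xS : (x \in S k) => //=.
      by rewrite (ww' x)//; exact: set_mem.
    rewrite (lam_consistent (leq_maxl k (level n)) mB dB).
    rewrite (integral_fibers (p := fun w : Env => recent (env_bits w) n)); last first.
      exact: measurable_env_recent.
    apply: eq_esum => s _; case: ifP => // _.
    (* Words of any other length have empty fibres under both laws. *)
    have [sn|sn] := eqVneq (size s) n.
      rewrite -sn; apply: etrans (nuE s) _; apply/esym/cylinder_massE.
      by apply: level_covers; exact: leq_maxr.
    rewrite (_ : mkset _ = set0) ?measure0; last first.
      by apply/seteqP; split => b //= bs; move: sn; rewrite -bs size_recent eqxx.
    rewrite (_ : mkset _ = set0) ?measure0//.
    by apply/seteqP; split => b //= bs; move: sn; rewrite -bs size_recent eqxx.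
rewrite -(integral_indic_setT (lam k) mA).
have [_ mAd] := nnm_comp measurable_decode nA.
apply: ge0_ae_eq_integral => //.
- have mh := measurableT_comp (measurable_mask_bits k) measurable_env_bits.
  exact: measurableT_comp mAd mh.
- by case: nA.
change ((lam k).-negligible (~` [set w : Env | setT w ->
  (\1_A (decode (mask_bits k (env_bits w))))%:E = (\1_A w)%:E :> \bar R])).
(* Decoding inverts coding on [S k] unless some entry there is negative, and there are countably
   many entries. *)
suff : (lam k).-negligible (\bigcup_(i : site * site)
    [set w : Env | S k i.1 /\ (w i.1 i.2 < 0)%R]).
  apply: negligibleS => w /= /not_implyP[_ Aw]; apply: contrapT => Nw; apply: Aw.
  apply: dA1 => x Sx; rewrite decode_mask//; apply/funext => z.
  rewrite decode_env_bits// leNgt; apply/negP => wxz.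
  by apply: Nw; exists (x, z).
apply: negligible_countable => -[x z] /=.
have [Sx|NSx] := pselect (S k x).
  suff : (lam k).-negligible [set w : Env | (w x z < 0)%R].
    by apply: negligibleS => w [].
  apply/negligibleP; last exact: lam_ge0.
  rewrite (_ : mkset _ = (fun w : Env => w x z) @^-1` [set` `]-oo, 0%R[ ]).
    by rewrite -[X in measurable X]setTI; exact: measurable_coord.
  by apply/seteqP; split => w; rewrite /preimage /= in_itv.
by rewrite (_ : mkset _ = set0); [exact: negligible_set0|apply/seteqP; split => w // []].
Qed.

End environment_extension.

(** * The stationary law *)

Section stationary_law.
Context {R : realType} {d : nat} (u : 'rV[R]_d).
Local Notation Env := (Env R d).
Local Notation site := (site d).
Local Notation H := (halfspace u).
Local Notation ind A := (fun w : Env => (\1_A w)%:E : \bar R).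
Implicit Types (f : Env -> \bar R) (A B : set Env).
Variables (pp : site -> Env -> \bar R) (eta c : R).
Hypothesis fk : forward_kernel u pp eta c.
Variable P : probability Env R.
Hypothesis Piid : iid_product P.
Hypothesis P_ge0 : forall x z, P [set w | (w x z < 0)%R] = 0.
Local Notation U := (transfer pp).
Local Notation slab := (slab_law u pp eta c P).
Let npp := fk_nnm fk.
Let n1 : nnm (fun _ : Env => 1 : \bar R). Proof. exact: nnm_cst. Qed.

Lemma unit_local_indic b A : measurable A -> dep (H b) A -> unit_local u b (ind A).
Proof.
move=> mA dA; split; [exact: nnm_indic| |exact: dep_indic].
by move=> w; rewrite lee_fin indicE lern1 leq_b1.
Qed.

(** By stationarity a null event stays null after a shift by [x], and the paths ending at [x] have
    weight at most [1]. *)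
Lemma Eiter_null n A : measurable A -> P A = 0 ->
  \int[P]_w iter n U (ind A) w = 0.
Proof.
move=> mA PA; have nA := nnm_indic R mA.
have nst := nnm_steps n npp.
rewrite -transfer_steps// integral_esum.
- rewrite esum1// => x _; apply/eqP; rewrite eq_le; apply/andP; split; last first.
    by apply: integral_ge0 => w _; apply: mule_ge0; [exact: nnm_ge0 (nst x)|exact: nnm_ge0 nA].
  rewrite -PA -(integral_indic_setT P mA) -(iid_shift Piid x nA).
  apply: (sigma_linear_le (sigma_linear_integral P)).
  + exact: (nnmM (nst x) (nnm_shift x nA)).
  + exact: (nnm_shift x nA).
  + move=> w; rewrite -[leRHS]mul1e lee_wpmul2r//.
    have -> : 1 = transfer (steps pp n) (fun=> 1) w :> \bar R.
      by rewrite transfer_steps// (iter_transfer1 fk).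
    rewrite /transfer; under eq_esum do rewrite mule1.
    by apply: (esum_ge1 (a := fun x => steps pp n x w) x) => y; exact: nnm_ge0.
- by move=> x w; apply: mule_ge0; [exact: nnm_ge0 (nst x)|exact: nnm_ge0 nA].
- by move=> x; case: (nnmM (nst x) (nnm_shift x nA)).
Qed.

Lemma slab_tends b f : unit_local u b f ->
  tends (fun n => \int[P]_w iter n U f w) (slab b f).
Proof.
by move=> uf; apply: (mixing_slab fk Piid uf); exact: (mixingP fk Piid).
Qed.

Lemma slab_lawU b f : (b <= 0)%R -> unit_local u b f -> slab b (U f) = slab b f.
Proof.
move=> b0 uf; apply: (tends_uniq (X := fun n => \int[P]_w iter n U (U f) w)).
  by apply: slab_tends => //; exact: (unit_local_iter fk 1 b0 uf).
have := tends_sub 1 (slab_tends uf); congr tends.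
by apply/funext => n; rewrite addn1 iterSr.
Qed.

Lemma slab_law1 b : slab b (fun=> 1) = 1.
Proof.
apply: (tends_uniq (X := fun n => \int[P]_w iter n U (fun=> 1) w)).
  by apply: slab_tends => //; split => // w; rewrite lexx.
rewrite (_ : (fun n => _) = fun=> 1); first exact: tends_cst.
apply/funext => n; rewrite (iter_transfer1 fk) integral1//.
exact: probability_setT.
Qed.

Lemma slab_law_null b A : measurable A -> dep (H b) A ->
  P A = 0 -> slab b (ind A) = 0.
Proof.
move=> mA dA PA; have := slab_tends (unit_local_indic mA dA).
rewrite (_ : (fun n => _) = fun=> 0); last by apply/funext => n; exact: Eiter_null.
by move=> /tends_uniq; apply; exact: tends_cst.
Qed.

Definition back (k : nat) : set site := H (- k%:R).

Lemma back_le0 k : (- k%:R <= 0 :> R)%R.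
Proof. by rewrite oppr_le0. Qed.

Lemma backS k k' : (k <= k')%N -> back k `<=` back k'.
Proof. by move=> kk'; apply: halfspaceS; rewrite lerN2 ler_nat. Qed.

Lemma back_cover x : exists k, back k x.
Proof.
exists (Num.bound `|dotu x u|); rewrite /back /halfspace /=.
rewrite lerNl; apply: le_trans (ler_norm _) _; rewrite normrN.
by apply/ltW/archi_boundP.
Qed.

Lemma measurable_negative x z : measurable [set w : Env | (w x z < 0)%R].
Proof.
rewrite (_ : mkset _ = (fun w : Env => w x z) @^-1` [set` `]-oo, 0%R[ ]).
  by rewrite -[X in measurable X]setTI; exact: measurable_coord.
by apply/seteqP; split => w; rewrite /preimage /= in_itv.
Qed.

Lemma stationary_law : exists Q : probability Env R,
  forall k A, measurable A -> dep (back k) A -> Q A = slab (- k%:R) (ind A).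
Proof.
have /choice[lam lamE] : forall k, exists mu : {measure set Env -> \bar R},
    forall f, nnm f -> slab (- k%:R) f = \int[mu]_w f w.
  by move=> k; apply: sigma_linear_measure; exact: (sigma_linear_slab_law fk).
have lamI k A : measurable A -> lam k A = slab (- k%:R) (ind A).
  by move=> mA; rewrite lamE ?integral_indic_setT//; exact: nnm_indic.
have [Q QE] : exists Q : probability Env R,
    forall k A, measurable A -> dep (back k) A -> Q A = lam k A.
  apply: (environment_extension backS back_cover).
  - move=> k; rewrite lamI// (_ : (fun w => _) = fun=> 1).
      exact: slab_law1.
    by apply/funext => w; rewrite indicT.
  (* Both values are limits of the same sequence of expectations, in which the half-space does not
     occur. *)
  - move=> k k' A kk' mA dA; rewrite (lamI k A mA) (lamI k' A mA).
    apply: (tends_uniq (slab_tends (unit_local_indic mA dA))).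
    apply: slab_tends; apply: unit_local_indic => //.
    by apply: depS dA; exact: backS.
  - move=> k x z Sx; have mN := measurable_negative x z.
    rewrite (lamI k _ mN); apply: slab_law_null => //.
    move=> w w' ww'; change ((w x z < 0)%R = (w' x z < 0)%R :> Prop).
    by rewrite ww'.
by exists Q => k A mA dA; rewrite (QE k) ?lamI.
Qed.

Lemma ge0_indicI A B w : (\1_(A `&` B) w)%:E = (\1_A w)%:E * (\1_B w)%:E :> \bar R.
Proof. by rewrite indicI EFinM. Qed.

Variable Q : probability Env R.
Hypothesis QE : forall k A, measurable A -> dep (back k) A ->
  Q A = slab (- k%:R) (ind A).

Definition back_sets : set (set Env) :=
  [set A | measurable A /\ exists k, dep (back k) A].

Lemma measurable_back_sets : @measurable _ Env = <<s back_sets >>.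
Proof.
apply/seteqP; split; last first.
  apply: smallest_sub; first exact: sigma_algebra_measurable.
  by move=> C [].
apply: sub_sigma_algebra2 => B [x [z [C [_ [mC ->]]]]]; split.
  by apply: sub_sigma_algebra; exists x, z, C.
have [k kx] := back_cover x; exists k => w w' ww'.
by change (C (w x z) = C (w' x z)); rewrite ww'.
Qed.

Lemma setI_back_sets : setI_closed back_sets.
Proof.
move=> A B [mA [a dA]] [mB [b dB]]; split; first exact: measurableI.
exists (maxn a b) => w w' ww'; rewrite /setI /mkset.
rewrite (dA w w'); last by move=> x xa; apply: ww'; apply: backS xa; exact: leq_maxl.
by rewrite (dB w w')// => x xb; apply: ww'; apply: backS xb; exact: leq_maxr.
Qed.

Lemma probability_eq (Q1 Q2 : probability Env R) :
  (forall A, back_sets A -> Q1 A = Q2 A) -> forall A, measurable A -> Q1 A = Q2 A.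
Proof.
move=> Q12 A mA; rewrite -(integral_indic_setT Q1 mA) -(integral_indic_setT Q2 mA).
have nA := nnm_indic R mA.
apply: (sigma_linear_unique (I := fun f => \int[Q1]_w f w)
  (J := fun f => \int[Q2]_w f w) _ _ measurable_back_sets setI_back_sets _ _ _ nA).
- exact: sigma_linear_integral.
- exact: sigma_linear_integral.
- by rewrite !integral1//; exact: probability_setT.
- by rewrite integral1 ?ltry//; exact: probability_setT.
- by move=> B BB; have [mB _] := BB; rewrite !integral_indic_setT//; exact: Q12.
Qed.

(** The two functionals are known to agree only on events of [back k]. Composed with the reset of
    all other sites they agree on every measurable set, and the reset does not change [f]. *)
Lemma Q_slab k f : nnm f -> dep (back k) f -> \int[Q]_w f w = slab (- k%:R) f.
Proof.
move=> nf df; pose rho w := splice (back k) w (point : Env).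
have mrho : measurable_fun setT rho := measurable_splicel _ _.
have fE g : dep (back k) g -> (fun w => g (rho w)) = g :> (Env -> \bar R).
  by move=> dg; apply/funext => w; exact: dep_splicel.
have sI (I : (Env -> \bar R) -> \bar R) : sigma_linear I ->
    sigma_linear (fun g => I (fun w => g (rho w))).
  move=> sI; apply: (@sigma_linear_comp _ _ _ _ _ _ (fun g w => g (rho w)) sI).
  - by move=> g ng; exact: nnm_comp mrho ng.
  - by move=> w; exact: sigma_linear_eval.
have := sigma_linear_ext (sI _ (sigma_linear_integral Q))
  (sI _ (sigma_linear_slab_law fk P (- k%:R))) _ nf.
rewrite (fE _ df); apply => A mA.
pose A' := [set w | A (rho w)].
have mA' : measurable A' by rewrite -[A']setTI; exact: mrho.
have dA' : dep (back k) A'.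
  move=> w w' ww'; congr A; apply/funext => x; rewrite /rho /splice.
  by case xk : (x \in back k) => //; apply: ww'; exact: set_mem.
change (\int[Q]_w (ind A') w = slab (- k%:R) (ind A')).
by rewrite integral_indic_setT//; exact: QE.
Qed.

Lemma Q_null k A : measurable A -> dep (back k) A -> P A = 0 -> Q A = 0.
Proof.
by move=> mA dA PA; rewrite (QE mA dA); exact: slab_law_null.
Qed.

(** Path weights read nothing ahead of their end-point, so such an event keeps the probability [P A]
    at every time and not just in the limit. *)
Lemma Q_fresh A : measurable A -> dep [set x | (0 < dotu x u)%R] A -> P A = Q A.
Proof.
move=> mA dA; have dA0 : dep (back 0) A.
  by apply: depS dA => x; rewrite /back /halfspace/= oppr0; exact: ltW.
rewrite (QE mA dA0).
have := slab_tends (unit_local_indic mA dA0).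
rewrite (_ : (fun n => _) = fun=> P A).
  by move=> /(tends_uniq (tends_cst _)).
apply/funext => n; rewrite -transfer_steps//; last exact: nnm_indic.
rewrite (Etransfer_fresh Piid (steps_adapted fk n) (nnm_indic R mA) (dep_indic dA)).
rewrite transfer_steps// (iter_transfer1 fk) integral1; last exact: probability_setT.
by rewrite mul1e integral_indic_setT.
Qed.

(** The fixed-point equation of the limit law gives [c * P A <= Q A] for events of the half-space at
    the origin. *)
Lemma Q_null_inv A : measurable A -> dep (H 0) A -> Q A = 0 -> P A = 0.
Proof.
move=> mA dA QA; have dA0 : dep (back 0) A by rewrite /back oppr0.
have nA := nnm_indic R mA.
have L0 : limit_law u pp eta c P (ind A) = 0.
  rewrite -QA (QE mA dA0); apply: (tends_uniq (X := fun n => \int[P]_w iter n U (ind A) w)).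
    by apply: (mixingP fk Piid); exact: unit_local_indic.
  by apply: slab_tends; exact: unit_local_indic.
have := limit_law_split fk P 1 nA; rewrite L0 big_nat1/= integral_indic_setT//.
move=> /esym/eqP; rewrite padde_eq0; last 2 first.
- by rewrite mule_ge0// lee_fin ltW// (fk_c0 fk).
- by apply: (limit_law_ge0 fk); exact: (nnm_coin_kernel fk).
move=> /andP[+ _]; rewrite mule_eq0 => /orP[|/eqP//].
by rewrite eqe gt_eqF// (fk_c0 fk).
Qed.

Lemma sigma_linear_EU (mu : probability Env R) :
  sigma_linear (fun f => \int[mu]_w U f w).
Proof.
apply: (sigma_linear_comp (T := U) (sigma_linear_integral mu)).
- by move=> f; exact: nnm_transfer.
- by move=> w; exact: sigma_linear_transfer.
Qed.

Lemma Q_invariant f : nnm f -> \int[Q]_w U f w = \int[Q]_w f w.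
Proof.
apply: (sigma_linear_unique (I := fun f => \int[Q]_w U f w)
  (J := fun f => \int[Q]_w f w) _ _ measurable_back_sets setI_back_sets).
- exact: sigma_linear_EU.
- exact: sigma_linear_integral.
- by rewrite (transfer1 fk).
- by rewrite (transfer1 fk) integral1 ?ltry//; exact: probability_setT.
- move=> A [mA [k dA]]; have uA := unit_local_indic mA dA.
  have [nU _ dU] := unit_local_iter fk 1 (back_le0 k) uA.
  have [nA _ dA1] := uA.
  rewrite (Q_slab nU dU) (Q_slab nA dA1).
  exact: (slab_lawU (back_le0 k) uA).
Qed.

(** Invariance makes the expectation of [U^n 1_A] under [Q'] constant in [n], and mixing from [Q']
    identifies that constant with the limit. *)
Lemma stationary_unique (Q' : probability Env R) :
  (forall A, measurable A -> \int[Q']_w U (ind A) w = Q' A) ->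
  (forall A, measurable A -> dep (H 0) A -> P A = 0 -> Q' A = 0) ->
  forall A, measurable A -> Q' A = Q A.
Proof.
move=> inv ac; apply: probability_eq => A [mA [k dA]].
have invf f : nnm f -> \int[Q']_w U f w = \int[Q']_w f w.
  apply: (sigma_linear_ext (I := fun f => \int[Q']_w U f w)
    (J := fun f => \int[Q']_w f w) (sigma_linear_EU Q') (sigma_linear_integral Q')).
  by move=> B mB; rewrite integral_indic_setT//; exact: inv.
have nA := nnm_indic R mA.
have itE n : \int[Q']_w iter n U (ind A) w = Q' A.
  elim: n => [|n ih]; first exact: integral_indic_setT.
  by rewrite iterS invf//; exact: nnm_iter_transfer.
have mQ' := mixing_abs_cont fk Piid ac.
have := mixing_slab fk Piid (unit_local_indic mA dA) mQ'.
rewrite (_ : (fun n => _) = fun=> Q' A); last by apply/funext.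
by move=> /(tends_uniq (tends_cst _)) ->; rewrite (QE mA dA).
Qed.

Lemma Q_ergodic A : measurable A -> {ae Q, forall w, U (ind A) w = (\1_A w)%:E} ->
  Q A = 0 \/ Q A = 1.
Proof.
move=> mA AE; have [|QA0] := eqVneq (Q A) 0; [by left|right].
have nA := nnm_indic R mA.
have Q0 : 0 <= Q A by [].
have Qfin : Q A \is a fin_num.
  by rewrite ge0_fin_numE//; apply: le_lt_trans (probability_le1 Q mA) (ltry _).
pose a := fine (Q A); have aE : Q A = a%:E by rewrite fineK.
have a0 : (0 < a)%R by rewrite -lte_fin -aE lt_neqAle eq_sym QA0.
have sI := sigma_linearMl Q nA.
have sJ : sigma_linear (fun f => a^-1%:E * \int[Q]_w ((\1_A w)%:E * f w)).
  by apply: sigma_linearZ => //; rewrite lee_fin invr_ge0 ltW.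
have J1 : a^-1%:E * \int[Q]_w ((\1_A w)%:E * 1) = 1.
  under eq_integral do rewrite mule1.
  by rewrite integral_indic_setT//= aE -EFinM mulVf// gt_eqF.
have [Q' Q'E] := sigma_linear_probability sJ J1.
have Q'I B : measurable B -> Q' B = a^-1%:E * Q (A `&` B).
  move=> mB; rewrite -(integral_indic_setT Q' mB) -Q'E; last exact: nnm_indic.
  rewrite -(integral_indic_setT Q (measurableI _ _ mA mB)); congr (_ * _).
  by apply: eq_integral => w _; rewrite ge0_indicI.
(* Almost surely a step from [A] stays in [A] and a step from outside stays outside, so
   [1_A * U 1_B] agrees with [U] applied to the indicator of the intersection. This is what makes
   the conditioned law invariant. *)
have UE B : measurable B -> \int[Q]_w ((\1_A w)%:E * U (ind B) w) = Q (A `&` B).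
  move=> mB; have mAB := measurableI _ _ mA mB.
  have nB := nnm_indic R mB; have nAB := nnm_indic R mAB.
  rewrite -(integral_indic_setT Q mAB) -(Q_invariant nAB).
  have nUB := nnm_transfer npp nB; have nUAB := nnm_transfer npp nAB.
  apply: ge0_ae_eq_integral => //.
  - by case: (nnmM nA nUB).
  - by case: nUAB.
  - by move=> w _; exact: nnm_ge0 (nnmM nA nUB).
  - by move=> w _; exact: nnm_ge0.
  apply: filterS AE => w Uw _.
  have sU := sigma_linear_transfer w npp.
  have [wA|wA] := boolP (w \in A).
    rewrite indicE wA mul1e; rewrite indicE wA in Uw.
    have mAc := measurableC mA; have nAc := nnm_indic R mAc.
    have mAcB := measurableI _ _ mAc mB; have nAcB := nnm_indic R mAcB.
    have Uc : U (ind (~` A)) w = 0.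
      have : U (ind (~` A)) w + 1 = 1.
        rewrite -[X in _ + X]Uw -(sigma_linearD sU nAc nA).
        rewrite (_ : (fun v => _) = fun=> 1) ?(transfer1 fk)//.
        apply/funext => v; rewrite -EFinD !indicE in_setC.
        by case: (v \in A); rewrite /= ?addr0 ?add0r.
      case: (U (ind (~` A)) w) => [r| |]//= [/eqP].
      by rewrite eq_sym -subr_eq subrr eq_sym => /eqP ->.
    have -> : ind B = fun v => (\1_(A `&` B) v)%:E + (\1_(~` A `&` B) v)%:E.
      apply/funext => v; rewrite -EFinD !indicE !in_setI in_setC.
      by case: (v \in A); rewrite /= ?addr0 ?add0r.
    rewrite (sigma_linearD sU nAB nAcB) [X in _ + X](_ : _ = 0) ?adde0//.
    apply/eqP; rewrite eq_le; apply/andP; split; last first.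
      exact: nnm_ge0 (nnm_transfer npp nAcB).
    rewrite -Uc; apply: (sigma_linear_le sU nAcB nAc) => v.
    by rewrite lee_fin !indicE in_setI ler_nat; case: (v \in _); case: (v \in _).
  rewrite indicE (negbTE wA) mul0e; rewrite indicE (negbTE wA) in Uw.
  apply/eqP; rewrite eq_le; apply/andP; split; first exact: nnm_ge0.
  rewrite -[leRHS]Uw; apply: (sigma_linear_le sU nAB nA) => v.
  by rewrite lee_fin !indicE in_setI ler_nat; case: (v \in _); case: (v \in _).
have QQ' : Q' A = Q A.
  apply: stationary_unique => // B mB.
    rewrite -Q'E; last by apply: nnm_transfer => //; exact: nnm_indic.
    by rewrite UE// Q'I.
  move=> dB PB; rewrite Q'I// (_ : Q _ = 0) ?mule0//.
  have QB : Q B = 0 by apply: (@Q_null 0%N) => //; rewrite /back oppr0.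
  apply/eqP; rewrite eq_le measure_ge0 andbT -QB.
  by apply: le_measure; rewrite ?inE//; exact: measurableI.
by rewrite -QQ' Q'I// setIid aE -EFinM mulVf// gt_eqF.
Qed.

End stationary_law.

(** * Jump laws *)

Section measurability_countable.
Context d (X : measurableType d) (R : realType).

Lemma measurable_forall (T : countType) (F : T -> set X) :
  (forall t, measurable (F t)) -> measurable [set x | forall t, F t x].
Proof.
move=> mF.
rewrite (_ : mkset _ = \bigcap_n
  (if @choice.unpickle T n is Some t then F t else setT)).
  apply: bigcapT_measurable => n.
  by case: choice.unpickle => [t|]; [exact: mF|exact: measurableT].
apply/seteqP; split => [x Fx n _|x Fx t].
  by case: choice.unpickle => // t; exact: Fx.
by have := Fx (choice.pickle t) Logic.I; rewrite choice.pickleK.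
Qed.

(* The terms may be negative: the sum is a supremum over finite subsets, taken
   here over the countable type of lists. *)
Lemma measurable_esum_in (T : countType) (D : set T) (a : T -> X -> \bar R) :
  (forall t, measurable_fun setT (a t)) ->
  measurable_fun setT (fun x => \esum_(t in D) a t x).
Proof.
move=> ma.
pose F (n : nat) (x : X) : \bar R := if @choice.unpickle (seq T) n is Some s then
  if uniq s && all (mem D) s then \sum_(t <- s) a t x else -oo else -oo.
have mF n : measurable_fun setT (F n).
  rewrite /F; case: choice.unpickle => [s|]; last exact: measurable_cst.
  case: (_ && _); last exact: measurable_cst.
  exact: emeasurable_sum.
rewrite (_ : (fun x => _) = fun x => esups (F ^~ x) 0%N).
  exact: measurable_fun_esups.
apply/funext => x; rewrite /esups /esum; apply/eqP; rewrite eq_le; apply/andP; split.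
  apply: ge_ereal_sup => _ /= [A [finA AD] <-].
  apply: ereal_sup_ubound; rewrite /sdrop /=.
  exists (choice.pickle (enum_fset (fset_set A))) => //.
  rewrite /F choice.pickleK fset_uniq /= fsbig_finite//=.
  rewrite ifT//; apply/allP => t tA; rewrite inE; apply: AD.
  by move: tA; rewrite -[_ \in _]/(t \in fset_set A) in_fset_set// inE.
apply: ge_ereal_sup => _ /= [n _ <-]; rewrite /F.
case: choice.unpickle => [s|]; last by rewrite leNye.
case: ifP => [/andP[us sD]|_]; last by rewrite leNye.
apply: ereal_sup_ubound => /=; exists [set` s].
  split; first exact: finite_seq.
  by move=> t /= ts; move/allP : sD => /(_ _ ts); rewrite inE.
by rewrite -fsbig_seq.
Qed.

Lemma measurable_esum_EFin (T : countType) (D : set T) (a : T -> X -> R) :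
  (forall t, measurable_fun setT (a t)) ->
  measurable_fun setT (fun x => \esum_(t in D) (a t x)%:E).
Proof.
by move=> ma; apply: measurable_esum_in => t; exact/measurable_EFinP.
Qed.

Lemma probability_setI1 (P : probability X R) (A B : set X) :
  measurable A -> measurable B -> P A = 1 -> P B = 1 -> P (A `&` B) = 1.
Proof.
move=> mA mB PA PB.
have H C : measurable C -> P C = 1 -> P (~` C) = 0.
  by move=> mC PC; rewrite probability_setC// PC subee.
rewrite -[A `&` B]setCK setCI probability_setC; last first.
  by apply: measurableU; exact: measurableC.
rewrite (_ : P _ = 0) ?sube0//; apply/eqP; rewrite eq_le measure_ge0 andbT.
apply: (@le_trans _ _ (P (~` A) + P (~` B))); last by rewrite !H// adde0.
by apply: measureU2; exact: measurableC.
Qed.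

End measurability_countable.

Section long_jump_bound.
Context {R : realType} {d : nat} (u : 'rV[R]_d).
Local Notation site := (site d).
Variables (delta p M : R).
Hypotheses (delta0 : (0 < delta)%R) (p1 : (1 < p)%R) (M0 : (0 < M)%R).

Let C : R := (1 + \sum_(i < d) `|u ord0 i|)%R.

Lemma dotu_le (z : site) : (dotu z u <= C * (norm1 z)%:R)%R.
Proof.
rewrite /dotu /norm1 natr_sum mulr_sumr; apply: ler_sum => i _.
apply: le_trans (ler_norm _) _; rewrite normrM mulrC.
apply: ler_pM => //; last by rewrite -intr_norm natr_absz.
rewrite /C (bigD1 i)//= addrCA lerDl addr_ge0// sumr_ge0//.
Qed.

Lemma large_displacement (e : R) : (0 < e)%R -> exists T : R, (0 < T)%R /\
  forall y : R, (0 <= y)%R -> (T < C * y)%R -> (C * y <= e * y `^ p)%R.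
Proof.
move=> e0; have C0 : (0 < C)%R by rewrite ltr_wpDr// sumr_ge0.
(* [Y] solves [C = e * Y^(p - 1)]. As [p > 1], the power dominates the linear bound beyond it. *)
pose Y := ((C / e) `^ (p - 1)^-1)%R.
have Y0 : (0 <= Y)%R by exact: powR_ge0.
have p10 : (0 < p - 1)%R by rewrite subr_gt0.
exists (C * Y + 1)%R; split; first by rewrite ltr_pwDr// mulr_ge0// ltW.
move=> y y0 Ty; have yY : (Y < y)%R.
  by rewrite -(ltr_pM2l C0) (le_lt_trans _ Ty)// lerDl.
have y_gt0 : (0 < y)%R by exact: le_lt_trans yY.
have : (Y `^ (p - 1) <= y `^ (p - 1))%R.
  by apply: ge0_ler_powR; rewrite ?nnegrE//; exact: ltW.
rewrite /Y -powRrM mulVf ?gt_eqF// powRr1; last by rewrite divr_ge0// ltW.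
rewrite ler_pdivrMr// => H.
have -> : (y `^ p = y `^ (p - 1) * y)%R.
  have yn0 : (y != 0)%R by rewrite gt_eqF.
  by rewrite -[X in _ = (_ * X)%R](powRr1 (ltW y_gt0)) -powRD ?subrK ?yn0 ?implybT.
by rewrite mulrA ler_pM2r// mulrC.
Qed.

(** The drift is split by displacement along [u]. Jumps below [delta / 4] contribute at most
    [delta / 4], and so do those beyond [T], by the moment bound. The remaining [delta / 2] is at
    most [T] times the mass of the jumps of at least [delta / 4], so that mass is at least
    [delta / (2 * T)]. *)
Lemma long_jump_bound : exists eta c : R, [/\ (0 < eta)%R, (0 < c)%R &
  forall v : site -> R, (forall z, 0 <= v z)%R ->
    \esum_(z in setT) (v z)%:E = 1 ->
    delta%:E <= zsum (fun z => (dotu z u * v z)%R) ->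
    \esum_(z in setT) (((norm1 z)%:R `^ p) * v z)%:E <= (M `^ p)%:E ->
    c%:E <= \esum_(z in setT) (if (eta <= dotu z u)%R then (v z)%:E else 0)].
Proof.
have Mp : (0 < M `^ p)%R by exact: powR_gt0.
have e0 : (0 < delta / 4 / M `^ p)%R by rewrite !divr_gt0.
have [T [T0 HT]] := large_displacement e0.
exists (delta / 4)%R, (delta / 2 / T)%R; split; [by rewrite divr_gt0|by rewrite !divr_gt0|].
move=> v v0 v1 vdelta vM; set a := \esum_(z in _) (if _ then _ else _).
have v0' z : 0 <= (v z)%:E by rewrite lee_fin.
have a0 : 0 <= a by apply: esum_ge0 => z _; case: ifP.
have : delta%:E <= (delta / 4)%:E + (T%:E * a + (delta / 4)%:E).
  apply: (le_trans vdelta); rewrite /zsum.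
  apply: (@le_trans _ _ (\esum_(z in setT) (Num.max (dotu z u * v z) 0)%:E)).
    rewrite -[leRHS]sube0 leeB//; apply: esum_ge0 => z _.
    by rewrite lee_fin le_max lexx orbT.
  have e0' : 0 <= (delta / 4 / M `^ p)%:E by rewrite lee_fin ltW.
  have m0 z : 0 <= ((norm1 z)%:R `^ p * v z)%:E by rewrite lee_fin mulr_ge0// powR_ge0.
  apply: (@le_trans _ _ (\esum_(z in setT) ((delta / 4)%:E * (v z)%:E +
     (T%:E * (if (delta / 4 <= dotu z u)%R then (v z)%:E else 0) +
      (delta / 4 / M `^ p)%:E * ((norm1 z)%:R `^ p * v z)%:E)))).
    apply: le_esum => z _; have d4 : (0 <= delta / 4)%R by rewrite divr_ge0// ltW.
    have pv : (0 <= delta / 4 / M `^ p * ((norm1 z)%:R `^ p * v z))%R.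
      by rewrite mulr_ge0 ?(ltW e0)// mulr_ge0// powR_ge0.
    have dv : (0 <= delta / 4 * v z)%R by rewrite mulr_ge0.
    have [dz|zd] := leP (delta / 4)%R (dotu z u).
      rewrite -!EFinM -!EFinD lee_fin ge_max; apply/andP; split; last first.
        by rewrite !addr_ge0// mulr_ge0// ltW.
      have [zT|Tz] := leP (dotu z u) T.
        have := ler_wpM2r (v0 z) zT; lra.
      have zC := dotu_le z.
      have H := HT _ (ler0n _ (norm1 z)) (lt_le_trans Tz zC).
      have := ler_wpM2r (v0 z) (le_trans zC H).
      have : (0 <= T * v z)%R by rewrite mulr_ge0// ltW.
      by rewrite -!mulrA; lra.
    rewrite mule0 add0e -!EFinM -!EFinD lee_fin ge_max; apply/andP; split; last first.
      by rewrite addr_ge0.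
    have := ler_wpM2r (v0 z) (ltW zd); lra.
  rewrite esumD; last 2 first.
  - by move=> z _; rewrite mule_ge0// lee_fin divr_ge0// ltW.
  - move=> z _; rewrite adde_ge0// mule_ge0//; last by case: ifP.
    by rewrite lee_fin ltW.
  rewrite esumD; last 2 first.
  - move=> z _; rewrite mule_ge0//; last by case: ifP.
    by rewrite lee_fin ltW.
  - by move=> z _; rewrite mule_ge0.
  rewrite !esumZl//; last 3 first.
  - by rewrite lee_fin ltW.
  - by move=> z; case: ifP.
  - by rewrite lee_fin divr_ge0// ltW.
  rewrite v1 mule1 leeD2l// leeD2l//.
  apply: (le_trans (lee_wpmul2l e0' vM)).
  by rewrite -EFinM lee_fin divfK// gt_eqF.
have [->|] := eqVneq a +oo; first by rewrite leey.
rewrite -ltey -ge0_fin_numE// => afin.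
rewrite -(fineK afin) -EFinM -!EFinD !lee_fin => H.
rewrite ler_pdivrMr//; lra.
Qed.

End long_jump_bound.

(** * Almost sure conditions at a site and the modified kernel *)

Section good_laws.
Context {R : realType} {d : nat} (u : 'rV[R]_d).
Local Notation Env := (Env R d).
Local Notation site := (site d).
Variables (delta p M : R).

Definition stochastic_at (x : site) : set Env :=
  [set w | (forall z, (0 <= w x z)%R) /\ \esum_(z in setT) (w x z)%:E = 1].

Definition forward_at0 : set Env :=
  [set w | \esum_(z in [set z : site | (0 <= dotu z u)%R]) (w 0%R z)%:E = 1].

Definition drift_at0 : set Env :=
  [set w | delta%:E <= zsum (fun z => (dotu z u * w 0%R z)%R)].

Definition moment_at0 : set Env :=
  [set w | \esum_(z in setT) (((norm1 z)%:R `^ p) * w 0%R z)%:E <= (M `^ p)%:E].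

Definition good0 : set Env :=
  stochastic_at 0%R `&` forward_at0 `&` (drift_at0 `&` moment_at0).

Definition good (x : site) : set Env := [set w | good0 (shift x w)].

Lemma measurable_coordZ (x z : site) (r : R) :
  measurable_fun setT (fun w : Env => (r * w x z)%R).
Proof. by apply: measurable_funM => //; exact: measurable_coord. Qed.

Lemma measurable_stochastic_at x : measurable (stochastic_at x).
Proof.
rewrite (_ : stochastic_at x = [set w | forall z, (0 <= w x z)%R] `&`
    [set w | \esum_(z in setT) (w x z)%:E = 1])//.
apply: measurableI.
  apply: (measurable_forall (F := fun z => [set w : Env | (0 <= w x z)%R])) => z.
  rewrite (_ : mkset _ = (fun w : Env => w x z) @^-1` [set` `[0%R, +oo[ ]).
    by rewrite -[X in measurable X]setTI; exact: measurable_coord.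
  by apply/seteqP; split => w; rewrite /preimage /= in_itv /= andbT.
have mf : measurable_fun setT (fun w : Env => \esum_(z in setT) (w x z)%:E).
  by apply: measurable_esum_EFin => z; exact: measurable_coord.
rewrite -[X in measurable X]setTI; exact: (mf measurableT [set 1] (emeasurable_set1 _)).
Qed.

Lemma measurable_forward_at0 : measurable forward_at0.
Proof.
have mf : measurable_fun setT (fun w : Env =>
    \esum_(z in [set z : site | (0 <= dotu z u)%R]) (w 0%R z)%:E).
  by apply: measurable_esum_EFin => z; exact: measurable_coord.
rewrite -[X in measurable X]setTI; exact: (mf measurableT [set 1] (emeasurable_set1 _)).
Qed.

Lemma measurable_drift_at0 : measurable drift_at0.
Proof.
have mf : measurable_fun setT (fun w : Env => zsum (fun z => (dotu z u * w 0%R z)%R)).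
  apply: emeasurable_funB; apply: measurable_esum_EFin => z.
    by apply: measurable_maxr; [exact: measurable_coordZ|exact: measurable_cst].
  apply: measurable_maxr; last exact: measurable_cst.
  by apply: measurableT_comp => //; exact: measurable_coordZ.
rewrite -[X in measurable X]setTI; exact: emeasurable_fun_c_infty.
Qed.

Lemma measurable_moment_at0 : measurable moment_at0.
Proof.
have mf : measurable_fun setT (fun w : Env =>
    \esum_(z in setT) (((norm1 z)%:R `^ p) * w 0%R z)%:E).
  by apply: measurable_esum_EFin => z; exact: measurable_coordZ.
rewrite -[X in measurable X]setTI; exact: emeasurable_fun_infty_c.
Qed.

Lemma measurable_good0 : measurable good0.
Proof.
apply: measurableI; apply: measurableI.
- exact: measurable_stochastic_at.
- exact: measurable_forward_at0.
- exact: measurable_drift_at0.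
- exact: measurable_moment_at0.
Qed.

Lemma dep_good0 : dep [set 0%R] good0.
Proof.
move=> w w' ww'; have E : w 0%R = w' 0%R by exact: ww'.
by rewrite /good0 /stochastic_at /forward_at0 /drift_at0 /moment_at0 /setI /mkset E.
Qed.

Lemma measurable_good x : measurable (good x).
Proof.
by rewrite -[good x]setTI; apply: measurable_shift => //; exact: measurable_good0.
Qed.

Lemma dep_good x : dep [set x] (good x).
Proof.
apply: depS (dep_shift dep_good0) => y /= /eqP; rewrite subr_eq0 => /eqP ->.
by [].
Qed.

Lemma good_stochastic x w : good x w -> stochastic_at x w.
Proof.
move=> [[[w0 w1] _] _]; move: w0 w1; rewrite /Defs.shift add0r.
by split.
Qed.

Variable P : probability Env R.
Hypothesis Piid : iid_product P.
Hypothesis Pgood0 : P good0 = 1.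
Variables eta c : R.
Hypothesis eta0 : (0 < eta)%R.
Hypothesis c0 : (0 < c)%R.
Hypothesis long : forall v : site -> R, (forall z, 0 <= v z)%R ->
    \esum_(z in setT) (v z)%:E = 1 ->
    delta%:E <= zsum (fun z => (dotu z u * v z)%R) ->
    \esum_(z in setT) (((norm1 z)%:R `^ p) * v z)%:E <= (M `^ p)%:E ->
    c%:E <= \esum_(z in setT) (if (eta <= dotu z u)%R then (v z)%:E else 0).

Lemma ex_good0 : exists w, good0 w.
Proof.
apply: contrapT => /forallNP N; have : P good0 = 0.
  by rewrite (_ : good0 = set0) ?measure0//; apply/seteqP; split => w // /N.
by rewrite Pgood0 => /eqP; rewrite onee_eq0.
Qed.

Definition default_env : Env := sval (cid ex_good0).

(* Replacing the exceptional laws by a fixed good one lets every estimate on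
   the kernel hold for all environments instead of almost all. *)
Definition jump_kernel (z : site) (w : Env) : \bar R :=
  (if w \in good0 then w 0%R z else default_env 0%R z)%:E.

Lemma jump_kernelE w : exists2 v : Env, good0 v & forall z, jump_kernel z w = (v 0%R z)%:E.
Proof.
have [wg|wg] := boolP (w \in good0).
  by exists w => [|z]; [exact: set_mem|rewrite /jump_kernel wg].
exists default_env => [|z]; last by rewrite /jump_kernel (negbTE wg).
by rewrite /default_env; case: cid.
Qed.

Lemma good_forward (v : Env) z : good0 v -> (dotu z u < 0)%R -> v 0%R z = 0%R.
Proof.
move=> [[[v0 v1] vf] _] z0.
move: v1; rewrite (esumID [set z : site | (0 <= dotu z u)%R]); last first.
  by move=> y _; rewrite lee_fin.
rewrite !setTI vf => E.
have : \esum_(i in ~` [set z : site | (0 <= dotu z u)%R]) (v 0%R i)%:E = 0.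
  move: E; case: (\esum_(i in _) _) => [r| |]//= [/eqP].
  by rewrite eq_sym addrC -subr_eq subrr eq_sym => /eqP ->.
move=> E0; apply/eqP; rewrite eq_le v0 andbT -lee_fin -[leRHS]E0.
apply: esum_ge; exists [set z]; last by rewrite fsbig_set1.
split; first exact: finite_set1.
by move=> _ /= ->; apply/negP; rewrite -ltNge.
Qed.

Lemma jump_forward_kernel : forward_kernel u jump_kernel eta c.
Proof.
split => //.
- move=> z; split=> [w|].
    by have [v [[[v0 _] _] _] ->] := jump_kernelE w; rewrite lee_fin.
  apply/measurable_EFinP; apply: measurable_fun_ifT.
  + apply: (measurable_fun_bool true); rewrite setTI.
    rewrite (_ : _ @^-1` _ = good0); first exact: measurable_good0.
    by apply/seteqP; split => w wg; [exact: (set_mem wg)|exact: (mem_set wg)].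
  + exact: measurable_coord.
  + exact: measurable_cst.
- move=> z w w' ww'; rewrite /jump_kernel (ww' 0%R)//.
  by have -> : (w \in good0) = (w' \in good0) by apply/idP/idP; rewrite !inE (dep_good0 ww').
- move=> w; have [v [[[_ v1] _] _] E] := jump_kernelE w.
  by rewrite -[RHS]v1; apply: eq_esum => z _; rewrite E.
- by move=> z w z0; have [v gv ->] := jump_kernelE w; rewrite (good_forward gv z0).
- move=> w; have [v [[[v0 v1] _] [vd vM]] E] := jump_kernelE w.
  by under eq_esum do rewrite E; exact: long.
Qed.

Lemma P_good x : P (~` good x) = 0.
Proof.
rewrite probability_setC; last exact: measurable_good.
suff -> : P (good x) = 1 by rewrite subee.
rewrite -Pgood0 -(integral_indic_setT P measurable_good0).
rewrite -(iid_shift Piid x (nnm_indic R measurable_good0)).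
rewrite -[LHS](integral_indic_setT P (measurable_good x)).
by [].
Qed.

Section almost_surely_good.
Variable mu : probability Env R.
Hypothesis mu_good : forall x, mu (~` good x) = 0.

Lemma ae_good : {ae mu, forall w, forall x, good x w}.
Proof.
rewrite /almost_everywhere.
suff : mu.-negligible (\bigcup_x ~` good x).
  apply: negligibleS => w /= /existsNP[x Nx]; by exists x.
apply: negligible_countable => x; apply/negligibleP; last exact: mu_good.
exact: measurableC (measurable_good x).
Qed.

Lemma integral_pihat A : measurable A ->
  \int[mu]_w pihat w A = \int[mu]_w transfer jump_kernel (fun v => (\1_A v)%:E) w.
Proof.
move=> mA; have nA := nnm_indic R mA.
have nU := nnm_transfer (fk_nnm jump_forward_kernel) nA.
apply: ae_eq_integral => //.
- apply: measurable_esum_EFin => z; apply: measurable_funM.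
    exact: measurable_coord.
  by apply/measurable_EFinP; case: (nnm_shift z nA).
- by case: nU.
apply: filterS ae_good => w gw _; apply: eq_esum => z _.
have g0 : good0 w by have := gw 0%R; rewrite /good /mkset shift0.
by rewrite /jump_kernel mem_set// EFinM.
Qed.

Lemma ae_pihat A w : (forall x, good x w) ->
  pihat w A = transfer jump_kernel (fun v => (\1_A v)%:E) w.
Proof.
move=> gw; apply: eq_esum => z _.
have g0 : good0 w by have := gw 0%R; rewrite /good /mkset shift0.
by rewrite /jump_kernel mem_set// EFinM.
Qed.

Lemma qlaw_steps w n y : (forall x, good x w) ->
  qlaw w n y = steps jump_kernel n y w.
Proof.
move=> gw; elim: n y => [//|n ih] y; rewrite [LHS]/= [RHS]/=.
apply: eq_esum => x _; rewrite ih; congr (_ * _).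
rewrite /jump_kernel mem_set; last exact: gw.
by rewrite /Defs.shift add0r.
Qed.

End almost_surely_good.

Lemma measurable_qlaw n y : measurable_fun setT (fun w : Env => qlaw w n y).
Proof.
elim: n y => [|n ih] y /=; first exact: measurable_cst.
apply: measurable_esum_in => x; apply: emeasurable_funM => //.
by apply/measurable_EFinP; exact: measurable_coord.
Qed.

Lemma Pn_iter n A : measurable A -> 
  Pn P n A = \int[P]_w iter n (transfer jump_kernel) (fun v => (\1_A v)%:E) w.
Proof.
move=> mA; have nA := nnm_indic R mA.
have npp := fk_nnm jump_forward_kernel.
apply: ae_eq_integral => //.
- apply: measurable_esum_in => x; apply: emeasurable_funM.
    exact: measurable_qlaw.
  by case: (nnm_shift x nA).
- by case: (nnm_iter_transfer n npp nA).
apply: filterS (ae_good P_good) => w gw _.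
rewrite -transfer_steps//; apply: eq_esum => x _.
by rewrite (qlaw_steps _ _ gw).
Qed.

End good_laws.

(** * The theorem *)

Section slabs.
Context {R : realType} {d : nat} (u : 'rV[R]_d).

Lemma frakS_back (k : int) A : (k <= 0)%R -> frakS u k A <->
  measurable A /\ dep (back u `|k|%N) A.
Proof.
move=> k0; rewrite /frakS sfieldP (_ : [set x | _] = back u `|k|%N)//.
have kE : (k%:~R = - `|k|%N%:R :> R)%R.
  by rewrite -{1}[k]opprK -(lez0_abs k0) mulrNz.
by rewrite kE.
Qed.

End slabs.

Section stationary_environment.
Context {R : realType} {d : nat} (u : 'rV[R]_d) (P : probability (Env R d) R)
  (delta p M : R).
Hypothesis Piid : iid_product P.
Hypothesis P_valid : P (@valid_env R d) = 1.
Hypothesis P_forward : P (forward_at0 u) = 1.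
Hypothesis P_drift : P (drift_at0 u delta) = 1.
Hypothesis P_moment : P (moment_at0 p M) = 1.

Lemma valid_envE : @valid_env R d = [set w | forall x, stochastic_at x w].
Proof. by []. Qed.

Lemma measurable_valid_env : measurable (@valid_env R d).
Proof.
rewrite valid_envE; apply: (@measurable_forall _ (Env R d) (site d)) => x.
exact: measurable_stochastic_at.
Qed.

Lemma P_good0 : P (good0 u delta p M) = 1.
Proof.
apply: probability_setI1.
- by apply: measurableI; [exact: measurable_stochastic_at|exact: measurable_forward_at0].
- by apply: measurableI; [exact: measurable_drift_at0|exact: measurable_moment_at0].
- apply: probability_setI1 => //.
  + exact: measurable_stochastic_at.
  + exact: measurable_forward_at0.
  apply/eqP; rewrite eq_le probability_le1; last exact: measurable_stochastic_at.
  rewrite -[leLHS]P_valid; apply: le_measure; rewrite ?inE.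
  + exact: measurable_valid_env.
  + exact: measurable_stochastic_at.
  + by move=> w; apply.
- apply: probability_setI1 => //.
  + exact: measurable_drift_at0.
  + exact: measurable_moment_at0.
Qed.

(** Every site lies in some [back k], so the condition at that site belongs to a sigma-field on
    which [mu] is dominated by [P]. This serves the constructed law and its competitors alike, and
    identifies [pihat] with the modified kernel under both. *)
Lemma null_good (mu : probability (Env R d) R) :
  (forall k : int, (k <= 0)%R -> abs_cont_on mu P (frakS u k)) ->
  forall x, mu (~` good u delta p M x) = 0.
Proof.
move=> ac x; have [k kx] := back_cover u x.
apply: (ac (- k%:Z)%R); rewrite ?oppr_le0//; last exact: (P_good Piid P_good0).
apply/frakS_back; rewrite ?oppr_le0//; split.
  by apply: measurableC; exact: measurable_good.
rewrite abszN absz_nat => w w' ww'; congr (~ _).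
by apply: (@dep_good _ _ u delta p M x) => _ /= ->; exact: ww'.
Qed.

Lemma valid_env1 (mu : probability (Env R d) R) :
  (forall x, mu (~` good u delta p M x) = 0) -> mu (@valid_env R d) = 1.
Proof.
move=> mug; have [A [mA A0 sA]] := ae_good mug.
have mV := measurable_valid_env.
rewrite -[@valid_env R d]setCK probability_setC; last exact: measurableC.
rewrite [X in _ - X](_ : _ = 0) ?sube0//.
apply/eqP; rewrite eq_le measure_ge0 andbT -[leRHS]A0.
apply: le_measure; rewrite ?inE//; first exact: measurableC.
move=> w /= Nv; apply: sA => /= gw; apply: Nv => x.
exact: good_stochastic (gw x).
Qed.

End stationary_environment.

Local Close Scope ereal_scope.

Theorem theorem3p1 (R : realType) (d : nat) (hd : (1 <= d)%N)
  (u : 'rV[R]_d) (hu : u != 0)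
  (P : probability (Env R d) R)
  (HOmega : P (@valid_env R d) = 1%E)
  (Hiid : iid_product P)
  (Hforbid : P [set w : Env R d |
                 esum [set z : site d | 0 <= dotu z u] (fun z => (w 0 z)%:E) = 1%E] = 1%E)
  (delta : R) (hdelta : 0 < delta)
  (HN : P [set w : Env R d | (delta%:E <= zsum (fun z => (dotu z u * w 0 z)%R))%E] = 1%E)
  (p M : R) (hp : 1 < p) (hM : 0 < M)
  (HM : P [set w : Env R d |
            (esum setT (fun z => (((norm1 z)%:R `^ p) * w 0 z)%:E) <= (M `^ p)%:E)%E]
        = 1%E) :
  exists Pinf : probability (Env R d) R,
    Pinf (@valid_env R d) = 1%E /\
    pihat_invariant Pinf /\
    (* (a) *)
    ((forall k : int, k <= 0 -> abs_cont_on Pinf P (frakS u k)) /\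
     (forall A, frakS u 1 A -> P A = Pinf A) /\
     (abs_cont_on Pinf P (frakS u 0) /\ abs_cont_on P Pinf (frakS u 0))) /\
    (* (b) *)
    pihat_ergodic Pinf /\
    (* (c) *)
    ((forall Q : probability (Env R d) R,
        pihat_invariant Q ->
        (forall k : int, k <= 0 -> abs_cont_on Q P (frakS u k)) ->
        pihat_ergodic Q ->
        forall A : set (Env R d), measurable A -> Q A = Pinf A) /\
     (forall (k : int) (A : set (Env R d)), k <= 0 -> frakS u k A ->
        (fun n => Pn P n A) @ \oo --> Pinf A)).
Proof.
have [eta [c [eta0 c0 long]]] := long_jump_bound u hdelta hp hM.
have Pg0 := P_good0 HOmega Hforbid HN HM.
have fk := jump_forward_kernel Pg0 eta0 c0 long.
have Pg := P_good Hiid Pg0.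
have P_ge0 x z : P [set w : Env R d | w x z < 0] = 0%E.
  apply/eqP; rewrite eq_le measure_ge0 andbT -(Pg x).
  apply: le_measure; rewrite ?inE.
  - exact: measurable_negative.
  - by apply: measurableC; exact: measurable_good.
  - by move=> w /= wxz /good_stochastic[/(_ z) w0 _]; move: w0; rewrite leNgt wxz.
have [Q QE] := stationary_law fk Hiid P_ge0.
have Qac (k : int) : k <= 0 -> abs_cont_on Q P (frakS u k).
  by move=> k0 A /(frakS_back _ _ k0)[mA dA]; exact: (Q_null fk Hiid QE mA dA).
have S0 A : frakS u 0 A <-> measurable A /\ dep (halfspace u 0) A.
  by rewrite (frakS_back u A (lexx 0)) /back oppr0.
have Qg := null_good Hiid HOmega Hforbid HN HM Qac.
exists Q; split; first exact: valid_env1 Qg.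
split.
  move=> A mA; rewrite (integral_pihat Pg0 eta0 c0 long Qg mA).
  by rewrite (Q_invariant fk Hiid QE (nnm_indic R mA)) integral_indic_setT.
split.
  split; first exact: Qac.
  split; last first.
    split; first exact: Qac.
    by move=> A /S0[mA dA]; exact: (Q_null_inv fk Hiid QE).
  move=> A /sfieldP[mA dA]; apply: (Q_fresh fk Hiid QE mA).
  (* Sites at level at least [1] lie strictly ahead of the origin. *)
  by apply: depS dA => x; rewrite /mkset; exact: lt_le_trans.
split.
  move=> A mA inv; apply: (Q_ergodic fk Hiid QE mA).
  apply: filterS2 (ae_good Qg) inv => w gw <-.
  by rewrite (ae_pihat Pg0 A gw).
split.
  move=> Q' inv ac _ A mA; apply: (stationary_unique fk Hiid QE _ _ mA).
    move=> B mB; rewrite -inv//.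
    by rewrite (integral_pihat Pg0 eta0 c0 long (null_good Hiid HOmega Hforbid HN HM ac) mB).
  by move=> B mB dB; apply: (ac 0) => //; exact/S0.
move=> k A k0 /(frakS_back _ _ k0)[mA dA].
have uA := unit_local_indic mA dA; have [nA A1 _] := uA.
apply: tends_cvg.
- move=> n; rewrite (Pn_iter Hiid Pg0 eta0 c0 long n mA).
  have nU := nnm_iter_transfer n (fk_nnm fk) nA.
  rewrite ge0_fin_numE; last by apply: integral_ge0 => w _; exact: nnm_ge0 nU.
  apply: le_lt_trans (ltry 1).
  by apply: integral_le_cst => // w; exact: (iter_transfer_le fk).
- exact: fin_num_measure.
- rewrite (QE _ _ mA dA); have := slab_tends fk Hiid uA; congr tends.
  by apply/funext => n; rewrite (Pn_iter Hiid Pg0 eta0 c0 long n mA).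
Qed.
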